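(* Let $\alpha\in(0,2)$, let $\Omega=(a_x,b_x)\times(a_y,b_y)\times(a_z,b_z)\subset\mathbb{R}^3$ be a bounded box, and let $u:\mathbb{R}^3\to\mathbb{R}$ satisfy $u=0$ on $\mathbb{R}^3\setminus\Omega$. Let $0<\varepsilon\le 1+\lfloor\alpha\rfloor-\alpha$ and assume $u\in C^{\lfloor\alpha\rfloor,\,\alpha-\lfloor\alpha\rfloor+\varepsilon}(\mathbb{R}^3)$. Then for every splitting parameter $\gamma\in(\alpha,2]$ there is a constant $C>0$ independent of $h$ such that, for all sufficiently small $h=L/N$, $$\sup_{\mathbf{x}\in\Omega}\big|(-\Delta)^{\alpha/2}u(\mathbf{x})-(-\Delta)^{\alpha/2}_{h,\gamma}u(\mathbf{x})\big|\le C h^{\varepsilon}.$$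
   Context: $\lfloor\cdot\rfloor$ is the floor function. For $k\in\mathbb{N}_0$, $s\in(0,1]$, $C^{k,s}(\mathbb{R}^d)$ is the space of functions $\mathbb{R}^d\to\mathbb{R}$ with continuous partial derivatives of all orders $\le k$ whose $k$-th order partial derivatives are uniformly Hölder continuous with exponent $s$. The fractional Laplacian is $(-\Delta)^{\alpha/2}u(\mathbf{x})=c_{d,\alpha}\,\mathrm{P.V.}\int_{\mathbb{R}^d}\frac{u(\mathbf{x})-u(\mathbf{x}')}{|\mathbf{x}-\mathbf{x}'|^{d+\alpha}}\,d\mathbf{x}'$ with $c_{d,\alpha}=\frac{2^{\alpha-1}\alpha\,\Gamma((d+\alpha)/2)}{\pi^{d/2}\Gamma(1-\alpha/2)}$. Three-dimensional discrete operator: let $L=\max\{b_x-a_x,b_y-a_y,b_z-a_z\}$, $N$ a positive integer, $h=L/N$, $\boldsymbol{\xi}_{ijk}=(ih,jh,kh)$, $I_{ijk}=[ih,(i+1)h]\times[jh,(j+1)h]\times[kh,(k+1)h]$, $D_1=(0,L)^3$, $D_2=[0,\infty)^3\setminus D_1$. For $\mathbf{x}=(x,y,z)$, $\boldsymbol{\xi}=(\xi,\eta,\zeta)\in[0,\infty)^3\setminus\{0\}$ set $\psi_\gamma(\mathbf{x},\boldsymbol{\xi})=|\boldsymbol{\xi}|^{-\gamma}\Big(\sum_{m,n,s\in\{0,1\}}u(x+(-1)^m\xi,\,y+(-1)^n\eta,\,z+(-1)^s\zeta)-8u(\mathbf{x})\Big)$ and $\omega_\gamma(\boldsymbol{\xi})=|\boldsymbol{\xi}|^{\gamma-(3+\alpha)}$.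 For $(m,n,s)\in\{0,1\}^3\setminus\{(0,0,0)\}$ let $c^\gamma_{mns}=1$ if $\gamma\in(\alpha,2)$; if $\gamma=2$, $c^2_{mns}=8/3$ when $m+n+s=1$ and $c^2_{mns}=0$ when $m+n+s>1$. Define, for $\mathbf{x}\in\Omega$, $$(-\Delta)^{\alpha/2}_{h,\gamma}u(\mathbf{x})=-c_{3,\alpha}\Big[\tfrac18\Big(\sum_{(m,n,s)\ne(0,0,0)}c^\gamma_{mns}\psi_\gamma(\mathbf{x},\boldsymbol{\xi}_{mns})\Big)\int_{I_{000}}\omega_\gamma\,d\boldsymbol{\xi}+\tfrac18\sum_{\substack{0\le i,j,k\le N-1\\(i,j,k)\ne(0,0,0)}}\Big(\sum_{m,n,s\in\{0,1\}}\psi_\gamma(\mathbf{x},\boldsymbol{\xi}_{(i+m)(j+n)(k+s)})\Big)\int_{I_{ijk}}\omega_\gamma\,d\boldsymbol{\xi}-8u(\mathbf{x})\int_{D_2}|\boldsymbol{\xi}|^{-(3+\alpha)}d\boldsymbol{\xi}\Big].$$ *)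

(* Defs.v *)
From Stdlib Require Import Reals Lra ZArith ClassicalEpsilon.
Open Scope R_scope.

Definition pt : Type := (R * R * R)%type.
Definition mkpt (x y z : R) : pt := (x, y, z).
Definition px (p : pt) : R := fst (fst p).
Definition py (p : pt) : R := snd (fst p).
Definition pz (p : pt) : R := snd p.
Definition padd (p q : pt) : pt := mkpt (px p + px q) (py p + py q) (pz p + pz q).
Definition psub (p q : pt) : pt := mkpt (px p - px q) (py p - py q) (pz p - pz q).
Definition pscal (t : R) (p : pt) : pt := mkpt (t * px p) (t * py p) (t * pz p).
Definition pnorm (p : pt) : R := sqrt (px p ^ 2 + py p ^ 2 + pz p ^ 2).
Definition origin : pt := mkpt 0 0 0.

Definition rpow (b e : R) : R := if Rlt_dec 0 b then Rpower b e else 0.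

Definition Rfloor (r : R) : R := IZR (Int_part r).

Definition ind (P : Prop) : R :=
  if excluded_middle_informative P then 1 else 0.

Fixpoint sumR (n : nat) (f : nat -> R) : R :=
  match n with O => 0 | S m => sumR m f + f m end.

(* ---------- limits (values chosen by epsilon; they are the limits when they exist) ---------- *)
Definition is_lim_pinf (F : R -> R) (l : R) : Prop :=
  forall eps, eps > 0 -> exists M, forall r, r > M -> Rabs (F r - l) < eps.
Definition is_lim_0p (F : R -> R) (l : R) : Prop :=
  forall eps, eps > 0 -> exists d, d > 0 /\ forall r, 0 < r < d -> Rabs (F r - l) < eps.
Definition lim_pinf (F : R -> R) : R := epsilon (inhabits 0) (is_lim_pinf F).
Definition lim_0p (F : R -> R) : R := epsilon (inhabits 0) (is_lim_0p F).

Definition is_int1 (f : R -> R) (a b I : R) : Prop :=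
  forall eps, eps > 0 -> exists n0 : nat, forall n : nat, (n0 <= n)%nat -> (0 < n)%nat ->
    forall tag : nat -> R,
      (forall i, (i < n)%nat ->
         a + INR i * (b - a) / INR n <= tag i <= a + INR (S i) * (b - a) / INR n) ->
      Rabs (sumR n (fun i => f (tag i)) * ((b - a) / INR n) - I) < eps.
Definition int1 (f : R -> R) (a b : R) : R := epsilon (inhabits 0) (is_int1 f a b).

Definition in_cbox (a b p : pt) : Prop :=
  px a <= px p <= px b /\ py a <= py p <= py b /\ pz a <= pz p <= pz b.
Definition cell_lo (a b : pt) (n i j k : nat) : pt :=
  mkpt (px a + INR i * (px b - px a) / INR n)
       (py a + INR j * (py b - py a) / INR n)
       (pz a + INR k * (pz b - pz a) / INR n).
Definition is_box_int (f : pt -> R) (a b : pt) (I : R) : Prop :=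
  forall eps, eps > 0 -> exists n0 : nat, forall n : nat, (n0 <= n)%nat -> (0 < n)%nat ->
    forall tag : nat -> nat -> nat -> pt,
      (forall i j k, (i < n)%nat -> (j < n)%nat -> (k < n)%nat ->
         in_cbox (cell_lo a b n i j k) (cell_lo a b n (S i) (S j) (S k)) (tag i j k)) ->
      Rabs (sumR n (fun i => sumR n (fun j => sumR n (fun k => f (tag i j k))))
              * ((px b - px a) * (py b - py a) * (pz b - pz a) / (INR n ^ 3)) - I) < eps.
Definition box_int (f : pt -> R) (a b : pt) : R := epsilon (inhabits 0) (is_box_int f a b).

(* ---------- (improper / principal value) integral over R^3, possibly singular at c:
   lim_{rho->0+} lim_{R->oo} int_{cube(c,R)} g * 1_{|p-c|>rho} ---------- *)
Definition improper_int (c : pt) (g : pt -> R) : R :=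
  lim_0p (fun rho =>
    lim_pinf (fun Rr =>
      box_int (fun p => if Rlt_dec rho (pnorm (psub p c)) then g p else 0)
              (psub c (mkpt Rr Rr Rr)) (padd c (mkpt Rr Rr Rr)))).

Definition Gamma (s : R) : R :=
  lim_0p (fun a => lim_pinf (fun b => int1 (fun t => rpow t (s - 1) * exp (- t)) a b)).
Definition c3 (alpha : R) : R :=
  rpow 2 (alpha - 1) * alpha * Gamma ((3 + alpha) / 2)
  / (rpow PI (3 / 2) * Gamma (1 - alpha / 2)).

Definition frac_lap (alpha : R) (u : pt -> R) (x : pt) : R :=
  c3 alpha * improper_int x (fun x' => (u x - u x') * rpow (pnorm (psub x x')) (- (3 + alpha))).

Definition cont3 (f : pt -> R) : Prop :=
  forall x eps, eps > 0 -> exists d, d > 0 /\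
    forall y, pnorm (psub y x) < d -> Rabs (f y - f x) < eps.
Definition unif_holder (f : pt -> R) (s : R) : Prop :=
  exists M, forall x y, Rabs (f x - f y) <= M * rpow (pnorm (psub x y)) s.
Definition unit_vec (d : nat) : pt :=
  match d with O => mkpt 1 0 0 | S O => mkpt 0 1 0 | _ => mkpt 0 0 1 end.
Definition has_partial (f : pt -> R) (d : nat) (x : pt) (l : R) : Prop :=
  derivable_pt_lim (fun t => f (padd x (pscal t (unit_vec d)))) 0 l.
Fixpoint Ck_s (k : nat) (s : R) (f : pt -> R) : Prop :=
  match k with
  | O => cont3 f /\ unif_holder f s
  | S k' => cont3 f /\
      forall d : nat, (d < 3)%nat ->
        exists g : pt -> R, (forall x, has_partial f d x (g x)) /\ Ck_s k' s g
  end.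

Definition sgn (m : bool) : R := if m then -1 else 1.
Definition b2n (m : bool) : nat := if m then 1%nat else 0%nat.
Definition sum8 (F : bool -> bool -> bool -> R) : R :=
  F false false false + F false false true + F false true false + F false true true +
  F true false false + F true false true + F true true false + F true true true.

Definition psi (u : pt -> R) (gamma : R) (x xi : pt) : R :=
  rpow (pnorm xi) (- gamma) *
  (sum8 (fun m n s => u (mkpt (px x + sgn m * px xi) (py x + sgn n * py xi)
                              (pz x + sgn s * pz xi))) - 8 * u x).
Definition omega (alpha gamma : R) (xi : pt) : R := rpow (pnorm xi) (gamma - (3 + alpha)).

(* c^gamma_{mns} for (m,n,s) <> (0,0,0) and gamma in (alpha,2] *)
Definition cg (gamma : R) (m n s : bool) : R :=
  if Req_EM_T gamma 2
  then (if Nat.eqb (b2n m + b2n n + b2n s) 1 then 8 / 3 else 0)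
  else 1.

Definition gridpt (h : R) (i j k : nat) : pt := mkpt (INR i * h) (INR j * h) (INR k * h).
Definition int_cell (alpha gamma h : R) (i j k : nat) : R :=
  improper_int origin (fun xi =>
    ind (in_cbox (gridpt h i j k) (gridpt h (S i) (S j) (S k)) xi) * omega alpha gamma xi).
Definition int_D2 (alpha L : R) : R :=
  improper_int origin (fun xi =>
    ind ((0 <= px xi /\ 0 <= py xi /\ 0 <= pz xi) /\
         ~ (0 < px xi < L /\ 0 < py xi < L /\ 0 < pz xi < L))
    * rpow (pnorm xi) (- (3 + alpha))).

Definition disc_op (alpha gamma L : R) (N : nat) (u : pt -> R) (x : pt) : R :=
  let h := L / INR N in
  - c3 alpha *
  ( / 8 * (sum8 (fun m n s =>
              if (m || n || s)%bool
              then cg gamma m n s * psi u gamma x (gridpt h (b2n m) (b2n n) (b2n s))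
              else 0))
        * int_cell alpha gamma h 0 0 0
    + / 8 * sumR N (fun i => sumR N (fun j => sumR N (fun k =>
              if (Nat.eqb i 0 && Nat.eqb j 0 && Nat.eqb k 0)%bool then 0
              else sum8 (fun m n s =>
                     psi u gamma x (gridpt h (i + b2n m) (j + b2n n) (k + b2n s)))
                   * int_cell alpha gamma h i j k)))
    - 8 * u x * int_D2 alpha L ).

Definition in_box_open (ax bx ay by_ az bz : R) (p : pt) : Prop :=
  ax < px p < bx /\ ay < py p < by_ /\ az < pz p < bz.

(* Main.v *)
(** Up to the factor [c3 alpha], the reflections of the coordinates turn the principal value integral
    into the integral over the positive octant of [- S(xi) |xi|^-(3+alpha)], where [S] is the sum of the
    eight values [u(x +- xi)] minus [8 u(x)]. This is absolutely convergent since [|S(xi)| <= K |xi|^s]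
    with [s = alpha + eps], and on the outer region [S = - 8 u(x)], so the error is the quadrature error
    on the cells. On the cell at the origin every term is crudely [O(h^eps)]. On any other cell the
    integrand is averaged with its reflection about the centre of the cell; what remains is controlled by
    second differences of [S |xi|^-gamma] and by products of two first differences, and is bounded by
    [C h^s |xi|^-(3+alpha)], whose integral over [|xi| >= h] is [O(h^eps)].

    Riemann integrability is obtained by squeezing between uniformly continuous functions of bounded
    support, whose integral is an iterated one-dimensional integral. *)

From Stdlib Require Import Reals ZArith Lra Lia List Classical ClassicalEpsilon FunctionalExtensionality.
From Coquelicot Require Import Coquelicot.
Require Import Defs.
Open Scope R_scope.

(** * Finite sums and Riemann sums *)

(** Every integral and limit in the definitions is chosen by [epsilon], so a value can be used only
    after its existence is proved. The proof therefore works with relations ([is_box_int], [RI],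
    [Imp]) that contain existence, and returns to [improper_int] only through [Imp_improper]. The
    truncations in [improper_int] are a cube outside and a Euclidean ball inside; both are symmetric
    under reflections of the coordinates, so the passage to the octant is exact before any limit is
    taken. Since [u] has at most one derivative, all its smoothness is expressed by finite
    differences of order s = alpha + eps <= 2 ([regular]), in one form for both values of
    floor(alpha). Uniformity in x and h is built into the order of quantifiers: the estimates fix
    their constant before the function, the scale and the truncation radii. *)

Lemma sumR_ext n f g : (forall i, (i < n)%nat -> f i = g i) -> sumR n f = sumR n g.
Proof.
  induction n as [|n IH]; intros H; simpl; [reflexivity|].
  rewrite IH, (H n); auto.
Qed.

Lemma sumR_plus n f g : sumR n (fun i => f i + g i) = sumR n f + sumR n g.
Proof. induction n as [|n IH]; simpl; [lra|rewrite IH; lra]. Qed.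

Lemma sumR_scal n k f : sumR n (fun i => k * f i) = k * sumR n f.
Proof. induction n as [|n IH]; simpl; [lra|rewrite IH; lra]. Qed.

Lemma sumR_le n f g : (forall i, (i < n)%nat -> f i <= g i) -> sumR n f <= sumR n g.
Proof.
  induction n as [|n IH]; intros H; simpl; [lra|].
  apply Rplus_le_compat; auto.
Qed.

Lemma sumR_abs n f : Rabs (sumR n f) <= sumR n (fun i => Rabs (f i)).
Proof.
  induction n as [|n IH]; simpl; [rewrite Rabs_R0; lra|].
  eapply Rle_trans; [apply Rabs_triang|lra].
Qed.

Lemma sumR_nonneg n f : (forall i, (i < n)%nat -> 0 <= f i) -> 0 <= sumR n f.
Proof.
  intros H. induction n as [|n IH]; simpl; [lra|].
  assert (0 <= f n) by auto. assert (0 <= sumR n f) by auto. lra.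
Qed.

Lemma sumR_term_le n f j : (forall i, (i < n)%nat -> 0 <= f i) -> (j < n)%nat -> f j <= sumR n f.
Proof.
  intros H Hj. induction n as [|n IH]; [lia|simpl].
  assert (0 <= f n) by auto.
  assert (0 <= sumR n f) by (apply sumR_nonneg; auto).
  destruct (Nat.eq_dec j n) as [->|]; [lra|].
  assert (f j <= sumR n f) by (apply IH; [auto|lia]). lra.
Qed.

Definition sum3 (n : nat) (F : nat -> nat -> nat -> R) : R :=
  sumR n (fun i => sumR n (fun j => sumR n (fun k => F i j k))).

Lemma sum3_ext n F G :
  (forall i j k, (i < n)%nat -> (j < n)%nat -> (k < n)%nat -> F i j k = G i j k) ->
  sum3 n F = sum3 n G.
Proof.
  intros H. unfold sum3. apply sumR_ext; intros. apply sumR_ext; intros. apply sumR_ext; auto.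
Qed.

Lemma sum3_plus n F G : sum3 n (fun i j k => F i j k + G i j k) = sum3 n F + sum3 n G.
Proof.
  unfold sum3. rewrite <- sumR_plus. apply sumR_ext; intros.
  rewrite <- sumR_plus. apply sumR_ext; intros. apply sumR_plus.
Qed.

Lemma sum3_scal n c F : sum3 n (fun i j k => c * F i j k) = c * sum3 n F.
Proof.
  unfold sum3. rewrite <- sumR_scal. apply sumR_ext; intros.
  rewrite <- sumR_scal. apply sumR_ext; intros. apply sumR_scal.
Qed.

Lemma sum3_le n F G :
  (forall i j k, (i < n)%nat -> (j < n)%nat -> (k < n)%nat -> F i j k <= G i j k) ->
  sum3 n F <= sum3 n G.
Proof.
  intros H. unfold sum3. apply sumR_le; intros. apply sumR_le; intros. apply sumR_le; auto.
Qed.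

Lemma sum3_abs n F : Rabs (sum3 n F) <= sum3 n (fun i j k => Rabs (F i j k)).
Proof.
  unfold sum3. eapply Rle_trans; [apply sumR_abs|]. apply sumR_le; intros.
  eapply Rle_trans; [apply sumR_abs|]. apply sumR_le; intros. apply sumR_abs.
Qed.

(** * Riemann sums over boxes *)

Definition tagging (a b : pt) (n : nat) (tag : nat -> nat -> nat -> pt) : Prop :=
  forall i j k, (i < n)%nat -> (j < n)%nat -> (k < n)%nat ->
    in_cbox (cell_lo a b n i j k) (cell_lo a b n (S i) (S j) (S k)) (tag i j k).

Definition nondeg (a b : pt) : Prop := px a < px b /\ py a < py b /\ pz a < pz b.

Lemma box_scal a b f I c : is_box_int f a b I -> is_box_int (fun p => c * f p) a b (c * I).
Proof.
  intros H e He.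
  destruct (H (e / (Rabs c + 1))) as [n0 Hn0].
  { apply Rdiv_lt_0_compat; [lra|]. pose proof (Rabs_pos c); lra. }
  exists n0. intros n Hn Hn' tag Ht. specialize (Hn0 n Hn Hn' tag Ht).
  pose proof (sum3_scal n c (fun i j k => f (tag i j k))) as Hs. unfold sum3 in Hs. rewrite Hs.
  match type of Hn0 with Rabs ?x < _ => set (X := x) in *; replace (_ * _ * _ - _) with (c * X) by (unfold X; ring) end.
  rewrite Rabs_mult. pose proof (Rabs_pos c). pose proof (Rabs_pos X).
  apply Rlt_div_r in Hn0; [|lra]. nra.
Qed.

Lemma box_plus a b f g I J :
  is_box_int f a b I -> is_box_int g a b J -> is_box_int (fun p => f p + g p) a b (I + J).
Proof.
  intros Hf Hg e He.
  destruct (Hf (e / 2)) as [n1 H1]; [lra|]. destruct (Hg (e / 2)) as [n2 H2]; [lra|].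
  exists (n1 + n2)%nat. intros n Hn Hn' tag Ht.
  specialize (H1 n ltac:(lia) Hn' tag Ht). specialize (H2 n ltac:(lia) Hn' tag Ht).
  pose proof (sum3_plus n (fun i j k => f (tag i j k)) (fun i j k => g (tag i j k))) as Hs.
  unfold sum3 in Hs. rewrite Hs.
  match type of H1 with Rabs ?x < _ => match type of H2 with Rabs ?y < _ =>
     replace (_ - (I + J)) with (x + y) by ring end end.
  eapply Rle_lt_trans; [apply Rabs_triang|lra].
Qed.

Definition off (l : list R) (p : pt) : Prop :=
  ~ In (px p) l /\ ~ In (py p) l /\ ~ In (pz p) l.

(** Each point of the list is avoided by passing to a half of the interval that does not contain
    it. *)
Lemma interval_avoids_list (l : list R) : forall lo hi, lo < hi -> exists t, lo < t < hi /\ ~ In t l.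
Proof.
  induction l as [|a l IH]; intros lo hi H.
  - exists ((lo + hi) / 2). split; [lra|intros []].
  - destruct (Rle_dec a ((lo + hi) / 2)) as [Ha|Ha].
    + destruct (IH ((lo + hi) / 2) hi) as [t [Ht Hl]]; [lra|].
      exists t. split; [lra|]. intros [E|E]; [lra|auto].
    + destruct (IH lo ((lo + hi) / 2)) as [t [Ht Hl]]; [lra|].
      exists t. split; [lra|]. intros [E|E]; [lra|auto].
Qed.

Lemma mesh_step_lt x y n i : x < y -> (0 < n)%nat ->
  x + INR i * (y - x) / INR n < x + INR (S i) * (y - x) / INR n.
Proof.
  intros H Hn. rewrite S_INR. apply Rplus_lt_compat_l.
  unfold Rdiv. apply Rmult_lt_compat_r; [apply Rinv_0_lt_compat, lt_0_INR; lia|nra].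
Qed.

Lemma tagging_off l a b n : nondeg a b -> (0 < n)%nat ->
  exists tag, tagging a b n tag /\ forall i j k, (i < n)%nat -> (j < n)%nat -> (k < n)%nat -> off l (tag i j k).
Proof.
  intros [Hx [Hy Hz]] Hn.
  assert (H1 : forall x y, x < y -> exists t : nat -> R, forall i,
     (x + INR i * (y - x) / INR n < t i < x + INR (S i) * (y - x) / INR n) /\ ~ In (t i) l).
  { intros x y Hxy. apply (choice (fun i t => (x + INR i * (y - x) / INR n < t < x + INR (S i) * (y - x) / INR n) /\ ~ In t l)).
    intros i. apply interval_avoids_list, mesh_step_lt; auto. }
  destruct (H1 _ _ Hx) as [t1 T1], (H1 _ _ Hy) as [t2 T2], (H1 _ _ Hz) as [t3 T3].
  exists (fun i j k => mkpt (t1 i) (t2 j) (t3 k)). split.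
  - intros i j k _ _ _. destruct (T1 i), (T2 j), (T3 k).
    unfold in_cbox, cell_lo, mkpt, px, py, pz in *; simpl in *. lra.
  - intros i j k _ _ _. destruct (T1 i), (T2 j), (T3 k). repeat split; assumption.
Qed.

(* Riemann sums may be tagged off finitely many coordinate planes, so these never matter. *)
Lemma box_le_off l a b f g I J : nondeg a b -> is_box_int f a b I -> is_box_int g a b J ->
  (forall p, off l p -> f p <= g p) -> I <= J.
Proof.
  intros Hab Hf Hg H. apply Rnot_lt_le. intros Hlt.
  destruct (Hf ((I - J) / 2)) as [n1 H1]; [lra|]. destruct (Hg ((I - J) / 2)) as [n2 H2]; [lra|].
  destruct (tagging_off l a b (n1 + n2 + 1) Hab ltac:(lia)) as [tag [Ht Ho]].
  specialize (H1 (n1 + n2 + 1)%nat ltac:(lia) ltac:(lia) tag Ht).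
  specialize (H2 (n1 + n2 + 1)%nat ltac:(lia) ltac:(lia) tag Ht).
  set (n := (n1 + n2 + 1)%nat) in *.
  pose proof (sum3_le n (fun i j k => f (tag i j k)) (fun i j k => g (tag i j k))) as Hs.
  unfold sum3 in Hs. specialize (Hs ltac:(intros; auto)).
  apply Rabs_def2 in H1. apply Rabs_def2 in H2.
  assert (0 < (px b - px a) * (py b - py a) * (pz b - pz a) / INR n ^ 3).
  { destruct Hab as [? [? ?]]. apply Rdiv_lt_0_compat.
    - repeat apply Rmult_lt_0_compat; lra.
    - apply pow_lt, lt_0_INR. lia. }
  nra.
Qed.

Lemma box_unique a b f I J : nondeg a b -> is_box_int f a b I -> is_box_int f a b J -> I = J.
Proof.
  intros. apply Rle_antisym; eapply (box_le_off nil); eauto; intros; lra.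
Qed.

(** The sup norm suits boxes and changes of a single coordinate; the Euclidean norm enters only
    through the kernel and the excluded ball. *)
Definition supn (p : pt) : R := Rmax (Rabs (px p)) (Rmax (Rabs (py p)) (Rabs (pz p))).

Lemma supn_le p r : supn p <= r <-> Rabs (px p) <= r /\ Rabs (py p) <= r /\ Rabs (pz p) <= r.
Proof.
  unfold supn. split.
  - intros H. pose proof (Rmax_l (Rabs (px p)) (Rmax (Rabs (py p)) (Rabs (pz p)))).
    pose proof (Rmax_r (Rabs (px p)) (Rmax (Rabs (py p)) (Rabs (pz p)))).
    pose proof (Rmax_l (Rabs (py p)) (Rabs (pz p))). pose proof (Rmax_r (Rabs (py p)) (Rabs (pz p))). lra.
  - intros [H1 [H2 H3]]. repeat apply Rmax_lub; assumption.
Qed.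

Definition cube_lo (R : R) : pt := mkpt (-R) (-R) (-R).
Definition cube_hi (R : R) : pt := mkpt R R R.

Lemma cube_nondeg R : 0 < R -> nondeg (cube_lo R) (cube_hi R).
Proof. intros. unfold nondeg, cube_lo, cube_hi, mkpt, px, py, pz; simpl; lra. Qed.

(** * Uniformly continuous functions *)

Definition ucont (f : pt -> R) : Prop :=
  forall e, 0 < e -> exists d, 0 < d /\
    forall p q, supn (psub p q) < d -> Rabs (f p - f q) < e.

Definition bounded_fun (f : pt -> R) : Prop := exists M, forall p, Rabs (f p) <= M.

Definition BUC f := ucont f /\ bounded_fun f.

Definition Cc f := BUC f /\ exists R, forall p, R < supn p -> f p = 0.

Lemma bounded_fun_pos f : bounded_fun f -> exists M, 0 < M /\ forall p, Rabs (f p) <= M.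
Proof.
  intros [M H]. exists (Rabs M + 1). split; [pose proof (Rabs_pos M); lra|].
  intros p. specialize (H p). pose proof (Rle_abs M). lra.
Qed.

Lemma ucont_plus f g : ucont f -> ucont g -> ucont (fun p => f p + g p).
Proof.
  intros Hf Hg e He. destruct (Hf (e/2)) as [d1 [D1 H1]]; [lra|]. destruct (Hg (e/2)) as [d2 [D2 H2]]; [lra|].
  exists (Rmin d1 d2). split; [apply Rmin_pos; auto|]. intros p q H.
  pose proof (Rmin_l d1 d2). pose proof (Rmin_r d1 d2).
  specialize (H1 p q ltac:(lra)). specialize (H2 p q ltac:(lra)).
  replace (f p + g p - (f q + g q)) with ((f p - f q) + (g p - g q)) by ring.
  eapply Rle_lt_trans; [apply Rabs_triang|lra].
Qed.

Lemma BUC_const c : BUC (fun _ => c).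
Proof.
  split; [|exists (Rabs c); intros; lra].
  intros e He. exists 1. split; [lra|]. intros. replace (c - c) with 0 by ring. rewrite Rabs_R0. lra.
Qed.

Lemma BUC_plus f g : BUC f -> BUC g -> BUC (fun p => f p + g p).
Proof.
  intros [F [M HM]] [G [N HN]]. split; [apply ucont_plus; auto|].
  exists (M + N). intros p. eapply Rle_trans; [apply Rabs_triang|]. specialize (HM p). specialize (HN p). lra.
Qed.

Lemma BUC_mult f g : BUC f -> BUC g -> BUC (fun p => f p * g p).
Proof.
  intros [F HF] [G HG]. destruct (bounded_fun_pos _ HF) as [M [M0 HM]], (bounded_fun_pos _ HG) as [N [N0 HN]].
  split.
  - intros e He.
    destruct (F (e / (2 * N))) as [d1 [D1 H1]]; [apply Rdiv_lt_0_compat; lra|].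
    destruct (G (e / (2 * M))) as [d2 [D2 H2]]; [apply Rdiv_lt_0_compat; lra|].
    exists (Rmin d1 d2). split; [apply Rmin_pos; auto|]. intros p q H.
    pose proof (Rmin_l d1 d2). pose proof (Rmin_r d1 d2).
    specialize (H1 p q ltac:(lra)). specialize (H2 p q ltac:(lra)).
    replace (f p * g p - f q * g q) with ((f p - f q) * g p + f q * (g p - g q)) by ring.
    eapply Rle_lt_trans; [apply Rabs_triang|]. rewrite !Rabs_mult.
    specialize (HN p). specialize (HM q).
    apply Rlt_div_r in H1; [|lra]. apply Rlt_div_r in H2; [|lra].
    pose proof (Rabs_pos (f p - f q)). pose proof (Rabs_pos (g p - g q)).
    pose proof (Rabs_pos (g p)). pose proof (Rabs_pos (f q)). nra.
  - exists (M * N). intros p. rewrite Rabs_mult. apply Rmult_le_compat; auto using Rabs_pos.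
Qed.

Lemma BUC_scal c f : BUC f -> BUC (fun p => c * f p).
Proof. intros. apply (BUC_mult (fun _ => c)); auto using BUC_const. Qed.

Lemma BUC_lip (h : R -> R) f : (forall s t, Rabs (h s - h t) <= Rabs (s - t)) -> BUC f -> BUC (fun p => h (f p)).
Proof.
  intros Hh [F [M HM]]. split.
  - intros e He. destruct (F e He) as [d [D H]]. exists d. split; auto. intros p q Hpq.
    eapply Rle_lt_trans; [apply Hh|auto].
  - exists (M + Rabs (h 0)). intros p. replace (h (f p)) with ((h (f p) - h 0) + h 0) by ring.
    eapply Rle_trans; [apply Rabs_triang|]. specialize (Hh (f p) 0). rewrite Rminus_0_r in Hh.
    specialize (HM p). lra.
Qed.

Lemma Cc_plus f g : Cc f -> Cc g -> Cc (fun p => f p + g p).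
Proof.
  intros [F [r Hr]] [G [s Hs]]. split; [apply BUC_plus; auto|].
  exists (Rmax r s). intros p Hp. pose proof (Rmax_l r s). pose proof (Rmax_r r s).
  rewrite Hr, Hs; lra.
Qed.

Lemma Cc_mult f g : BUC f -> Cc g -> Cc (fun p => f p * g p).
Proof.
  intros F [G [s Hs]]. split; [apply BUC_mult; auto|]. exists s. intros p Hp. rewrite Hs; auto; ring.
Qed.

Lemma Cc_scal c f : Cc f -> Cc (fun p => c * f p).
Proof. intros. apply (Cc_mult (fun _ => c)); auto using BUC_const. Qed.

Lemma Rabs_lip s t : Rabs (Rabs s - Rabs t) <= Rabs (s - t).
Proof. apply Rabs_triang_inv2. Qed.

Lemma Cc_abs f : Cc f -> Cc (fun p => Rabs (f p)).
Proof.
  intros [F [r Hr]]. split; [apply (BUC_lip Rabs); auto using Rabs_lip|].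
  exists r. intros. rewrite Hr, Rabs_R0; auto.
Qed.

Lemma Rmin_abs s t : Rmin s t = (s + t - Rabs (s - t)) / 2.
Proof. unfold Rmin, Rabs. destruct (Rle_dec s t), (Rcase_abs (s - t)); lra. Qed.

Lemma Cc_min f g : Cc f -> Cc g -> Cc (fun p => Rmin (f p) (g p)).
Proof.
  intros F G. assert (H : Cc (fun p => / 2 * ((f p + g p) + (-1) * Rabs (f p + (-1) * g p)))).
  { apply Cc_scal, Cc_plus; [apply Cc_plus; auto|]. apply Cc_scal, Cc_abs, Cc_plus; auto. apply Cc_scal; auto. }
  replace (fun p => Rmin (f p) (g p)) with (fun p => / 2 * ((f p + g p) + (-1) * Rabs (f p + (-1) * g p))); auto.
  apply functional_extensionality. intros p. rewrite Rmin_abs.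
  replace (f p + -1 * g p) with (f p - g p) by ring. field.
Qed.

(** * The iterated integral *)

Definition upd (d : nat) (p : pt) (t : R) : pt :=
  match d with O => mkpt t (py p) (pz p) | S O => mkpt (px p) t (pz p) | _ => mkpt (px p) (py p) t end.

Definition crd (d : nat) (p : pt) : R :=
  match d with O => px p | S O => py p | _ => pz p end.

(** The result is again a function on the whole space, constant in coordinate [d], so that the
    operator can be iterated and its regularity stated with the same predicates. *)
Definition Ipart (d : nat) (r : R) (f : pt -> R) (p : pt) : R := RInt (fun t => f (upd d p t)) (-r) r.

Definition Tint (r : R) (f : pt -> R) : R := Ipart 0 r (Ipart 1 r (Ipart 2 r f)) origin.

Lemma supn_lt p r : supn p < r <-> Rabs (px p) < r /\ Rabs (py p) < r /\ Rabs (pz p) < r.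
Proof.
  unfold supn. split.
  - intros H. pose proof (Rmax_l (Rabs (px p)) (Rmax (Rabs (py p)) (Rabs (pz p)))).
    pose proof (Rmax_r (Rabs (px p)) (Rmax (Rabs (py p)) (Rabs (pz p)))).
    pose proof (Rmax_l (Rabs (py p)) (Rabs (pz p))). pose proof (Rmax_r (Rabs (py p)) (Rabs (pz p))). lra.
  - intros [H1 [H2 H3]]. repeat apply Rmax_lub_lt; assumption.
Qed.

Lemma upd_supn d p q s t r : 0 < r -> supn (psub p q) < r -> Rabs (s - t) < r -> supn (psub (upd d p s) (upd d q t)) < r.
Proof.
  intros Hr H Hst. apply supn_lt. apply supn_lt in H. destruct H as [H1 [H2 H3]].
  destruct d as [|[|d]]; unfold upd, psub, mkpt, px, py, pz in *; simpl in *; auto.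
Qed.

Lemma psub_diag_supn p : supn (psub p p) = 0.
Proof.
  unfold supn, psub, mkpt, px, py, pz; simpl. rewrite !Rminus_diag, !Rabs_R0.
  rewrite !(Rmax_left 0 0) by apply Rle_refl. reflexivity.
Qed.

Lemma slice_continuous d f p t : ucont f -> continuous (fun t => f (upd d p t)) t.
Proof.
  intros F. apply (proj2 (filterlim_locally (F := locally t) (fun t => f (upd d p t)) (f (upd d p t)))).
  intros e. destruct (F e (cond_pos e)) as [r [Hr H]].
  exists (mkposreal r Hr). intros s Hs. apply H. apply upd_supn; auto.
  rewrite psub_diag_supn. auto.
Qed.

Lemma slice_ex_RInt d f p a b : ucont f -> ex_RInt (fun t => f (upd d p t)) a b.
Proof. intros F. apply (ex_RInt_continuous (V := R_CompleteNormedModule)). intros; apply slice_continuous; auto. Qed.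

Lemma Ipart_ucont d r f : 0 <= r -> ucont f -> ucont (Ipart d r f).
Proof.
  intros Hr F e He.
  (* The divisor 2 r + 1 stays positive for r = 0 and makes the final inequality strict. *)
  destruct (F (e / (2 * r + 1))) as [s [Hs H]]; [apply Rdiv_lt_0_compat; lra|].
  exists s. split; auto. intros p q Hpq. unfold Ipart.
  rewrite <- (RInt_minus (V := R_CompleteNormedModule)) by (apply slice_ex_RInt; auto).
  eapply Rle_lt_trans.
  - apply (abs_RInt_le_const _ (-r) r (e / (2 * r + 1))); [lra| |].
    + apply (ex_RInt_minus (V := R_NormedModule)); apply slice_ex_RInt; auto.
    + intros t _. left. apply H. apply upd_supn; auto. rewrite Rminus_diag, Rabs_R0; auto.
  - apply (Rlt_le_trans _ ((2 * r + 1) * (e / (2 * r + 1)))).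
    + apply Rmult_lt_compat_r; [apply Rdiv_lt_0_compat|]; lra.
    + right. field. lra.
Qed.

(** Enlarging the range from r to r' only adds nonpositive contributions. Only a sign is assumed
    outside r, because a lower squeezing function need not vanish where the squeezed function
    does. *)
Lemma Ipart_le_dom d f g r r' p : 0 <= r <= r' -> ucont f -> ucont g ->
  (forall p, f p <= g p) -> (forall p, r < Rabs (crd d p) -> f p <= 0) ->
  Ipart d r' f p <= Ipart d r g p.
Proof.
  intros Hr F G Hfg Hneg. unfold Ipart.
  assert (Hc : forall t, crd d (upd d p t) = t) by (intros; destruct d as [|[|d]]; reflexivity).
  rewrite <- (RInt_Chasles (V := R_CompleteNormedModule) _ (-r') (-r) r') by (apply slice_ex_RInt; auto).
  rewrite <- (RInt_Chasles (V := R_CompleteNormedModule) _ (-r) r r') by (apply slice_ex_RInt; auto).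
  unfold plus; simpl.
  assert (H1 : RInt (fun t => f (upd d p t)) (-r') (-r) <= RInt (fun t => 0) (-r') (-r)).
  { apply RInt_le; [lra|apply slice_ex_RInt; auto|apply ex_RInt_const|].
    intros t Ht. apply Hneg. rewrite Hc. rewrite Rabs_left; lra. }
  assert (H2 : RInt (fun t => f (upd d p t)) r r' <= RInt (fun t => 0) r r').
  { apply RInt_le; [lra|apply slice_ex_RInt; auto|apply ex_RInt_const|].
    intros t Ht. apply Hneg. rewrite Hc. rewrite Rabs_right; lra. }
  assert (H3 : RInt (fun t => f (upd d p t)) (-r) r <= RInt (fun t => g (upd d p t)) (-r) r).
  { apply RInt_le; [lra|apply slice_ex_RInt; auto|apply slice_ex_RInt; auto|]. intros; auto. }
  rewrite !RInt_const in H1, H2. unfold scal in *; simpl in *; unfold mult in *; simpl in *. lra.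
Qed.

Lemma Ipart_nonpos d e f r r' p : 0 <= r -> ucont f -> e <> d -> (d < 3)%nat -> (e < 3)%nat ->
  (forall p, r' < Rabs (crd e p) -> f p <= 0) -> r' < Rabs (crd e p) -> Ipart d r f p <= 0.
Proof.
  intros Hr F Hed Hd He H Hp. unfold Ipart.
  assert (RInt (fun t => f (upd d p t)) (-r) r <= RInt (fun t => 0) (-r) r).
  { apply RInt_le; [lra|apply slice_ex_RInt; auto|apply ex_RInt_const|].
    intros t Ht. apply H. destruct d as [|[|[|d]]], e as [|[|[|e]]]; try lia; exact Hp. }
  rewrite RInt_const in H0. unfold scal in *; simpl in *; unfold mult in *; simpl in *. lra.
Qed.

Lemma crd_le_supn d p : Rabs (crd d p) <= supn p.
Proof.
  destruct (proj1 (supn_le p (supn p)) (Rle_refl _)) as [? [? ?]]. destruct d as [|[|d]]; auto.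
Qed.

Lemma Tint_le_dom f r r' : 0 <= r <= r' -> ucont f -> (forall p, r < supn p -> f p <= 0) -> Tint r' f <= Tint r f.
Proof.
  intros Hr F H. unfold Tint.
  assert (Hd : forall d p, r < Rabs (crd d p) -> f p <= 0).
  { intros d p Hp. apply H. pose proof (crd_le_supn d p). lra. }
  assert (U : forall d g s, 0 <= s -> ucont g -> ucont (Ipart d s g)) by (intros; apply Ipart_ucont; auto).
  apply Ipart_le_dom; auto; try (repeat apply U; auto; lra).
  - intros p. apply Ipart_le_dom; auto; try (repeat apply U; auto; lra).
    + intros q. apply Ipart_le_dom; auto; [intros; apply Rle_refl|apply Hd].
    + intros q Hq. apply (Ipart_nonpos 2 1 f r' r q); auto; try lra; try lia. apply Hd.
  - intros p Hp. apply (Ipart_nonpos 1 0 _ r' r p); auto; try lra; try lia; [apply U; auto; lra|].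
    intros q Hq. apply (Ipart_nonpos 2 0 f r' r q); auto; try lra; try lia. apply Hd.
Qed.

(** The numbers [s i] are approximations of [q] on the cells rather than values of [q]: in
    [Tint_box] they are the inner Riemann sums, so one estimate serves all three coordinates. *)
Lemma RInt_cells (q : R -> R) (s : nat -> R) r n e : 0 < r -> (0 < n)%nat ->
  (forall a b, ex_RInt q a b) ->
  (forall i t, (i < n)%nat ->
     -r + INR i * (r - -r) / INR n <= t <= -r + INR (S i) * (r - -r) / INR n -> Rabs (q t - s i) <= e) ->
  Rabs (RInt q (-r) r - sumR n s * (2 * r / INR n)) <= 2 * r * e.
Proof.
  intros Hr Hn Hq H.
  assert (Hn' : 0 < INR n) by (apply lt_0_INR; lia).
  set (c := fun i => -r + INR i * (r - -r) / INR n).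
  assert (Hind : forall m, (m <= n)%nat ->
     Rabs (RInt q (-r) (c m) - sumR m s * (2 * r / INR n)) <= INR m * (2 * r / INR n) * e).
  { induction m as [|m IH]; intros Hm.
    - unfold c. simpl. replace (-r + 0 * (r - -r) / INR n) with (-r) by (field; lra).
      rewrite RInt_point. unfold zero; simpl. rewrite !Rmult_0_l, Rminus_0_r, Rabs_R0. lra.
    - specialize (IH ltac:(lia)).
      rewrite <- (RInt_Chasles (V := R_CompleteNormedModule) q (-r) (c m) (c (S m))) by auto.
      unfold plus; simpl AbelianMonoid.plus. simpl sumR.
      assert (Hlt : c m < c (S m)) by (apply mesh_step_lt; auto; lra).
      assert (Hd : c (S m) - c m = 2 * r / INR n) by (unfold c; rewrite S_INR; field; lra).
      assert (E : RInt q (c m) (c (S m)) - s m * (2 * r / INR n) = RInt (fun t => q t - s m) (c m) (c (S m))).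
      { rewrite (RInt_minus (V := R_CompleteNormedModule)) by (auto using ex_RInt_const; apply ex_RInt_const).
        rewrite RInt_const. unfold minus, plus, opp, scal; simpl. unfold mult; simpl. rewrite Hd. ring. }
      assert (B : Rabs (RInt (fun t => q t - s m) (c m) (c (S m))) <= (c (S m) - c m) * e).
      { apply abs_RInt_le_const; [lra| |].
        - apply (ex_RInt_minus (V := R_NormedModule)); [auto|apply ex_RInt_const].
        - intros t Ht. apply H; [lia|exact Ht]. }
      rewrite Hd, <- E in B. rewrite S_INR.
      match goal with |- Rabs ?z <= _ =>
        replace z with ((RInt q (-r) (c m) - sumR m s * (2 * r / INR n)) + (RInt q (c m) (c (S m)) - s m * (2 * r / INR n)))
          by (simpl; ring) end.
      eapply Rle_trans; [apply Rabs_triang|]. lra. }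
  specialize (Hind n (le_n n)). unfold c in Hind.
  replace (-r + INR n * (r - -r) / INR n) with r in Hind by (field; lra).
  replace (INR n * (2 * r / INR n) * e) with (2 * r * e) in Hind by (field; lra). exact Hind.
Qed.

Lemma Ipart_cells d f s p r n e : 0 < r -> (0 < n)%nat -> ucont f ->
  (forall i t, (i < n)%nat ->
     -r + INR i * (r - -r) / INR n <= t <= -r + INR (S i) * (r - -r) / INR n -> Rabs (f (upd d p t) - s i) <= e) ->
  Rabs (Ipart d r f p - sumR n s * (2 * r / INR n)) <= 2 * r * e.
Proof. intros. apply RInt_cells; auto. intros; apply slice_ex_RInt; auto. Qed.

(** The triple sum is compared with the iterated integral one coordinate at a time. That a tag
    depends on all three indices is harmless: uniform continuity compares [f] on the whole cell with
    [f] at its tag. *)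
Lemma Tint_box f r : 0 < r -> ucont f -> is_box_int f (cube_lo r) (cube_hi r) (Tint r f).
Proof.
  intros Hr F e He.
  (* Three integrations over an interval of length 2 r turn e' into e / 2. *)
  set (e' := e / (2 * (2 * r) ^ 3)).
  assert (H3 : 0 < (2 * r) ^ 3) by (apply pow_lt; lra).
  assert (He' : 0 < e') by (apply Rdiv_lt_0_compat; lra).
  destruct (F e' He') as [d [Hd H]].
  destruct (archimed_cor1 (d / (4 * r))) as [n0 [Hn0 Hn0']]; [apply Rdiv_lt_0_compat; lra|].
  exists n0. intros n Hn Hn' tag Ht.
  assert (Hmesh : (r - -r) / INR n < d).
  { assert (0 < INR n0) by (apply lt_0_INR; lia). assert (INR n0 <= INR n) by (apply le_INR; lia).
    apply Rlt_div_r in Hn0; [|lra].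
    assert (/ INR n <= / INR n0) by (apply Rinv_le_contravar; lra).
    unfold Rdiv. apply (Rle_lt_trans _ (2 * r * / INR n0)); [nra|].
    assert (0 < / INR n0) by (apply Rinv_0_lt_compat; auto). nra. }
  set (cell := fun (i : nat) t => -r + INR i * (r - -r) / INR n <= t <= -r + INR (S i) * (r - -r) / INR n).
  assert (Hcell : forall i s t, cell i s -> cell i t -> Rabs (s - t) < d).
  { intros i s t Hs Ht'. unfold cell in *. rewrite S_INR in *.
    replace ((INR i + 1) * (r - -r) / INR n) with (INR i * (r - -r) / INR n + (r - -r) / INR n) in *
      by (unfold Rdiv; ring).
    apply Rabs_def1; lra. }
  assert (H0 : forall p i j k, (i < n)%nat -> (j < n)%nat -> (k < n)%nat ->
     cell i (px p) -> cell j (py p) -> cell k (pz p) -> Rabs (f p - f (tag i j k)) <= e').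
  { intros p i j k Hi Hj Hk Ci Cj Ck. left. apply H. destruct (Ht i j k Hi Hj Hk) as [T1 [T2 T3]].
    apply supn_lt. split; [|split]; simpl; eapply Hcell; eauto. }
  assert (U1 := Ipart_ucont 2 r f ltac:(lra) F).
  assert (U2 := Ipart_ucont 1 r _ ltac:(lra) U1).
  set (m := 2 * r / INR n).
  assert (H1 : forall p i j, (i < n)%nat -> (j < n)%nat -> cell i (px p) -> cell j (py p) ->
     Rabs (Ipart 2 r f p - sumR n (fun k => f (tag i j k)) * m) <= 2 * r * e').
  { intros. apply Ipart_cells; auto. }
  assert (H2 : forall p i, (i < n)%nat -> cell i (px p) ->
     Rabs (Ipart 1 r (Ipart 2 r f) p - sumR n (fun j => sumR n (fun k => f (tag i j k)) * m) * m) <= 2 * r * (2 * r * e')).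
  { intros. apply Ipart_cells; auto. }
  assert (H4 : Rabs (Tint r f - sumR n (fun i => sumR n (fun j => sumR n (fun k => f (tag i j k)) * m) * m) * m)
      <= 2 * r * (2 * r * (2 * r * e'))).
  { apply Ipart_cells; auto. }
  assert (Hpull : forall g, sumR n (fun i => g i * m) = m * sumR n g).
  { intros g. rewrite <- sumR_scal. apply sumR_ext; intros; ring. }
  rewrite Hpull in H4.
  rewrite (sumR_ext n _ (fun i => m * sumR n (fun j => sumR n (fun k => f (tag i j k))))) in H4
    by (intros; apply Hpull).
  rewrite sumR_scal in H4. rewrite Rabs_minus_sym.
  match type of H4 with _ <= ?z => assert (Ez : z = e / 2) by (unfold e'; field; lra) end.
  rewrite Ez in H4.
  match type of H4 with Rabs (_ - ?z) <= _ => replace (_ * ((px (cube_hi r) - px (cube_lo r)) * (py (cube_hi r) - py (cube_lo r)) * (pz (cube_hi r) - pz (cube_lo r)) / INR n ^ 3)) with z end.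
  - lra.
  - unfold m, cube_lo, cube_hi, mkpt, px, py, pz; simpl. field. apply Rgt_not_eq, lt_0_INR. lia.
Qed.

(** * Riemann integrable functions with bounded support *)

(** One value valid on all large cubes lets functions with different supports be compared on a
    common cube, without a limit. *)
Definition boxI (f : pt -> R) (I : R) : Prop :=
  exists r0, 0 < r0 /\ forall r, r0 <= r -> is_box_int f (cube_lo r) (cube_hi r) I.

Lemma boxI_le l f g I J : boxI f I -> boxI g J -> (forall p, off l p -> f p <= g p) -> I <= J.
Proof.
  intros [r [Hr F]] [s [Hs G]] H. pose proof (Rmax_l r s). pose proof (Rmax_r r s).
  eapply (box_le_off l (cube_lo (Rmax r s)) (cube_hi (Rmax r s))); eauto. apply cube_nondeg; lra.
Qed.

Lemma boxI_unique f I J : boxI f I -> boxI f J -> I = J.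
Proof. intros. apply Rle_antisym; eapply (boxI_le nil); eauto; intros; lra. Qed.

Lemma boxI_plus f g I J : boxI f I -> boxI g J -> boxI (fun p => f p + g p) (I + J).
Proof.
  intros [r [Hr F]] [s [Hs G]]. exists (Rmax r s). pose proof (Rmax_l r s). pose proof (Rmax_r r s).
  split; [lra|]. intros t Ht. apply box_plus; [apply F|apply G]; lra.
Qed.

Lemma boxI_scal c f I : boxI f I -> boxI (fun p => c * f p) (c * I).
Proof. intros [r [Hr F]]. exists r. split; auto. intros. apply box_scal; auto. Qed.

Definition supp (r : R) (f : pt -> R) : Prop := forall p, r < supn p -> f p = 0.

Lemma Tint_opp f r : 0 < r -> ucont f -> Tint r (fun p => -1 * f p) = -1 * Tint r f.
Proof.
  intros Hr F. apply (box_unique (cube_lo r) (cube_hi r) (fun p => -1 * f p)).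
  - apply cube_nondeg; auto.
  - apply Tint_box; auto. intros e He. destruct (F e He) as [d [Hd H]]. exists d. split; auto.
    intros p q Hpq. replace (-1 * f p - -1 * f q) with (- (f p - f q)) by ring. rewrite Rabs_Ropp; auto.
  - apply box_scal, Tint_box; auto.
Qed.

Lemma ucont_opp f : ucont f -> ucont (fun p => -1 * f p).
Proof.
  intros F e He. destruct (F e He) as [d [Hd H]]. exists d. split; auto.
  intros p q Hpq. replace (-1 * f p - -1 * f q) with (- (f p - f q)) by ring. rewrite Rabs_Ropp; auto.
Qed.

Lemma Tint_const f r r' : 0 < r <= r' -> ucont f -> supp r f -> Tint r' f = Tint r f.
Proof.
  intros Hr F S. apply Rle_antisym.
  - apply Tint_le_dom; auto; [lra|]. intros p Hp. rewrite S; auto; lra.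
  - assert (Tint r' (fun p => -1 * f p) <= Tint r (fun p => -1 * f p)).
    { apply Tint_le_dom; auto using ucont_opp; [lra|]. intros p Hp. rewrite S; auto; lra. }
    rewrite !Tint_opp in H; auto; lra.
Qed.

Lemma Cc_boxI f r : 0 < r -> ucont f -> supp r f -> boxI f (Tint r f).
Proof.
  intros Hr F S. exists r. split; auto. intros s Hs.
  rewrite <- (Tint_const f r s); auto; try lra. apply Tint_box; auto; lra.
Qed.

Lemma Cc_supp f : Cc f -> exists r, 0 < r /\ supp r f.
Proof.
  intros [_ [r Hr]]. exists (Rmax r 1). pose proof (Rmax_l r 1). pose proof (Rmax_r r 1).
  split; [lra|]. intros p Hp. apply Hr. lra.
Qed.

Lemma Cc_boxI_ex f : Cc f -> exists I, boxI f I.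
Proof.
  intros F. destruct (Cc_supp f F) as [r [Hr S]]. exists (Tint r f). apply Cc_boxI; auto. apply F.
Qed.

(** What is cut off is nonpositive. This truncates a squeezing function to the support of the
    function it squeezes. *)
Lemma Tint_boxI_le f r I : 0 < r -> Cc f -> boxI f I -> (forall p, r < supn p -> f p <= 0) -> I <= Tint r f.
Proof.
  intros Hr F HI H. destruct (Cc_supp f F) as [s [Hs S]].
  pose proof (Rmax_l r s). pose proof (Rmax_r r s).
  assert (S' : supp (Rmax r s) f) by (intros p Hp; apply S; lra).
  rewrite (boxI_unique f I (Tint (Rmax r s) f)); auto.
  - apply Tint_le_dom; auto; [lra|apply F].
  - apply Cc_boxI; auto; [lra|apply F].
Qed.

Definition intble (f : pt -> R) : Prop :=
  forall e, 0 < e -> exists g1 g2 a b, Cc g1 /\ Cc g2 /\ boxI g1 a /\ boxI g2 b /\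
    (forall p, g1 p <= f p <= g2 p) /\ b - a < e.

Lemma Cc_intble f : Cc f -> intble f.
Proof.
  intros F e He. destruct (Cc_boxI_ex f F) as [I HI]. exists f, f, I, I.
  do 4 (split; [auto|]). split; [intros; split|]; lra.
Qed.

Lemma intble_supp f : intble f -> exists r, 0 < r /\ supp r f.
Proof.
  intros H. destruct (H 1 ltac:(lra)) as [g1 [g2 [a [b [C1 [C2 [_ [_ [L _]]]]]]]]].
  destruct (Cc_supp _ C1) as [r [Hr S1]], (Cc_supp _ C2) as [s [Hs S2]].
  exists (Rmax r s). pose proof (Rmax_l r s). pose proof (Rmax_r r s). split; [lra|].
  intros p Hp. specialize (L p). rewrite S1, S2 in L; lra.
Qed.

(** The value is the supremum of the integrals of continuous minorants. It has to be the Riemann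
    integral on every cube containing the support of [f], even if [g1] and [g2] live on a larger
    set: [improper_int] integrates over exactly the truncation cube. Hence the truncated comparisons
    [T1] and [T2]. *)
Lemma intble_box f : intble f -> exists I, forall r, 0 < r -> supp r f -> is_box_int f (cube_lo r) (cube_hi r) I.
Proof.
  intros H.
  set (E := fun a => exists g, Cc g /\ boxI g a /\ forall p, g p <= f p).
  destruct (completeness E) as [I [Iub Ilub]].
  - destruct (H 1 ltac:(lra)) as [g1 [g2 [a [b [C1 [C2 [B1 [B2 [L _]]]]]]]]].
    exists b. intros a' [g [C [B L']]]. apply (boxI_le nil g g2); auto.
    intros p _. specialize (L p). specialize (L' p). lra.
  - destruct (H 1 ltac:(lra)) as [g1 [g2 [a [b [C1 [C2 [B1 [B2 [L _]]]]]]]]].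
    exists a, g1. split; [|split]; auto. intros p. apply L.
  - exists I. intros r Hr S e He.
    destruct (H (e / 2) ltac:(lra)) as [g1 [g2 [a [b [C1 [C2 [B1 [B2 [L D]]]]]]]]].
    assert (Ha : a <= I).
    { apply Iub. exists g1. split; [|split]; auto. intros p. apply L. }
    assert (Hb : I <= b).
    { apply Ilub. intros a' [g [C [B L']]]. apply (boxI_le nil g g2); auto.
      intros p _. specialize (L p). specialize (L' p). lra. }
    assert (T1 : a <= Tint r g1).
    { apply Tint_boxI_le; auto. intros p Hp. specialize (L p). rewrite S in L; lra. }
    assert (T2 : Tint r g2 <= b).
    { assert (-1 * b <= Tint r (fun p => -1 * g2 p)).
      { apply Tint_boxI_le; auto using Cc_scal, boxI_scal.
        intros p Hp. specialize (L p). rewrite S in L; lra. }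
      rewrite Tint_opp in H0; auto; [lra|apply C2]. }
    destruct (Tint_box g1 r Hr (proj1 (proj1 C1)) (e / 2) ltac:(lra)) as [n1 N1].
    destruct (Tint_box g2 r Hr (proj1 (proj1 C2)) (e / 2) ltac:(lra)) as [n2 N2].
    exists (n1 + n2)%nat. intros n Hn Hn' tag Ht.
    specialize (N1 n ltac:(lia) Hn' tag Ht). specialize (N2 n ltac:(lia) Hn' tag Ht).
    pose proof (sum3_le n (fun i j k => g1 (tag i j k)) (fun i j k => f (tag i j k)) ltac:(intros; apply L)) as M1.
    pose proof (sum3_le n (fun i j k => f (tag i j k)) (fun i j k => g2 (tag i j k)) ltac:(intros; apply L)) as M2.
    unfold sum3 in M1, M2.
    set (w := (px (cube_hi r) - px (cube_lo r)) * (py (cube_hi r) - py (cube_lo r)) * (pz (cube_hi r) - pz (cube_lo r)) / INR n ^ 3) in *.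
    assert (0 < w).
    { unfold w, cube_lo, cube_hi, mkpt, px, py, pz; simpl. apply Rdiv_lt_0_compat.
      - repeat apply Rmult_lt_0_compat; lra.
      - apply (pow_lt (INR n) 3), lt_0_INR. lia. }
    apply Rabs_def2 in N1. apply Rabs_def2 in N2. apply Rabs_def1; nra.
Qed.

Definition RI (f : pt -> R) (I : R) : Prop := intble f /\ boxI f I.

Lemma intble_RI f : intble f -> exists I, RI f I.
Proof.
  intros H. destruct (intble_box f H) as [I HI]. destruct (intble_supp f H) as [r [Hr S]].
  exists I. split; auto. exists r. split; auto. intros s Hs. apply HI; [lra|].
  intros p Hp. apply S. lra.
Qed.

Lemma RI_box f I r : RI f I -> 0 < r -> supp r f -> is_box_int f (cube_lo r) (cube_hi r) I.
Proof.
  intros [H HI] Hr S. destruct (intble_box f H) as [J HJ].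
  rewrite (boxI_unique f I J); auto. destruct (intble_supp f H) as [s [Hs Ss]].
  exists s. split; auto. intros t Ht. apply HJ; [lra|]. intros p Hp. apply Ss; lra.
Qed.

Lemma RI_unique f I J : RI f I -> RI f J -> I = J.
Proof. intros [_ H] [_ H']. eapply boxI_unique; eauto. Qed.

Lemma RI_le l f g I J : RI f I -> RI g J -> (forall p, off l p -> f p <= g p) -> I <= J.
Proof. intros [_ H] [_ H']. eapply boxI_le; eauto. Qed.

Lemma intble_plus f g : intble f -> intble g -> intble (fun p => f p + g p).
Proof.
  intros F G e He.
  destruct (F (e / 2) ltac:(lra)) as [f1 [f2 [a [b [C1 [C2 [B1 [B2 [L D]]]]]]]]].
  destruct (G (e / 2) ltac:(lra)) as [g1 [g2 [a' [b' [C1' [C2' [B1' [B2' [L' D']]]]]]]]].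
  exists (fun p => f1 p + g1 p), (fun p => f2 p + g2 p), (a + a'), (b + b').
  do 4 (split; [auto using Cc_plus, boxI_plus|]). split; [|lra].
  intros p. specialize (L p). specialize (L' p). lra.
Qed.

Lemma intble_scal c f : intble f -> intble (fun p => c * f p).
Proof.
  intros F e He.
  destruct (F (e / (Rabs c + 1))) as [f1 [f2 [a [b [C1 [C2 [B1 [B2 [L D]]]]]]]]].
  { apply Rdiv_lt_0_compat; [lra|]. pose proof (Rabs_pos c); lra. }
  pose proof (Rabs_pos c). apply Rlt_div_r in D; [|lra].
  assert (a <= b) by (apply (boxI_le nil f1 f2); auto; intros p _; specialize (L p); lra).
  destruct (Rle_dec 0 c) as [Hc|Hc].
  - rewrite (Rabs_right c) in D by lra.
    exists (fun p => c * f1 p), (fun p => c * f2 p), (c * a), (c * b).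
    do 4 (split; [auto using Cc_scal, boxI_scal|]). split; [|nra].
    intros p. specialize (L p). nra.
  - rewrite (Rabs_left c) in D by lra.
    exists (fun p => c * f2 p), (fun p => c * f1 p), (c * b), (c * a).
    do 4 (split; [auto using Cc_scal, boxI_scal|]). split; [|nra].
    intros p. specialize (L p). nra.
Qed.

(** The gap between the two minima is at most the sum of the two gaps. Intersections of sets are
    handled by this, since a product of indicators is their minimum. *)
Lemma intble_min f g : intble f -> intble g -> intble (fun p => Rmin (f p) (g p)).
Proof.
  intros F G e He.
  destruct (F (e / 2) ltac:(lra)) as [f1 [f2 [a [b [C1 [C2 [B1 [B2 [L D]]]]]]]]].
  destruct (G (e / 2) ltac:(lra)) as [g1 [g2 [a' [b' [C1' [C2' [B1' [B2' [L' D']]]]]]]]].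
  destruct (Cc_boxI_ex _ (Cc_min f1 g1 C1 C1')) as [I1 H1].
  destruct (Cc_boxI_ex _ (Cc_min f2 g2 C2 C2')) as [I2 H2].
  exists (fun p => Rmin (f1 p) (g1 p)), (fun p => Rmin (f2 p) (g2 p)), I1, I2.
  do 4 (split; [auto using Cc_min|]). split.
  - intros p. specialize (L p). specialize (L' p). unfold Rmin.
    destruct (Rle_dec (f1 p) (g1 p)), (Rle_dec (f p) (g p)), (Rle_dec (f2 p) (g2 p)); lra.
  - assert (I2 + -1 * I1 <= (b + -1 * a) + (b' + -1 * a')); [|lra].
    eapply (boxI_le nil).
    + apply boxI_plus; [apply H2|apply boxI_scal, H1].
    + apply boxI_plus; (apply boxI_plus; [eassumption|apply boxI_scal; eassumption]).
    + intros p _. cbv beta. specialize (L p). specialize (L' p). unfold Rmin.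
      destruct (Rle_dec (f1 p) (g1 p)), (Rle_dec (f2 p) (g2 p)); lra.
Qed.

Lemma intble_ext f g : (forall p, f p = g p) -> intble f -> intble g.
Proof. intros H. rewrite (functional_extensionality f g H). auto. Qed.

(** Multiplication respects the squeezing only for a nonnegative factor, so [f] is first shifted by
    a bound [M] and the shift is subtracted afterwards. *)
Lemma intble_mult f k : BUC f -> intble k -> intble (fun p => f p * k p).
Proof.
  intros F K. destruct (bounded_fun_pos f (proj2 F)) as [M [M0 HM]].
  assert (P : intble (fun p => (f p + M) * k p)).
  { intros e He.
    destruct (K (e / (2 * M))) as [k1 [k2 [a [b [C1 [C2 [B1 [B2 [L D]]]]]]]]]; [apply Rdiv_lt_0_compat; lra|].
    assert (FM : BUC (fun p => f p + M)) by (apply BUC_plus; auto using BUC_const).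
    destruct (Cc_boxI_ex _ (Cc_mult _ k1 FM C1)) as [I1 H1].
    destruct (Cc_boxI_ex _ (Cc_mult _ k2 FM C2)) as [I2 H2].
    exists (fun p => (f p + M) * k1 p), (fun p => (f p + M) * k2 p), I1, I2.
    do 4 (split; [auto using Cc_mult|]).
    assert (B : forall p, 0 <= f p + M <= 2 * M).
    { intros p. specialize (HM p). apply Rabs_le_between in HM. lra. }
    split.
    - intros p. specialize (L p). specialize (B p). nra.
    - assert (I2 + -1 * I1 <= 2 * M * (b + -1 * a)).
      { eapply (boxI_le nil).
        - apply boxI_plus; [apply H2|apply boxI_scal, H1].
        - apply boxI_scal, boxI_plus; [apply B2|apply boxI_scal, B1].
        - intros p _. cbv beta. specialize (L p). specialize (B p). nra. }
      apply Rlt_div_r in D; lra. }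
  apply (intble_ext (fun p => (f p + M) * k p + (- M) * k p)); [intros; ring|].
  apply intble_plus; auto using intble_scal.
Qed.

Lemma RI_plus f g I J : RI f I -> RI g J -> RI (fun p => f p + g p) (I + J).
Proof. intros [] []. split; auto using intble_plus, boxI_plus. Qed.

Lemma RI_scal c f I : RI f I -> RI (fun p => c * f p) (c * I).
Proof. intros []. split; auto using intble_scal, boxI_scal. Qed.

Lemma RI_ext f g I : (forall p, f p = g p) -> RI f I -> RI g I.
Proof. intros H. rewrite (functional_extensionality f g H). auto. Qed.

Lemma RI_eq_off l f g I J : RI f I -> RI g J -> (forall p, off l p -> f p = g p) -> I = J.
Proof.
  intros F G H. apply Rle_antisym; eapply (RI_le l); eauto; intros p Hp; rewrite H; auto; lra.
Qed.

(** * Affine changes of one coordinate *)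

(** Changes of variables are made one coordinate at a time, where they reduce to the one-dimensional
    substitution rule inside the iterated integral. *)
Definition aff (d : nat) (u v : R) (p : pt) : pt := upd d p (u * crd d p + v).

Lemma RInt_supp (q : R -> R) r a b : (forall a b, ex_RInt q a b) -> (forall t, r < Rabs t -> q t = 0) ->
  0 <= r -> a <= - r -> r <= b -> RInt q a b = RInt q (-r) r.
Proof.
  intros Q H Hr Ha Hb.
  assert (Z : forall s t, s <= t -> (forall x, s < x < t -> r < Rabs x) -> RInt q s t = 0).
  { intros s t Hst Hx. rewrite (RInt_ext q (fun _ => 0)).
    - rewrite RInt_const. unfold scal; simpl; unfold mult; simpl; ring.
    - intros x Hx'. rewrite Rmin_left, Rmax_right in Hx' by lra. apply H, Hx; auto. }
  rewrite <- (RInt_Chasles (V := R_CompleteNormedModule) q a (-r) b) by auto.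
  rewrite <- (RInt_Chasles (V := R_CompleteNormedModule) q (-r) r b) by auto.
  rewrite (Z a (-r)), (Z r b); auto.
  - unfold plus; simpl; ring.
  - intros x Hx. rewrite Rabs_right; lra.
  - intros x Hx. rewrite Rabs_left; lra.
Qed.

(** The condition r + |v| <= |u| s says that the image of [-s, s] under t -> u t + v still contains
    [-r, r], so that no mass is lost. *)
Lemma RInt_affine (q : R -> R) r u v s : (forall a b, ex_RInt q a b) -> (forall t, r < Rabs t -> q t = 0) ->
  0 <= r -> u <> 0 -> r <= s -> r + Rabs v <= Rabs u * s ->
  RInt (fun t => q (u * t + v)) (-s) s = / Rabs u * RInt q (-s) s.
Proof.
  intros Q H Hr Hu Hs Hus.
  assert (E : u * RInt (fun t => q (u * t + v)) (-s) s = RInt q (u * (-s) + v) (u * s + v)).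
  { rewrite <- (RInt_comp_lin (V := R_CompleteNormedModule) q u v (-s) s) by auto.
    rewrite (RInt_scal (V := R_CompleteNormedModule)); [reflexivity|].
    destruct (ex_RInt_comp_lin (V := R_NormedModule) q u v (-s) s (Q _ _)) as [l Hl].
    exists (/ u * l). apply (is_RInt_ext (fun t => scal (/ u) (scal u (q (u * t + v))))).
    - intros t _. unfold scal; simpl; unfold mult; simpl. field. auto.
    - apply (is_RInt_scal (V := R_NormedModule)); auto. }
  rewrite (RInt_supp q r (-s) s); auto; try lra.
  assert (Hv := Rle_abs v). assert (Hv' := Rle_abs (- v)). rewrite Rabs_Ropp in Hv'.
  (* For u < 0 the substitution reverses the endpoints, hence the swap. *)
  destruct (Rdichotomy _ _ Hu) as [Hu'|Hu'].
  - rewrite (Rabs_left u) in * by auto.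
    rewrite <- (opp_RInt_swap q) in E by auto. rewrite (RInt_supp q r) in E; auto; try lra.
    assert (K : forall w : R, - w = u * (/ - u * w)) by (intros; field; lra).
    apply (Rmult_eq_reg_l u); auto. etransitivity; [exact E|apply K].
  - rewrite (Rabs_right u) in * by lra.
    rewrite (RInt_supp q r) in E; auto; try lra.
    assert (K : forall w : R, w = u * (/ u * w)) by (intros; field; lra).
    apply (Rmult_eq_reg_l u); auto. etransitivity; [exact E|apply K].
Qed.

Lemma Ipart_aff_ne d e f r u v p : d <> e -> (d < 3)%nat -> (e < 3)%nat ->
  Ipart e r (fun p => f (aff d u v p)) p = Ipart e r f (aff d u v p).
Proof.
  intros. unfold Ipart. f_equal. apply functional_extensionality. intros t.
  destruct d as [|[|[|d]]], e as [|[|[|e]]]; try lia; reflexivity.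
Qed.

Lemma Ipart_aff_eq d f r u v s p : ucont f -> (forall p, r < Rabs (crd d p) -> f p = 0) ->
  0 <= r -> u <> 0 -> r <= s -> r + Rabs v <= Rabs u * s ->
  Ipart d s (fun p => f (aff d u v p)) p = / Rabs u * Ipart d s f p.
Proof.
  intros F S Hr Hu Hs Hus. unfold Ipart.
  assert (C : forall t, crd d (upd d p t) = t) by (intros; destruct d as [|[|d]]; reflexivity).
  assert (A : forall t, aff d u v (upd d p t) = upd d p (u * t + v))
    by (intros; destruct d as [|[|d]]; reflexivity).
  rewrite (RInt_ext _ (fun t => f (upd d p (u * t + v)))) by (intros; rewrite A; auto).
  apply (RInt_affine (fun t => f (upd d p t)) r); auto.
  - intros; apply slice_ex_RInt; auto.
  - intros t Ht. apply S. rewrite C. auto.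
Qed.

Lemma Ipart_crd_supp d e f r s : d <> e -> (d < 3)%nat -> (e < 3)%nat ->
  (forall p, r < Rabs (crd d p) -> f p = 0) -> forall p, r < Rabs (crd d p) -> Ipart e s f p = 0.
Proof.
  intros Hde Hd He H p Hp. unfold Ipart. rewrite (RInt_ext _ (fun _ => 0)).
  - rewrite RInt_const. unfold scal; simpl; unfold mult; simpl; ring.
  - intros t _. apply H. destruct d as [|[|[|d]]], e as [|[|[|e]]]; try lia; exact Hp.
Qed.

Lemma Ipart_scal d r c f : ucont f -> Ipart d r (fun p => c * f p) = fun p => c * Ipart d r f p.
Proof.
  intros F. apply functional_extensionality. intros p. unfold Ipart.
  apply (RInt_scal (V := R_CompleteNormedModule) (fun t => f (upd d p t))). apply slice_ex_RInt; auto.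
Qed.

Lemma Tint_affine d f r u v s : (d < 3)%nat -> ucont f -> supp r f -> 0 <= r -> u <> 0 -> r <= s ->
  r + Rabs v <= Rabs u * s -> Tint s (fun p => f (aff d u v p)) = / Rabs u * Tint s f.
Proof.
  intros Hd F S Hr Hu Hs Hus. unfold Tint.
  assert (C : forall d p, r < Rabs (crd d p) -> f p = 0).
  { intros d' p Hp. apply S. pose proof (crd_le_supn d' p). lra. }
  assert (U2 := Ipart_ucont 2 s f ltac:(lra) F). assert (U1 := Ipart_ucont 1 s _ ltac:(lra) U2).
  destruct d as [|[|[|d]]]; try lia.
  - rewrite (functional_extensionality (Ipart 2 s (fun p => f (aff 0 u v p))) (fun p => Ipart 2 s f (aff 0 u v p)))
      by (intros; apply Ipart_aff_ne; lia).
    rewrite (functional_extensionality (Ipart 1 s (fun p => Ipart 2 s f (aff 0 u v p))) (fun p => Ipart 1 s (Ipart 2 s f) (aff 0 u v p)))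
      by (intros; apply Ipart_aff_ne; lia).
    apply (Ipart_aff_eq 0 _ r); auto.
    do 2 (apply Ipart_crd_supp; [lia..|]). apply C.
  - rewrite (functional_extensionality (Ipart 2 s (fun p => f (aff 1 u v p))) (fun p => Ipart 2 s f (aff 1 u v p)))
      by (intros; apply Ipart_aff_ne; lia).
    rewrite (functional_extensionality (Ipart 1 s (fun p => Ipart 2 s f (aff 1 u v p))) (fun p => / Rabs u * Ipart 1 s (Ipart 2 s f) p)).
    + rewrite Ipart_scal; auto.
    + intros p. apply (Ipart_aff_eq 1 _ r); auto. apply Ipart_crd_supp; [lia..|]. apply C.
  - rewrite (functional_extensionality (Ipart 2 s (fun p => f (aff 2 u v p))) (fun p => / Rabs u * Ipart 2 s f p)).
    + rewrite !Ipart_scal; auto.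
    + intros p. apply (Ipart_aff_eq 2 _ r); auto. apply C.
Qed.

Lemma BUC_comp f (A : pt -> pt) K : 0 < K -> (forall p q, supn (psub (A p) (A q)) <= K * supn (psub p q)) ->
  BUC f -> BUC (fun p => f (A p)).
Proof.
  intros HK HA [F [M HM]]. split; [|exists M; auto].
  intros e He. destruct (F e He) as [d [Hd H]].
  exists (d / K). split; [apply Rdiv_lt_0_compat; auto|]. intros p q Hpq. apply H.
  eapply Rle_lt_trans; [apply HA|]. apply Rlt_div_r in Hpq; lra.
Qed.

Lemma aff_supn d u v p q : supn (psub (aff d u v p) (aff d u v q)) <= (Rabs u + 1) * supn (psub p q).
Proof.
  destruct (proj1 (supn_le (psub p q) _) (Rle_refl _)) as [H1 [H2 H3]].
  set (s := supn (psub p q)) in *. pose proof (Rabs_pos u).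
  assert (D : forall a b, Rabs (a - b) <= s -> Rabs (u * a + v - (u * b + v)) <= (Rabs u + 1) * s).
  { intros a b Hab. replace (u * a + v - (u * b + v)) with (u * (a - b)) by ring. rewrite Rabs_mult.
    pose proof (Rabs_pos (a - b)). nra. }
  assert (D' : forall a b, Rabs (a - b) <= s -> Rabs (a - b) <= (Rabs u + 1) * s).
  { intros a b Hab. pose proof (Rabs_pos (a - b)). nra. }
  apply supn_le.
  destruct d as [|[|d]]; unfold aff, upd, crd, psub, mkpt, px, py, pz in *; simpl in *; auto.
Qed.

Lemma aff_BUC d u v f : BUC f -> BUC (fun p => f (aff d u v p)).
Proof.
  apply (BUC_comp f (aff d u v) (Rabs u + 1)); [pose proof (Rabs_pos u); lra|apply aff_supn].
Qed.

Lemma aff_Cc d u v f : u <> 0 -> Cc f -> Cc (fun p => f (aff d u v p)).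
Proof.
  intros Hu F. split; [apply aff_BUC, F|]. destruct (Cc_supp f F) as [r [Hr S]].
  pose proof (Rabs_pos_lt u Hu).
  exists (r + (r + Rabs v) / Rabs u). intros p Hp. apply S. apply Rnot_le_lt. intros H0.
  apply (Rlt_not_le _ _ Hp). apply supn_le in H0. destruct H0 as [H1 [H2 H3]].
  assert (Q : 0 <= (r + Rabs v) / Rabs u).
  { apply Rdiv_le_0_compat; auto. pose proof (Rabs_pos v); lra. }
  assert (D : forall a, Rabs (u * a + v) <= r -> Rabs a <= r + (r + Rabs v) / Rabs u).
  { intros a Ha. assert (Rabs a <= (r + Rabs v) / Rabs u); [|lra].
    apply Rle_div_r; [lra|]. rewrite Rmult_comm, <- Rabs_mult.
    replace (u * a) with (u * a + v + - v) by ring. eapply Rle_trans; [apply Rabs_triang|].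
    rewrite Rabs_Ropp; lra. }
  apply supn_le.
  destruct d as [|[|d]]; unfold aff, upd, crd, psub, mkpt, px, py, pz in *; simpl in *;
    split; [|split| |split| |split]; auto; lra.
Qed.

Lemma boxI_Cc_affine d u v f I : (d < 3)%nat -> u <> 0 -> Cc f -> boxI f I ->
  boxI (fun p => f (aff d u v p)) (/ Rabs u * I).
Proof.
  intros Hd Hu F HI. pose proof (Rabs_pos_lt u Hu).
  destruct (Cc_supp f F) as [r [Hr S]]. destruct (Cc_supp _ (aff_Cc d u v f Hu F)) as [r' [Hr' S']].
  set (s := r + r' + (r + Rabs v) / Rabs u).
  assert (Q : 0 <= (r + Rabs v) / Rabs u).
  { apply Rdiv_le_0_compat; auto. pose proof (Rabs_pos v); lra. }
  assert (Hs : r <= s /\ r' <= s) by (unfold s; lra).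
  rewrite (boxI_unique f I (Tint s f)); auto.
  - rewrite <- (Tint_affine d f r u v s); auto; try lra; [|apply F|].
    + apply Cc_boxI; [lra|apply (aff_Cc d u v f Hu F)|]. intros p Hp. apply S'. lra.
    + assert ((r + Rabs v) / Rabs u <= s) by (unfold s; lra).
      apply Rle_div_l in H0; lra.
  - apply Cc_boxI; [lra|apply F|]. intros p Hp. apply S; lra.
Qed.

(** Transporting the squeezing functions gives integrability. Both candidate values then lie between
    the transported bounds, whose gap can be made smaller than any positive distance between
    them. *)
Lemma RI_affine d u v f I : (d < 3)%nat -> u <> 0 -> RI f I -> RI (fun p => f (aff d u v p)) (/ Rabs u * I).
Proof.
  intros Hd Hu [F B]. pose proof (Rabs_pos_lt u Hu). assert (Hi := Rinv_0_lt_compat _ H).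
  assert (FA : intble (fun p => f (aff d u v p))).
  { intros e He. destruct (F (e * Rabs u) ltac:(nra)) as [g1 [g2 [a [b [C1 [C2 [B1 [B2 [L D]]]]]]]]].
    exists (fun p => g1 (aff d u v p)), (fun p => g2 (aff d u v p)), (/ Rabs u * a), (/ Rabs u * b).
    do 4 (split; [auto using aff_Cc, boxI_Cc_affine|]). split; [auto|].
    apply Rlt_div_l in D; auto. unfold Rdiv in D. lra. }
  destruct (intble_RI _ FA) as [J HJ].
  replace (/ Rabs u * I) with J; auto.
  apply Rminus_diag_uniq. apply NNPP. intros Hne. apply Rabs_pos_lt in Hne.
  destruct (F (Rabs (J - / Rabs u * I) * Rabs u) ltac:(nra)) as [g1 [g2 [a [b [C1 [C2 [B1 [B2 [L D]]]]]]]]].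
  assert (a <= I <= b).
  { split; [apply (boxI_le nil g1 f)|apply (boxI_le nil f g2)]; auto; intros p _; apply L. }
  assert (/ Rabs u * a <= J <= / Rabs u * b).
  { split.
    - apply (boxI_le nil (fun p => g1 (aff d u v p)) (fun p => f (aff d u v p))).
      + apply boxI_Cc_affine; auto.
      + apply HJ.
      + intros p _. apply L.
    - apply (boxI_le nil (fun p => f (aff d u v p)) (fun p => g2 (aff d u v p))).
      + apply HJ.
      + apply boxI_Cc_affine; auto.
      + intros p _. apply L. }
  apply Rlt_div_l in D; auto.
  assert (/ Rabs u * a <= / Rabs u * I <= / Rabs u * b) by (split; apply Rmult_le_compat_l; lra).
  assert (Rabs (J - / Rabs u * I) <= (b - a) / Rabs u); [|lra].
  unfold Rdiv. apply Rabs_le. lra.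
Qed.

Lemma RI_nonneg l f I : RI f I -> (forall p, off l p -> 0 <= f p) -> 0 <= I.
Proof.
  intros F H. rewrite <- (Rmult_0_l I). apply (RI_le l (fun p => 0 * f p) f); auto.
  - apply RI_scal; auto.
  - intros p Hp. rewrite Rmult_0_l. auto.
Qed.

Lemma RI_abs_le l f g I J : RI f I -> RI g J -> (forall p, off l p -> Rabs (f p) <= g p) -> Rabs I <= J.
Proof.
  intros F G H.
  assert (I <= J) by (apply (RI_le l f g); auto; intros p Hp; eapply Rle_trans; [apply Rle_abs|auto]).
  assert (-1 * I <= J).
  { apply (RI_le l (fun p => -1 * f p) g); auto using RI_scal. intros p Hp.
    specialize (H p Hp). apply Rabs_le_between in H. lra. }
  apply Rabs_le. lra.
Qed.

(** * Norms and powers *)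

Lemma pnorm_sq p : pnorm p ^ 2 = px p ^ 2 + py p ^ 2 + pz p ^ 2.
Proof.
  unfold pnorm. rewrite <- Rsqr_pow2, Rsqr_sqrt; [reflexivity|].
  pose proof (pow2_ge_0 (px p)). pose proof (pow2_ge_0 (py p)). pose proof (pow2_ge_0 (pz p)). lra.
Qed.

Lemma pnorm_nonneg p : 0 <= pnorm p.
Proof. apply sqrt_pos. Qed.

Lemma sq_le_abs a b : 0 <= b -> a ^ 2 <= b ^ 2 -> Rabs a <= b.
Proof. intros Hb H. apply Rabs_le. split; nra. Qed.

Lemma crd_le_pnorm d p : Rabs (crd d p) <= pnorm p.
Proof.
  apply sq_le_abs; [apply pnorm_nonneg|]. rewrite pnorm_sq.
  pose proof (pow2_ge_0 (px p)). pose proof (pow2_ge_0 (py p)). pose proof (pow2_ge_0 (pz p)).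
  destruct d as [|[|d]]; simpl crd; lra.
Qed.

Lemma supn_le_pnorm p : supn p <= pnorm p.
Proof.
  apply supn_le. split; [|split]; [apply (crd_le_pnorm 0)|apply (crd_le_pnorm 1)|apply (crd_le_pnorm 2)].
Qed.

Lemma supn_nonneg p : 0 <= supn p.
Proof. eapply Rle_trans; [apply (Rabs_pos (px p))|apply (crd_le_supn 0)]. Qed.

Lemma sq_of_abs_le a s : Rabs a <= s -> a ^ 2 <= s ^ 2.
Proof. intros H. apply Rabs_le_between in H. nra. Qed.

Lemma pnorm_le_supn p : pnorm p <= 2 * supn p.
Proof.
  pose proof (supn_nonneg p). rewrite <- (Rabs_right (pnorm p)) by (apply Rle_ge, pnorm_nonneg).
  apply sq_le_abs; [lra|]. rewrite pnorm_sq.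
  pose proof (sq_of_abs_le _ _ (crd_le_supn 0 p)). pose proof (sq_of_abs_le _ _ (crd_le_supn 1 p)).
  pose proof (sq_of_abs_le _ _ (crd_le_supn 2 p)). simpl crd in *. nra.
Qed.

Lemma pnorm_triang p q : pnorm (padd p q) <= pnorm p + pnorm q.
Proof.
  pose proof (pnorm_nonneg p). pose proof (pnorm_nonneg q).
  rewrite <- (Rabs_right (pnorm (padd p q))) by (apply Rle_ge, pnorm_nonneg).
  apply sq_le_abs; [lra|].
  (* Cauchy-Schwarz, from Lagrange's identity. *)
  assert (CS : Rabs (px p * px q + py p * py q + pz p * pz q) <= pnorm p * pnorm q).
  { apply sq_le_abs; [nra|]. rewrite Rpow_mult_distr, !pnorm_sq.
    pose proof (pow2_ge_0 (px p * py q - py p * px q)).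
    pose proof (pow2_ge_0 (px p * pz q - pz p * px q)).
    pose proof (pow2_ge_0 (py p * pz q - pz p * py q)). nra. }
  apply Rabs_le_between in CS.
  pose proof (pnorm_sq p). pose proof (pnorm_sq q).
  rewrite pnorm_sq. unfold padd, mkpt, px, py, pz in *; simpl fst in *; simpl snd in *. nra.
Qed.

Lemma pnorm_scal c p : 0 <= c -> pnorm (pscal c p) = c * pnorm p.
Proof.
  intros Hc. unfold pnorm, pscal, mkpt, px, py, pz; simpl fst; simpl snd.
  replace ((c * fst (fst p)) ^ 2 + (c * snd (fst p)) ^ 2 + (c * snd p) ^ 2)
    with (c ^ 2 * (fst (fst p) ^ 2 + snd (fst p) ^ 2 + snd p ^ 2)) by ring.
  rewrite sqrt_mult_alt by apply pow2_ge_0. rewrite sqrt_pow2; auto.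
Qed.

Lemma pnorm_opp p : pnorm (pscal (-1) p) = pnorm p.
Proof. unfold pnorm, pscal, mkpt, px, py, pz; simpl fst; simpl snd. f_equal. ring. Qed.

Lemma pt_eq p q : px p = px q -> py p = py q -> pz p = pz q -> p = q.
Proof. destruct p as [[? ?] ?], q as [[? ?] ?]. unfold px, py, pz; simpl. congruence. Qed.

Lemma pnorm_sub_sym p q : pnorm (psub p q) = pnorm (psub q p).
Proof. rewrite <- pnorm_opp. f_equal. apply pt_eq; unfold pscal, psub, mkpt, px, py, pz; simpl; ring. Qed.

Lemma pnorm_lip p q : Rabs (pnorm p - pnorm q) <= pnorm (psub p q).
Proof.
  assert (H : forall p q, pnorm p - pnorm q <= pnorm (psub p q)).
  { intros a b. pose proof (pnorm_triang (psub a b) b).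
    replace (padd (psub a b) b) with a in H; [lra|].
    apply pt_eq; unfold padd, psub, mkpt, px, py, pz; simpl; ring. }
  apply Rabs_le. pose proof (H p q). pose proof (H q p). rewrite (pnorm_sub_sym q p) in *. lra.
Qed.

Lemma supn_scal c p : 0 <= c -> supn (pscal c p) = c * supn p.
Proof.
  intros Hc. unfold supn, pscal, mkpt, px, py, pz; simpl fst; simpl snd.
  rewrite !Rabs_mult, (Rabs_right c) by lra. rewrite !RmaxRmult; auto.
Qed.

(** * Real powers and their differences *)

Lemma rpow_pos b e : 0 < b -> rpow b e = Rpower b e.
Proof. intros. unfold rpow. destruct (Rlt_dec 0 b); [auto|lra]. Qed.

Lemma rpow_gt_0 b e : 0 < b -> 0 < rpow b e.
Proof. intros. rewrite rpow_pos; auto. apply exp_pos. Qed.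

Lemma rpow_nonneg b e : 0 <= rpow b e.
Proof. unfold rpow. destruct (Rlt_dec 0 b); [left; apply exp_pos|lra]. Qed.

(** It holds for b <= 0 too, where every [rpow] is 0; this lets products of powers of the norm be
    combined without excluding the origin. *)
Lemma rpow_plus b e e' : rpow b (e + e') = rpow b e * rpow b e'.
Proof. unfold rpow. destruct (Rlt_dec 0 b); [apply Rpower_plus|ring]. Qed.

Lemma rpow_0 b : 0 < b -> rpow b 0 = 1.
Proof. intros. rewrite rpow_pos; auto. apply Rpower_O; auto. Qed.

Lemma rpow_1 b : 0 < b -> rpow b 1 = b.
Proof. intros. rewrite rpow_pos; auto. apply Rpower_1; auto. Qed.

Lemma rpow_INR b n : 0 < b -> rpow b (INR n) = b ^ n.
Proof. intros. rewrite rpow_pos; auto. apply Rpower_pow; auto. Qed.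

Lemma rpow_mult_distr a b e : 0 < a -> 0 < b -> rpow (a * b) e = rpow a e * rpow b e.
Proof.
  intros. rewrite !rpow_pos by nra. symmetry. apply Rpower_mult_distr; auto.
Qed.

Lemma rpow_le_pos a b e : 0 <= a <= b -> 0 <= e -> rpow a e <= rpow b e.
Proof.
  intros H He. unfold rpow. destruct (Rlt_dec 0 a), (Rlt_dec 0 b); try lra.
  - apply Rle_Rpower_l; lra.
  - left; apply exp_pos.
Qed.

Lemma rpow_le_neg a b e : 0 < a <= b -> e <= 0 -> rpow b e <= rpow a e.
Proof.
  intros H He. rewrite !rpow_pos by lra. unfold Rpower.
  assert (ln a <= ln b) by (apply ln_le; lra).
  destruct (Req_dec (e * ln b) (e * ln a)) as [->|Hn]; [lra|].
  left. apply exp_increasing. nra.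
Qed.

Lemma rpow_pow b e n : 0 < b -> rpow (b ^ n) e = rpow b e ^ n.
Proof.
  intros Hb. induction n as [|n IH]; simpl.
  - rewrite rpow_pos by lra. unfold Rpower. rewrite ln_1, Rmult_0_r. apply exp_0.
  - rewrite rpow_mult_distr, IH; auto. apply pow_lt; auto.
Qed.

Lemma rpow_inv b e : 0 < b -> rpow b (- e) = / rpow b e.
Proof. intros. rewrite !rpow_pos; auto. apply Rpower_Ropp. Qed.

Lemma rpow_MVT a b e : 0 < a -> 0 < b ->
  exists c, (a <= c <= b \/ b <= c <= a) /\ rpow b e - rpow a e = e * rpow c (e - 1) * (b - a).
Proof.
  intros Ha Hb.
  assert (K : forall x, 0 < x -> derivable_pt_lim (fun x => rpow x e) x (e * rpow x (e - 1))).
  { intros x Hx. rewrite rpow_pos by auto. apply is_derive_Reals.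
    apply (is_derive_ext_loc (fun x => Rpower x e)).
    - exists (mkposreal x Hx). intros y Hy. rewrite rpow_pos; auto.
      unfold ball in Hy; simpl in Hy; unfold AbsRing_ball, abs, minus, plus, opp in Hy; simpl in Hy.
      apply Rabs_def2 in Hy. lra.
    - apply is_derive_Reals, derivable_pt_lim_power; auto. }
  destruct (Rtotal_order a b) as [H|[->|H]].
  - destruct (MVT_cor2 (fun x => rpow x e) (fun x => e * rpow x (e - 1)) a b H) as [c [E Hc]].
    + intros; apply K; lra.
    + exists c. split; [left; lra|exact E].
  - exists b. split; [left; lra|ring].
  - destruct (MVT_cor2 (fun x => rpow x e) (fun x => e * rpow x (e - 1)) b a H) as [c [E Hc]].
    + intros; apply K; lra.
    + exists c. split; [right; lra|lra].
Qed.

Lemma rpow_lip e m a b : e <= 0 -> 0 < m -> m <= a -> m <= b ->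
  Rabs (rpow a e - rpow b e) <= - e * rpow m (e - 1) * Rabs (a - b).
Proof.
  intros He Hm Ha Hb. destruct (rpow_MVT b a e) as [c [Hc E]]; try lra.
  rewrite E, !Rabs_mult, Rabs_left1 by auto. apply Rmult_le_compat_r; [apply Rabs_pos|].
  apply Rmult_le_compat_l; [lra|]. rewrite Rabs_right by apply Rle_ge, rpow_nonneg.
  apply rpow_le_neg; lra.
Qed.

(** The mean value theorem is applied to the power e and then to the power e - 1. This loses the
    factor 1/2 of Taylor's formula, which only affects constants. *)
Lemma rpow_taylor2 e m a b : e <= 0 -> 0 < m -> m <= a -> m <= b ->
  Rabs (rpow b e - rpow a e - e * rpow a (e - 1) * (b - a)) <= - e * (1 - e) * rpow m (e - 2) * (b - a) ^ 2.
Proof.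
  intros He Hm Ha Hb. destruct (rpow_MVT a b e) as [c [Hc E]]; try lra.
  rewrite E. replace (e * rpow c (e - 1) * (b - a) - e * rpow a (e - 1) * (b - a))
    with (e * (rpow c (e - 1) - rpow a (e - 1)) * (b - a)) by ring.
  rewrite !Rabs_mult, Rabs_left1 by auto.
  assert (H := rpow_lip (e - 1) m c a ltac:(lra) Hm ltac:(lra) Ha).
  replace (e - 1 - 1) with (e - 2) in H by ring.
  assert (Hca : Rabs (c - a) <= Rabs (b - a)) by (unfold Rabs; destruct (Rcase_abs (c - a)), (Rcase_abs (b - a)); lra).
  assert (Hp := rpow_nonneg m (e - 2)).
  assert (H' : Rabs (rpow c (e - 1) - rpow a (e - 1)) <= (1 - e) * rpow m (e - 2) * Rabs (b - a)).
  { eapply Rle_trans; [exact H|]. replace (- (e - 1)) with (1 - e) by ring.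
    apply Rmult_le_compat_l; auto. nra. }
  rewrite <- (pow2_abs (b - a)).
  replace (- e * (1 - e) * rpow m (e - 2) * Rabs (b - a) ^ 2)
    with (- e * ((1 - e) * rpow m (e - 2) * Rabs (b - a)) * Rabs (b - a)) by ring.
  apply Rmult_le_compat_r; [apply Rabs_pos|]. apply Rmult_le_compat_l; lra.
Qed.

(** * Jordan measurable sets *)

Lemma ind_true (P : Prop) : P -> ind P = 1.
Proof. intros. unfold ind. destruct (excluded_middle_informative P); tauto. Qed.

Lemma ind_false (P : Prop) : ~ P -> ind P = 0.
Proof. intros. unfold ind. destruct (excluded_middle_informative P); tauto. Qed.

Lemma ind_bound (P : Prop) : 0 <= ind P <= 1.
Proof. unfold ind. destruct (excluded_middle_informative P); lra. Qed.

Lemma ind_iff (P Q : Prop) : (P <-> Q) -> ind P = ind Q.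
Proof. intros H. unfold ind. destruct (excluded_middle_informative P), (excluded_middle_informative Q); tauto. Qed.

Lemma ind_and (P Q : Prop) : ind (P /\ Q) = ind P * ind Q.
Proof.
  unfold ind. destruct (excluded_middle_informative (P /\ Q)), (excluded_middle_informative P), (excluded_middle_informative Q); try tauto; lra.
Qed.

Lemma ind_not (P : Prop) : ind (~ P) = 1 - ind P.
Proof. unfold ind. destruct (excluded_middle_informative P), (excluded_middle_informative (~ P)); try tauto; lra. Qed.

Ltac ind_cases := unfold ind; repeat match goal with |- context [excluded_middle_informative ?P] => destruct (excluded_middle_informative P) end.

Lemma BUC_of_lip f K : bounded_fun f -> 0 < K -> (forall p q, Rabs (f p - f q) <= K * supn (psub p q)) -> BUC f.
Proof.
  intros B HK H. split; auto. intros e He. exists (e / K). split; [apply Rdiv_lt_0_compat; auto|].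
  intros p q Hpq. eapply Rle_lt_trans; [apply H|]. apply Rlt_div_r in Hpq; lra.
Qed.

(** * Diagonal affine changes of variables and scaling *)

Definition diag_affine (u v p : pt) : pt := mkpt (px u * px p + px v) (py u * py p + py v) (pz u * pz p + pz v).

Lemma RI_diag_affine u v f I : px u <> 0 -> py u <> 0 -> pz u <> 0 -> RI f I ->
  RI (fun p => f (diag_affine u v p)) (/ Rabs (px u) * (/ Rabs (py u) * (/ Rabs (pz u) * I))).
Proof.
  intros H1 H2 H3 HI.
  apply (RI_affine 0 (px u) (px v) (fun p => f (aff 2 (pz u) (pz v) (aff 1 (py u) (py v) p)))); auto.
  apply (RI_affine 1 (py u) (py v) (fun p => f (aff 2 (pz u) (pz v) p))); auto.
  apply (RI_affine 2 (pz u) (pz v) f); auto.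
Qed.

Lemma intble_diag_affine u v f : px u <> 0 -> py u <> 0 -> pz u <> 0 -> intble f -> intble (fun p => f (diag_affine u v p)).
Proof.
  intros H1 H2 H3 HI. destruct (intble_RI f HI) as [I HI']. apply (RI_diag_affine u v f I H1 H2 H3 HI').
Qed.

Lemma diag_affine_BUC u v f : BUC f -> BUC (fun p => f (diag_affine u v p)).
Proof.
  intros F. apply (aff_BUC 0 (px u) (px v) (fun p => f (aff 2 (pz u) (pz v) (aff 1 (py u) (py v) p)))).
  apply (aff_BUC 1 (py u) (py v) (fun p => f (aff 2 (pz u) (pz v) p))).
  apply (aff_BUC 2 (pz u) (pz v) f); auto.
Qed.

Lemma pscal_diag_affine c p : pscal c p = diag_affine (mkpt c c c) origin p.
Proof. apply pt_eq; unfold pscal, diag_affine, origin, mkpt, px, py, pz; simpl; ring. Qed.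

Lemma RI_scaled c f I : 0 < c -> RI f I -> RI (fun p => f (pscal c p)) (/ c ^ 3 * I).
Proof.
  intros Hc HI.
  assert (H := RI_diag_affine (mkpt c c c) origin f I). unfold mkpt, px, py, pz in H; simpl fst in H; simpl snd in H.
  specialize (H ltac:(lra) ltac:(lra) ltac:(lra) HI). rewrite Rabs_right in H by lra.
  replace (/ c ^ 3 * I) with (/ c * (/ c * (/ c * I))) by (field; lra).
  apply (RI_ext (fun p => f (diag_affine (c, c, c) origin p))); auto.
  intros p. rewrite pscal_diag_affine. reflexivity.
Qed.

Definition clamp (t : R) : R := Rmin 1 (Rmax 0 t).

Lemma clamp_lip s t : Rabs (clamp s - clamp t) <= Rabs (s - t).
Proof.
  unfold clamp, Rmin, Rmax.
  destruct (Rle_dec 0 s), (Rle_dec 0 t); repeat match goal with |- context [Rle_dec 1 ?x] => destruct (Rle_dec 1 x) end;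
  unfold Rabs; repeat match goal with |- context [Rcase_abs ?x] => destruct (Rcase_abs x) end; lra.
Qed.

Lemma clamp_bound t : 0 <= clamp t <= 1.
Proof. unfold clamp, Rmin, Rmax. destruct (Rle_dec 0 t); destruct (Rle_dec 1 _); lra. Qed.

Lemma clamp_1 t : 1 <= t -> clamp t = 1.
Proof. intros. unfold clamp. rewrite Rmax_right, Rmin_left; lra. Qed.

Lemma clamp_0 t : t <= 0 -> clamp t = 0.
Proof. intros. unfold clamp. rewrite Rmax_left, Rmin_right; lra. Qed.

(* The indicator of a gauge ball lies between a bump function and its dilate,
   whose integrals differ by a factor close to 1. *)
Lemma gauge_intble (N : pt -> R) (A : pt -> Prop) :
  (forall p, supn p <= N p <= 2 * supn p) ->
  (forall p q, Rabs (N p - N q) <= 2 * supn (psub p q)) ->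
  (forall c p, 0 <= c -> N (pscal c p) = c * N p) ->
  (forall p, N p < 1 -> A p) -> (forall p, A p -> N p <= 1) ->
  intble (fun p => ind (A p)).
Proof.
  intros N1 N2 N3 A1 A2.
  set (bump := fun l p => clamp ((l - N p) / (l - 1))).
  assert (C : forall l, 1 < l -> Cc (bump l)).
  { intros l Hl. split.
    - apply (BUC_of_lip _ (2 / (l - 1))).
      + exists 1. intros p. unfold bump. apply Rabs_le. pose proof (clamp_bound ((l - N p) / (l - 1))). lra.
      + apply Rdiv_lt_0_compat; lra.
      + intros p q. eapply Rle_trans; [apply clamp_lip|].
        replace ((l - N p) / (l - 1) - (l - N q) / (l - 1)) with ((N q - N p) * / (l - 1)) by (field; lra).
        rewrite Rabs_mult, Rabs_minus_sym, (Rabs_right (/ (l - 1))) by (left; apply Rinv_0_lt_compat; lra).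
        replace (2 / (l - 1) * supn (psub p q)) with (2 * supn (psub p q) * / (l - 1)) by (field; lra).
        apply Rmult_le_compat_r; [left; apply Rinv_0_lt_compat; lra|auto].
    - exists l. intros p Hp. apply clamp_0. specialize (N1 p).
      assert (0 <= (N p - l) / (l - 1)) by (apply Rdiv_le_0_compat; lra).
      replace ((l - N p) / (l - 1)) with (- ((N p - l) / (l - 1))) by (field; lra). lra. }
  assert (bump1 : forall l p, 1 < l -> N p <= 1 -> bump l p = 1).
  { intros l p Hl Hp. apply clamp_1. apply Rle_div_r; lra. }
  assert (bump0 : forall l p, 1 < l -> l <= N p -> bump l p = 0).
  { intros l p Hl Hp. apply clamp_0. apply Rle_div_l; lra. }
  assert (bumpb : forall l p, 0 <= bump l p <= 1) by (intros; apply clamp_bound).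
  (* [V] dominates the integral of every [bump l] with l <= 2, because [bump 2] at half scale equals
     1 where N <= 2. It is fixed first, since the choice of l depends on it. *)
  destruct (intble_RI _ (Cc_intble _ (C 2 ltac:(lra)))) as [V0 HV0].
  assert (HV := RI_scaled (/ 2) _ _ ltac:(lra) HV0). set (V := / (/ 2) ^ 3 * V0) in *.
  assert (V0p : 0 <= V).
  { eapply (RI_nonneg nil); [exact HV|]. intros p _. apply bumpb. }
  (* With l = 1 + d the two squeezing integrals differ by b (1 - l^-3) <= 3 V d, and d is chosen to
     make this smaller than e. *)
  intros e He. set (d := Rmin 1 (e / (3 * V + 1) / 2)).
  assert (Hd : 0 < d <= 1).
  { split; [|apply Rmin_l]. apply Rmin_pos; [lra|]. repeat apply Rdiv_lt_0_compat; lra. }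
  assert (Hd' : 3 * V * d < e).
  { assert (d <= e / (3 * V + 1) / 2) by apply Rmin_r.
    assert (d * (3 * V + 1) <= e / 2).
    { apply Rle_div_r; [lra|]. replace (e / 2 / (3 * V + 1)) with (e / (3 * V + 1) / 2) by (field; lra). auto. }
    nra. }
  set (l := 1 + d). assert (Hl : 1 < l) by (unfold l; lra).
  destruct (intble_RI _ (Cc_intble _ (C l Hl))) as [b Hb].
  assert (Ha := RI_scaled l _ _ ltac:(lra) Hb).
  assert (Hbb : 0 <= b <= V).
  { split.
    - eapply (RI_nonneg nil); [exact Hb|]. intros p _. apply bumpb.
    - apply (RI_le nil (bump l) (fun p => bump 2 (pscal (/ 2) p))); auto. intros p _.
      destruct (Rle_dec (N p) 2).
      + rewrite (bump1 2 (pscal (/2) p)); [apply bumpb|lra|]. rewrite N3; lra.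
      + rewrite (bump0 l p); [apply bumpb|auto|]. unfold l. lra. }
  exists (fun p => bump l (pscal l p)), (bump l), (/ l ^ 3 * b), b.
  assert (CL : Cc (fun p => bump l (pscal l p))).
  { replace (fun p => bump l (pscal l p)) with (fun p => bump l (diag_affine (mkpt l l l) origin p))
      by (apply functional_extensionality; intros; rewrite pscal_diag_affine; reflexivity).
    apply (aff_Cc 0 l 0 (fun p => bump l (aff 2 l 0 (aff 1 l 0 p)))); [lra|].
    apply (aff_Cc 1 l 0 (fun p => bump l (aff 2 l 0 p))); [lra|].
    apply (aff_Cc 2 l 0 (bump l)); [lra|auto]. }
  split; [auto|]. split; [auto|]. split; [apply Ha|]. split; [apply Hb|]. split.
  - intros p. destruct (classic (A p)) as [HA|HA].
    + rewrite ind_true by auto. rewrite (bump1 l p); auto. split; [apply bumpb|lra].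
    + rewrite ind_false by auto. split; [|apply bumpb]. rewrite bump0; [lra|auto|].
      rewrite N3 by lra. assert (1 <= N p); [|nra]. apply Rnot_lt_le. auto.
  - set (x := / l). assert (0 < x) by (apply Rinv_0_lt_compat; lra).
    assert (x * l = 1) by (unfold x; field; lra).
    replace (/ l ^ 3) with (x ^ 3) by (unfold x; field; lra).
    assert (x <= 1) by nra. assert (1 - x <= d) by (unfold l in *; nra).
    assert (1 - x ^ 3 <= 3 * d) by nra.
    assert (b * (1 - x ^ 3) <= V * (3 * d)); [|lra].
    assert (0 <= 1 - x ^ 3) by nra.
    apply Rmult_le_compat; lra.
Qed.

Lemma ball_intble r : 0 < r -> intble (fun p => ind (pnorm p <= r)).
Proof.
  intros Hr.
  assert (H : intble (fun p => ind (pnorm p <= 1))).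
  { apply (gauge_intble pnorm); auto using pnorm_scal; try (intros; lra).
    - intros p. split; [apply supn_le_pnorm|apply pnorm_le_supn].
    - intros p q. eapply Rle_trans; [apply pnorm_lip|apply pnorm_le_supn]. }
  destruct (intble_RI _ H) as [I HI].
  destruct (RI_scaled (/ r) _ _ (Rinv_0_lt_compat _ Hr) HI) as [H' _].
  eapply intble_ext; [|exact H']. intros p. cbv beta. apply ind_iff.
  rewrite pnorm_scal by (left; apply Rinv_0_lt_compat; auto).
  rewrite Rmult_comm. split; intros K; [apply Rle_div_l in K|apply Rle_div_l]; lra.
Qed.

Lemma supn_lip p q : Rabs (supn p - supn q) <= supn (psub p q).
Proof.
  assert (H : forall p q, supn p <= supn (psub p q) + supn q).
  { intros a b. apply supn_le.
    destruct (proj1 (supn_le (psub a b) _) (Rle_refl _)) as [A1 [A2 A3]].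
    destruct (proj1 (supn_le b _) (Rle_refl _)) as [B1 [B2 B3]].
    set (s := supn (psub a b)) in *. set (t := supn b) in *.
    unfold psub, mkpt, px, py, pz in *; simpl in *.
    assert (D : forall x y, Rabs (x - y) <= s -> Rabs y <= t -> Rabs x <= s + t).
    { intros x y Hx Hy. replace x with ((x - y) + y) by ring. eapply Rle_trans; [apply Rabs_triang|lra]. }
    split; [|split]; eapply D; eauto. }
  assert (E : supn (psub p q) = supn (psub q p)).
  { unfold supn, psub, mkpt, px, py, pz; simpl.
    rewrite (Rabs_minus_sym (fst (fst p))), (Rabs_minus_sym (snd (fst p))), (Rabs_minus_sym (snd p)). reflexivity. }
  apply Rabs_le. pose proof (H p q). pose proof (H q p). rewrite <- E in H1. lra.
Qed.

Lemma cube_intble (A : pt -> Prop) :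
  (forall p, supn p < 1 -> A p) -> (forall p, A p -> supn p <= 1) -> intble (fun p => ind (A p)).
Proof.
  intros. apply (gauge_intble supn); auto using supn_scal.
  - intros p. pose proof (supn_nonneg p). lra.
  - intros p q. pose proof (supn_lip p q). pose proof (supn_nonneg (psub p q)). lra.
Qed.

(* An axis-parallel cube with any part of its boundary. *)
Lemma box_intble (a : pt) s (A : pt -> Prop) : 0 < s ->
  (forall p, (px a < px p < px a + s /\ py a < py p < py a + s /\ pz a < pz p < pz a + s) -> A p) ->
  (forall p, A p -> in_cbox a (padd a (mkpt s s s)) p) ->
  intble (fun p => ind (A p)).
Proof.
  intros Hs H1 H2.
  set (c := 2 / s). assert (Hc : 0 < c) by (apply Rdiv_lt_0_compat; lra).
  assert (Hcs : c * s = 2) by (unfold c; field; lra).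
  (* The affine map that sends [-1, 1]^3 onto the given cube. *)
  set (back := fun q : pt => mkpt (px a + (px q + 1) / c) (py a + (py q + 1) / c) (pz a + (pz q + 1) / c)).
  assert (H : intble (fun p => ind (A (back p)))).
  { apply cube_intble.
    - intros p Hp. apply supn_lt in Hp. destruct Hp as [P1 [P2 P3]].
      apply Rabs_def2 in P1, P2, P3. apply H1. unfold back, mkpt, px, py, pz in *; simpl.
      assert (D : forall x, -1 < x < 1 -> 0 < (x + 1) / c < s).
      { intros x Hx. split; [apply Rdiv_lt_0_compat; lra|]. apply Rlt_div_l; auto. nra. }
      destruct (D _ (conj (proj2 P1) (proj1 P1))), (D _ (conj (proj2 P2) (proj1 P2))), (D _ (conj (proj2 P3) (proj1 P3))). lra.
    - intros p Hp. apply H2 in Hp. destruct Hp as [P1 [P2 P3]]. apply supn_le.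
      assert (D : forall x, 0 <= (x + 1) / c <= s -> Rabs x <= 1).
      { intros x Hx. destruct Hx as [Ha Hb]. apply Rle_div_l in Hb; auto.
        assert (0 <= x + 1). { replace (x + 1) with ((x + 1) / c * c) by (field; lra). nra. }
        apply Rabs_le. nra. }
      unfold back, padd, mkpt, px, py, pz in *; simpl in *.
      split; [|split]; apply D; lra. }
  assert (H' := intble_diag_affine (mkpt c c c) (mkpt (-1 - c * px a) (-1 - c * py a) (-1 - c * pz a)) _
     ltac:(unfold px, mkpt; simpl; lra) ltac:(unfold py, mkpt; simpl; lra) ltac:(unfold pz, mkpt; simpl; lra) H).
  eapply intble_ext; [|exact H']. intros p. cbv beta. f_equal. f_equal.
  apply pt_eq; unfold back, diag_affine, mkpt, px, py, pz; simpl; field; lra.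
Qed.

(** Intersecting with every cube admits unbounded sets such as the octant and complements of balls,
    whose indicators are not [intble] because [intble] forces bounded support. *)
Definition Jset (A : pt -> Prop) : Prop := forall r, 0 < r -> intble (fun p => ind (supn p <= r /\ A p)).

Lemma Jset_iff (A B : pt -> Prop) : (forall p, A p <-> B p) -> Jset A -> Jset B.
Proof.
  intros H HA r Hr. eapply intble_ext; [|apply (HA r Hr)]. intros p. apply ind_iff. rewrite H. tauto.
Qed.

Lemma supn_box_intble r : 0 < r -> intble (fun p => ind (supn p <= r)).
Proof.
  intros Hr. apply (box_intble (mkpt (-r) (-r) (-r)) (2 * r)); [lra| |].
  - intros p [P1 [P2 P3]]. apply supn_le. unfold mkpt, px, py, pz in *; simpl in *.
    split; [|split]; apply Rabs_le; lra.
  - intros p Hp. apply supn_le in Hp. destruct Hp as [P1 [P2 P3]].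
    apply Rabs_le_between in P1, P2, P3.
    unfold in_cbox, padd, mkpt, px, py, pz in *; simpl in *. lra.
Qed.

Lemma Jset_intble A : intble (fun p => ind (A p)) -> Jset A.
Proof.
  intros H r Hr. eapply intble_ext; [|apply (intble_min _ _ (supn_box_intble r Hr) H)].
  intros p. cbv beta. rewrite ind_and. unfold Rmin. ind_cases; destruct (Rle_dec _ _); lra.
Qed.

Lemma Jset_and A B : Jset A -> Jset B -> Jset (fun p => A p /\ B p).
Proof.
  intros HA HB r Hr. eapply intble_ext; [|apply (intble_min _ _ (HA r Hr) (HB r Hr))].
  intros p. cbv beta. rewrite !ind_and. unfold Rmin. ind_cases; destruct (Rle_dec _ _); lra.
Qed.

Lemma Jset_not A : Jset A -> Jset (fun p => ~ A p).
Proof.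
  intros HA r Hr.
  eapply intble_ext; [|apply (intble_plus _ _ (supn_box_intble r Hr) (intble_scal (-1) _ (HA r Hr)))].
  intros p. cbv beta. rewrite !ind_and, ind_not. ring.
Qed.

Lemma Jset_True : Jset (fun _ => True).
Proof.
  intros r Hr. eapply intble_ext; [|apply (supn_box_intble r Hr)]. intros p. apply ind_iff. tauto.
Qed.

Lemma Jset_outside rho : 0 < rho -> Jset (fun p => rho < pnorm p).
Proof.
  intros H. apply (Jset_iff (fun p => ~ pnorm p <= rho)).
  - intros p. split; [apply Rnot_le_lt|intros; lra].
  - apply Jset_not, Jset_intble, ball_intble; auto.
Qed.

Definition oct (p : pt) : Prop := 0 <= px p /\ 0 <= py p /\ 0 <= pz p.

Lemma Jset_oct : Jset oct.
Proof.
  intros r Hr. apply (box_intble origin r); auto.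
  - intros p [P1 [P2 P3]]. unfold origin, oct, mkpt, px, py, pz in *; simpl in *.
    split; [|lra]. apply supn_le. unfold px, py, pz. split; [|split]; apply Rabs_le; lra.
  - intros p [Hp Ho]. apply supn_le in Hp. destruct Hp as [P1 [P2 P3]].
    apply Rabs_le_between in P1, P2, P3.
    unfold in_cbox, oct, padd, origin, mkpt, px, py, pz in *; simpl in *. lra.
Qed.

(** * Dyadic bounds for integrals of powers *)

Lemma RI_zero : RI (fun _ => 0) 0.
Proof.
  assert (C : Cc (fun _ => 0)) by (split; [apply BUC_const|exists 0; auto]).
  destruct (intble_RI _ (Cc_intble _ C)) as [I HI].
  assert (H := RI_scal 0 _ _ HI). rewrite Rmult_0_l in H.
  eapply RI_ext; [|exact H]. intros p. cbv beta. lra.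
Qed.

Lemma RI_sumR n (f : nat -> pt -> R) (I : nat -> R) : (forall i, (i < n)%nat -> RI (f i) (I i)) ->
  RI (fun p => sumR n (fun i => f i p)) (sumR n I).
Proof.
  intros H. induction n as [|n IH]; simpl; [apply RI_zero|].
  apply RI_plus; auto.
Qed.

(** Only the scaling with r matters, so the constant [v] is left unevaluated. *)
Lemma cube_volume : exists v, 0 <= v /\ forall r, 0 < r -> RI (fun p => ind (supn p <= r)) (v * r ^ 3).
Proof.
  destruct (intble_RI _ (supn_box_intble 1 ltac:(lra))) as [v Hv]. exists v. split.
  - apply (RI_nonneg nil _ _ Hv). intros p _. apply ind_bound.
  - intros r Hr. assert (Hi := Rinv_0_lt_compat _ Hr).
    assert (H := RI_scaled (/ r) _ _ Hi Hv).
    replace (v * r ^ 3) with (/ (/ r) ^ 3 * v) by (field; lra).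
    eapply RI_ext; [|exact H]. intros p. cbv beta. apply ind_iff.
    rewrite supn_scal by lra. split; intros K.
    + assert (supn p = r * (/ r * supn p)) by (field; lra). nra.
    + assert (supn p = r * (/ r * supn p)) by (field; lra). apply Rnot_lt_le. intros K'. nra.
Qed.

Lemma geom_le q n : 0 < q < 1 -> sumR n (fun j => q ^ j) <= / (1 - q).
Proof.
  intros Hq. assert (H : (1 - q) * sumR n (fun j => q ^ j) = 1 - q ^ n).
  { induction n as [|n IH]; simpl; [ring|]. rewrite Rmult_plus_distr_l, IH. ring. }
  assert (0 < q ^ n) by (apply pow_lt; lra).
  apply (Rmult_le_reg_l (1 - q)); [lra|]. rewrite H, Rinv_r; lra.
Qed.

Lemma dyadic_down h t n : h * (/ 2) ^ n < t -> t <= h ->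
  exists j, (j < n)%nat /\ h * (/ 2) ^ S j < t <= h * (/ 2) ^ j.
Proof.
  induction n as [|n IH]; simpl; intros H1 H2; [lra|].
  destruct (Rlt_dec (h * (/ 2) ^ n) t) as [Hlt|Hge].
  - destruct IH as [j [Hj K]]; auto. exists j. split; [lia|exact K].
  - exists n. split; [lia|simpl; split; lra].
Qed.

Lemma dyadic_up r t n : r <= t -> t < r * 2 ^ n ->
  exists j, (j < n)%nat /\ r * 2 ^ j <= t <= r * 2 ^ S j.
Proof.
  induction n as [|n IH]; simpl; intros H1 H2; [lra|].
  destruct (Rlt_dec t (r * 2 ^ n)) as [Hlt|Hge].
  - destruct IH as [j [Hj K]]; auto. exists j. split; [lia|exact K].
  - exists n. split; [lia|simpl; split; lra].
Qed.

Lemma half_lt_1 e : 0 < e -> 0 < rpow (/ 2) e < 1.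
Proof.
  intros He. split; [apply rpow_gt_0; lra|]. rewrite rpow_pos by lra. unfold Rpower.
  rewrite <- exp_0. apply exp_increasing. rewrite ln_Rinv by lra. pose proof ln_lt_2. nra.
Qed.

(** On the dyadic shell at scale h 2^-j the function is at most of order (h 2^-j)^(b-3) and the
    enclosing cube has volume of order (h 2^-j)^3, so the contributions form a geometric series of
    ratio 2^-b. The radius rho only makes the number of shells finite; it does not enter the
    constant. *)
Lemma near_bound b : 0 < b < 3 -> exists C, 0 < C /\ forall l h K rho f I, 0 < h -> 0 <= K -> 0 < rho -> RI f I ->
  (forall p, off l p -> f p = 0 \/ (rho < pnorm p /\ supn p <= h /\ Rabs (f p) <= K * rpow (pnorm p) (b - 3))) ->
  Rabs I <= C * K * rpow h b.
Proof.
  intros Hb. destruct cube_volume as [v [Hv V]]. destruct (half_lt_1 b ltac:(lra)) as [Q0 Q1].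
  set (q := rpow (/ 2) b) in *.
  set (B := rpow (/ 2) (b - 3) * v * / (1 - q)).
  assert (HB : 0 <= B).
  { apply Rmult_le_pos; [apply Rmult_le_pos; auto; apply rpow_nonneg|]. left. apply Rinv_0_lt_compat; lra. }
  exists (B + 1). split; [lra|]. intros l h K rho f I Hh HK Hrho HI Hf.
  (* n is such that h 2^-n < rho / 2, which lies below the sup norm of every point with |p| >
     rho. *)
  destruct (pow_lt_1_zero (/ 2) ltac:(rewrite Rabs_right; lra) (rho / (2 * h))) as [n Hn].
  { apply Rdiv_lt_0_compat; lra. }
  specialize (Hn n (le_n n)). rewrite Rabs_right in Hn by (apply Rle_ge, pow_le; lra).
  apply Rlt_div_r in Hn; [|lra].
  set (a := fun j => h * (/ 2) ^ j).
  assert (Ha : forall j, 0 < a j) by (intros; apply Rmult_lt_0_compat; auto; apply pow_lt; lra).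
  (* The exponent b - 3 is negative, so on a shell the power is largest at the inner radius a j /
     2. *)
  set (w := fun j => K * rpow (a j * / 2) (b - 3)).
  assert (Hw : forall j, 0 <= w j) by (intros; apply Rmult_le_pos; auto; apply rpow_nonneg).
  set (g := fun p => sumR n (fun j => w j * ind (supn p <= a j))).
  assert (G : RI g (sumR n (fun j => w j * (v * a j ^ 3)))).
  { unfold g. apply (RI_sumR n (fun j p => w j * ind (supn p <= a j))). intros j _. apply RI_scal, V, Ha. }
  assert (E : sumR n (fun j => w j * (v * a j ^ 3)) <= B * K * rpow h b).
  { rewrite (sumR_ext n _ (fun j => (K * rpow (/2) (b - 3) * v * rpow h b) * q ^ j)).
    - rewrite sumR_scal. unfold B.
      replace (rpow (/ 2) (b - 3) * v * / (1 - q) * K * rpow h b)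
        with (K * rpow (/ 2) (b - 3) * v * rpow h b * / (1 - q)) by ring.
      apply Rmult_le_compat_l; [|apply geom_le; auto].
      repeat apply Rmult_le_pos; auto using rpow_nonneg.
    - intros j _. unfold w. rewrite rpow_mult_distr by (auto; lra).
      assert (Ea : a j ^ 3 * rpow (a j) (b - 3) = rpow h b * q ^ j).
      { rewrite <- (rpow_INR (a j) 3), <- rpow_plus by auto.
        replace (INR 3 + (b - 3)) with b by (simpl; ring).
        unfold a. rewrite rpow_mult_distr, rpow_pow; auto; try lra. apply pow_lt; lra. }
      replace (K * (rpow (a j) (b - 3) * rpow (/ 2) (b - 3)) * (v * a j ^ 3))
        with (K * rpow (/ 2) (b - 3) * v * (a j ^ 3 * rpow (a j) (b - 3))) by ring.
      rewrite Ea. ring. }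
  assert (L : forall p, off l p -> Rabs (f p) <= g p).
  { intros p Hp. destruct (Hf p Hp) as [->|[H1 [H2 H3]]].
    - rewrite Rabs_R0. apply sumR_nonneg. intros j _. apply Rmult_le_pos; auto. apply ind_bound.
    - destruct (dyadic_down h (supn p) n) as [j [Hj [K1 K2]]]; auto.
      { pose proof (pnorm_le_supn p). lra. }
      eapply Rle_trans; [exact H3|].
      apply (Rle_trans _ (w j * ind (supn p <= a j))).
      + rewrite ind_true, Rmult_1_r by exact K2. unfold w. apply Rmult_le_compat_l; auto.
        apply rpow_le_neg; [|lra]. pose proof (Ha j). simpl in K1. unfold a in *.
        pose proof (supn_le_pnorm p). lra.
      + apply (sumR_term_le n (fun j => w j * ind (supn p <= a j))); auto.
        intros i _. apply Rmult_le_pos; auto. apply ind_bound. }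
  assert (HIG := RI_abs_le l f g _ _ HI G L).
  assert (0 <= K * rpow h b) by (apply Rmult_le_pos; auto using rpow_nonneg). lra.
Qed.

(** The same argument with shells growing outwards, again with ratio 2^-b. The bounded support of
    [f] makes their number finite but does not enter the constant. *)
Lemma far_bound b : 0 < b -> exists C, 0 < C /\ forall l r K f I, 0 < r -> 0 <= K -> RI f I ->
  (forall p, off l p -> f p = 0 \/ (r <= pnorm p /\ Rabs (f p) <= K * rpow (pnorm p) (- (3 + b)))) ->
  Rabs I <= C * K * rpow r (- b).
Proof.
  intros Hb. destruct cube_volume as [v [Hv V]]. destruct (half_lt_1 b Hb) as [Q0 Q1].
  set (q := rpow (/ 2) b) in *.
  set (B := 8 * v * rpow (/ 2) (- b) * / (1 - q)).
  assert (HB : 0 <= B).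
  { repeat apply Rmult_le_pos; try lra; [apply rpow_nonneg|]. left. apply Rinv_0_lt_compat; lra. }
  exists (B + 1). split; [lra|]. intros l r K f I Hr HK HI Hf.
  destruct (intble_supp f (proj1 HI)) as [s [Hs S]].
  destruct (pow_lt_1_zero (/ 2) ltac:(rewrite Rabs_right; lra) (r / (2 * (s + 1)))) as [n Hn].
  { apply Rdiv_lt_0_compat; lra. }
  specialize (Hn n (le_n n)). rewrite Rabs_right in Hn by (apply Rle_ge, pow_le; lra).
  apply Rlt_div_r in Hn; [|lra]. rewrite pow_inv in Hn.
  assert (H2n : 0 < 2 ^ n) by (apply pow_lt; lra).
  assert (Hsn : s < r * / 2 * 2 ^ n).
  { apply (Rmult_lt_reg_l (/ 2 ^ n)); [apply Rinv_0_lt_compat; auto|].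
    replace (/ 2 ^ n * (r * / 2 * 2 ^ n)) with (r / 2) by (field; lra).
    assert (0 < / 2 ^ n) by (apply Rinv_0_lt_compat; auto). lra. }
  (* From r <= |p| one gets only r / 2 <= [supn p], so the shells start at r / 2. *)
  set (a := fun j => r * / 2 * 2 ^ j).
  assert (Ha : forall j, 0 < a j) by (intros; apply Rmult_lt_0_compat; [lra|apply pow_lt; lra]).
  set (w := fun j => K * rpow (a j) (- (3 + b))).
  assert (Hw : forall j, 0 <= w j) by (intros; apply Rmult_le_pos; auto; apply rpow_nonneg).
  set (g := fun p => sumR n (fun j => w j * ind (supn p <= 2 * a j))).
  assert (G : RI g (sumR n (fun j => w j * (v * (2 * a j) ^ 3)))).
  { unfold g. apply (RI_sumR n (fun j p => w j * ind (supn p <= 2 * a j))). intros j _.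
    apply RI_scal, V. specialize (Ha j). lra. }
  assert (E : sumR n (fun j => w j * (v * (2 * a j) ^ 3)) <= B * K * rpow r (- b)).
  { rewrite (sumR_ext n _ (fun j => (8 * v * rpow (/2) (- b) * K * rpow r (- b)) * q ^ j)).
    - rewrite sumR_scal. unfold B.
      replace (8 * v * rpow (/ 2) (- b) * / (1 - q) * K * rpow r (- b))
        with (8 * v * rpow (/ 2) (- b) * K * rpow r (- b) * / (1 - q)) by ring.
      apply Rmult_le_compat_l; [|apply geom_le; auto].
      repeat apply Rmult_le_pos; auto using rpow_nonneg; lra.
    - intros j _. unfold w.
      assert (Ea : a j ^ 3 * rpow (a j) (- (3 + b)) = rpow r (- b) * rpow (/ 2) (- b) * q ^ j).
      { rewrite <- (rpow_INR (a j) 3), <- rpow_plus by auto.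
        replace (INR 3 + - (3 + b)) with (- b) by (simpl; ring).
        unfold a. rewrite !rpow_mult_distr, rpow_pow; auto; try lra; try (apply pow_lt; lra).
        f_equal. unfold q. f_equal. replace (/ 2) with (2 ^ 1 * / 4) by field.
        rewrite <- (Rinv_inv 2) at 1. rewrite !rpow_pos by lra. unfold Rpower. f_equal.
        replace (2 ^ 1 * / 4) with (/ 2) by field. rewrite (ln_Rinv (/ 2)) by lra. ring. }
      replace (K * rpow (a j) (- (3 + b)) * (v * (2 * a j) ^ 3))
        with (8 * v * K * (a j ^ 3 * rpow (a j) (- (3 + b)))) by ring.
      rewrite Ea. ring. }
  assert (L : forall p, off l p -> Rabs (f p) <= g p).
  { intros p Hp.
    assert (G0 : 0 <= g p).
    { apply sumR_nonneg. intros j _. apply Rmult_le_pos; auto. apply ind_bound. }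
    destruct (Rlt_dec s (supn p)) as [Hsp|Hsp].
    { rewrite S, Rabs_R0; auto. }
    destruct (Hf p Hp) as [->|[H1 H3]].
    - rewrite Rabs_R0. auto.
    - pose proof (pnorm_le_supn p). pose proof (supn_le_pnorm p).
      destruct (dyadic_up (r * / 2) (supn p) n) as [j [Hj [K1 K2]]]; try lra.
      eapply Rle_trans; [exact H3|].
      apply (Rle_trans _ (w j * ind (supn p <= 2 * a j))).
      + rewrite ind_true, Rmult_1_r by (simpl in K2; unfold a; lra). unfold w. apply Rmult_le_compat_l; auto.
        apply rpow_le_neg; [|lra]. pose proof (Ha j). unfold a in *. lra.
      + apply (sumR_term_le n (fun j => w j * ind (supn p <= 2 * a j))); auto.
        intros i _. apply Rmult_le_pos; auto. apply ind_bound. }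
  assert (HIG := RI_abs_le l f g _ _ HI G L).
  assert (0 <= K * rpow r (- b)) by (apply Rmult_le_pos; auto using rpow_nonneg). lra.
Qed.

(** * Improper integrals *)

Definition cut (rho r : R) (g : pt -> R) (p : pt) : R := ind (supn p <= r) * ind (rho < pnorm p) * g p.

Definition locint (g : pt -> R) : Prop := forall rho r, 0 < rho -> 0 < r -> intble (cut rho r g).

(* [improper_int] at the origin, as a relation; existence of the inner limit is part of it, since
   [lim_pinf] is arbitrary on functions without a limit. *)
Definition Imp (g : pt -> R) (V : R) : Prop :=
  exists G : R -> R,
    (forall rho, 0 < rho -> forall e, 0 < e -> exists M, 0 < M /\
       forall r, M < r -> exists I, RI (cut rho r g) I /\ Rabs (I - G rho) < e) /\
    (forall e, 0 < e -> exists d, 0 < d /\ forall rho, 0 < rho < d -> Rabs (G rho - V) < e).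

Lemma box_translate c f r I : is_box_int f (cube_lo r) (cube_hi r) I ->
  is_box_int (fun p => f (psub p c)) (psub c (mkpt r r r)) (padd c (mkpt r r r)) I.
Proof.
  intros H e He. destruct (H e He) as [n0 Hn0]. exists n0. intros n Hn Hn' tag Ht.
  specialize (Hn0 n Hn Hn' (fun i j k => psub (tag i j k) c)).
  assert (E : (px (padd c (mkpt r r r)) - px (psub c (mkpt r r r))) * (py (padd c (mkpt r r r)) - py (psub c (mkpt r r r))) *
    (pz (padd c (mkpt r r r)) - pz (psub c (mkpt r r r))) =
    (px (cube_hi r) - px (cube_lo r)) * (py (cube_hi r) - py (cube_lo r)) * (pz (cube_hi r) - pz (cube_lo r))).
  { unfold padd, psub, cube_lo, cube_hi, mkpt, px, py, pz; simpl. ring. }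
  rewrite E. apply Hn0. intros i j k Hi Hj Hk. specialize (Ht i j k Hi Hj Hk).
  unfold in_cbox, cell_lo, padd, psub, cube_lo, cube_hi, mkpt, px, py, pz in *; cbn [fst snd] in *.
  assert (D : forall x, x + r - (x - r) = r - - r) by (intros; ring). rewrite !D in Ht. lra.
Qed.

(** The three nested [epsilon] choices are resolved from the inside out: at each level a witness
    exists, so the chosen value satisfies its specification, and uniqueness identifies it with the
    witness. *)
Lemma Imp_improper c g f V : (forall p, g (padd c p) = f p) -> Imp f V -> improper_int c g = V.
Proof.
  intros Hgf [G [H1 H2]].
  set (B := fun rho Rr => box_int (fun p => if Rlt_dec rho (pnorm (psub p c)) then g p else 0)
              (psub c (mkpt Rr Rr Rr)) (padd c (mkpt Rr Rr Rr))).
  assert (HB : forall rho r I, 0 < rho -> 0 < r -> RI (cut rho r f) I -> B rho r = I).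
  { intros rho r I Hrho Hr HI.
    assert (K : is_box_int (fun p => if Rlt_dec rho (pnorm (psub p c)) then g p else 0)
              (psub c (mkpt r r r)) (padd c (mkpt r r r)) I).
    { assert (Hsupp : supp r (cut rho r f)).
      { intros p Hp. unfold cut. rewrite (ind_false (supn p <= r)); [ring|lra]. }
      pose proof (box_translate c _ r I (RI_box _ I r HI Hr Hsupp)) as T.
      intros e He. destruct (T e He) as [n0 Hn0]. exists n0. intros n Hn Hn' tag Ht.
      specialize (Hn0 n Hn Hn' tag Ht).
      rewrite (sumR_ext n _ (fun i => sumR n (fun j => sumR n (fun k => cut rho r f (psub (tag i j k) c))))); auto.
      intros i Hi. apply sumR_ext; intros j Hj. apply sumR_ext; intros k Hk.
      specialize (Ht i j k Hi Hj Hk).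
      (* Tags lie in the cube of integration, where the factor [ind (supn p <= r)] of [cut] equals
         1. *)
      assert (Hin : supn (psub (tag i j k) c) <= r).
      { assert (Hm : forall x m, (m < n)%nat -> x - r <= x - r + INR m * (x + r - (x - r)) / INR n /\
           x - r + INR (S m) * (x + r - (x - r)) / INR n <= x + r).
        { intros x m Hm. assert (Hn1 : 0 < INR n) by (apply lt_0_INR; lia).
          assert (INR (S m) <= INR n) by (apply le_INR; lia). pose proof (pos_INR m).
          replace (x + r - (x - r)) with (2 * r) by ring. split.
          - assert (0 <= INR m * (2 * r) / INR n) by (apply Rdiv_le_0_compat; auto; nra). lra.
          - assert (INR (S m) * (2 * r) / INR n <= 2 * r); [|lra]. apply Rle_div_l; auto. nra. }
        destruct Ht as [T1 [T2 T3]].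
        unfold cell_lo, padd, psub, mkpt, px, py, pz in *; cbn [fst snd] in *.
        pose proof (Hm (fst (fst c)) i Hi). pose proof (Hm (snd (fst c)) j Hj). pose proof (Hm (snd c) k Hk).
        apply supn_le. unfold px, py, pz; cbn [fst snd]. split; [|split]; apply Rabs_le; lra. }
      unfold cut. rewrite (ind_true _ Hin). rewrite <- Hgf.
      replace (padd c (psub (tag i j k) c)) with (tag i j k)
        by (apply pt_eq; unfold padd, psub, mkpt, px, py, pz; simpl; ring).
      destruct (Rlt_dec rho (pnorm (psub (tag i j k) c))); [rewrite ind_true|rewrite ind_false]; auto; ring. }
    assert (K' : is_box_int (fun p => if Rlt_dec rho (pnorm (psub p c)) then g p else 0)
              (psub c (mkpt r r r)) (padd c (mkpt r r r)) (B rho r)).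
    { unfold B, box_int. apply epsilon_spec. exists I. exact K. }
    eapply box_unique; [|exact K'|exact K].
    unfold nondeg, padd, psub, mkpt, px, py, pz; simpl; lra. }
  assert (HG : forall rho, 0 < rho -> lim_pinf (B rho) = G rho).
  { intros rho Hrho.
    assert (L : is_lim_pinf (B rho) (G rho)).
    { intros e He. destruct (H1 rho Hrho e He) as [M [HM K]]. exists M. intros r Hr.
      destruct (K r Hr) as [I [HI HI']]. rewrite (HB rho r I); auto. lra. }
    assert (L' : is_lim_pinf (B rho) (lim_pinf (B rho))).
    { unfold lim_pinf. apply epsilon_spec. exists (G rho). exact L. }
    apply cond_eq. intros e He.
    destruct (L (e / 2) ltac:(lra)) as [M HM]. destruct (L' (e / 2) ltac:(lra)) as [M' HM'].
    pose proof (Rmax_l M M'). pose proof (Rmax_r M M').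
    specialize (HM (Rmax M M' + 1) ltac:(lra)). specialize (HM' (Rmax M M' + 1) ltac:(lra)).
    apply Rabs_def2 in HM. apply Rabs_def2 in HM'. apply Rabs_def1; lra. }
  assert (L : is_lim_0p (fun rho => lim_pinf (B rho)) V).
  { intros e He. destruct (H2 e He) as [d [Hd K]]. exists d. split; auto.
    intros rho Hrho. rewrite HG by lra. auto. }
  change (lim_0p (fun rho => lim_pinf (B rho)) = V).
  assert (L' : is_lim_0p (fun rho => lim_pinf (B rho)) (lim_0p (fun rho => lim_pinf (B rho)))).
  { apply (epsilon_spec (inhabits 0) (is_lim_0p (fun rho => lim_pinf (B rho)))). exists V. exact L. }
  apply cond_eq. intros e He.
  destruct (L (e / 2) ltac:(lra)) as [d [D1 D2]]. destruct (L' (e / 2) ltac:(lra)) as [d' [D1' D2']].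
  pose proof (Rmin_l d d'). pose proof (Rmin_r d d'). assert (0 < Rmin d d') by (apply Rmin_pos; auto).
  specialize (D2 (Rmin d d' / 2) ltac:(lra)). specialize (D2' (Rmin d d' / 2) ltac:(lra)).
  apply Rabs_def2 in D2. apply Rabs_def2 in D2'. apply Rabs_def1; lra.
Qed.

Lemma Imp_le l f g V W : Imp f V -> Imp g W -> (forall p, off l p -> f p <= g p) -> V <= W.
Proof.
  intros [F [F1 F2]] [G [G1 G2]] H. apply le_epsilon. intros e He.
  destruct (F2 (e / 4) ltac:(lra)) as [d [D1 D2]]. destruct (G2 (e / 4) ltac:(lra)) as [d' [D1' D2']].
  pose proof (Rmin_l d d'). pose proof (Rmin_r d d'). assert (0 < Rmin d d') by (apply Rmin_pos; auto).
  set (rho := Rmin d d' / 2). assert (Hrho : 0 < rho) by (unfold rho; lra).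
  specialize (D2 rho ltac:(unfold rho; lra)). specialize (D2' rho ltac:(unfold rho; lra)).
  destruct (F1 rho Hrho (e / 4) ltac:(lra)) as [M [M1 M2]]. destruct (G1 rho Hrho (e / 4) ltac:(lra)) as [M' [M1' M2']].
  pose proof (Rmax_l M M'). pose proof (Rmax_r M M').
  destruct (M2 (Rmax M M' + 1) ltac:(lra)) as [I [I1 I2]]. destruct (M2' (Rmax M M' + 1) ltac:(lra)) as [J [J1 J2]].
  assert (I <= J).
  { eapply (RI_le l); eauto. intros p Hp. unfold cut. apply Rmult_le_compat_l; auto.
    apply Rmult_le_pos; apply ind_bound. }
  apply Rabs_def2 in D2. apply Rabs_def2 in D2'. apply Rabs_def2 in I2. apply Rabs_def2 in J2. lra.
Qed.

Lemma Imp_unique f V W : Imp f V -> Imp f W -> V = W.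
Proof. intros. apply Rle_antisym; eapply (Imp_le nil); eauto; intros; lra. Qed.

Lemma Imp_plus f g V W : Imp f V -> Imp g W -> Imp (fun p => f p + g p) (V + W).
Proof.
  intros [F [F1 F2]] [G [G1 G2]]. exists (fun rho => F rho + G rho). split.
  - intros rho Hrho e He.
    destruct (F1 rho Hrho (e / 2) ltac:(lra)) as [M [M1 M2]]. destruct (G1 rho Hrho (e / 2) ltac:(lra)) as [M' [M1' M2']].
    pose proof (Rmax_l M M'). pose proof (Rmax_r M M'). exists (Rmax M M'). split; [lra|]. intros r Hr.
    destruct (M2 r ltac:(lra)) as [I [I1 I2]]. destruct (M2' r ltac:(lra)) as [J [J1 J2]].
    exists (I + J). split.
    + eapply RI_ext; [|apply (RI_plus _ _ _ _ I1 J1)]. intros p. unfold cut. ring.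
    + apply Rabs_def2 in I2. apply Rabs_def2 in J2. apply Rabs_def1; lra.
  - intros e He.
    destruct (F2 (e / 2) ltac:(lra)) as [d [D1 D2]]. destruct (G2 (e / 2) ltac:(lra)) as [d' [D1' D2']].
    pose proof (Rmin_l d d'). pose proof (Rmin_r d d'). exists (Rmin d d'). split; [apply Rmin_pos; auto|].
    intros rho Hrho. specialize (D2 rho ltac:(lra)). specialize (D2' rho ltac:(lra)).
    apply Rabs_def2 in D2. apply Rabs_def2 in D2'. apply Rabs_def1; lra.
Qed.

Lemma Imp_scal c f V : Imp f V -> Imp (fun p => c * f p) (c * V).
Proof.
  intros [F [F1 F2]]. exists (fun rho => c * F rho).
  pose proof (Rabs_pos c).
  assert (D : forall e x y, 0 < e -> Rabs (x - y) < e / (Rabs c + 1) -> Rabs (c * x - c * y) < e).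
  { intros e x y He Hxy. rewrite <- Rmult_minus_distr_l, Rabs_mult. apply Rlt_div_r in Hxy; [|lra].
    pose proof (Rabs_pos (x - y)). nra. }
  split.
  - intros rho Hrho e He. destruct (F1 rho Hrho (e / (Rabs c + 1))) as [M [M1 M2]]; [apply Rdiv_lt_0_compat; lra|].
    exists M. split; auto. intros r Hr. destruct (M2 r Hr) as [I [I1 I2]]. exists (c * I). split; auto.
    eapply RI_ext; [|apply (RI_scal c _ _ I1)]. intros p. unfold cut. ring.
  - intros e He. destruct (F2 (e / (Rabs c + 1))) as [d [D1 D2]]; [apply Rdiv_lt_0_compat; lra|].
    exists d. split; auto.
Qed.

Lemma Imp_zero : Imp (fun _ => 0) 0.
Proof.
  exists (fun _ => 0). split.
  - intros rho _ e He. exists 1. split; [lra|]. intros r _. exists 0. split.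
    + eapply RI_ext; [|apply RI_zero]. intros p. unfold cut. ring.
    + rewrite Rminus_0_r, Rabs_R0. auto.
  - intros e He. exists 1. split; [lra|]. intros. rewrite Rminus_0_r, Rabs_R0. auto.
Qed.

Lemma Imp_sumR n (f : nat -> pt -> R) (V : nat -> R) : (forall i, (i < n)%nat -> Imp (f i) (V i)) ->
  Imp (fun p => sumR n (fun i => f i p)) (sumR n V).
Proof.
  intros H. induction n as [|n IH]; simpl; [apply Imp_zero|]. apply Imp_plus; auto.
Qed.

Lemma Imp_sum3 n (f : nat -> nat -> nat -> pt -> R) (V : nat -> nat -> nat -> R) :
  (forall i j k, (i < n)%nat -> (j < n)%nat -> (k < n)%nat -> Imp (f i j k) (V i j k)) ->
  Imp (fun p => sum3 n (fun i j k => f i j k p)) (sum3 n V).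
Proof.
  intros H. unfold sum3.
  apply (Imp_sumR n (fun i p => sumR n (fun j => sumR n (fun k => f i j k p)))). intros i Hi.
  apply (Imp_sumR n (fun j p => sumR n (fun k => f i j k p))). intros j Hj.
  apply (Imp_sumR n (fun k p => f i j k p)). auto.
Qed.

Lemma Imp_bound g V B : (forall rho r I, 0 < rho -> 0 < r -> RI (cut rho r g) I -> Rabs I <= B) -> Imp g V -> Rabs V <= B.
Proof.
  intros H [G [G1 G2]]. apply le_epsilon. intros e He.
  destruct (G2 (e / 2) ltac:(lra)) as [d [D1 D2]]. specialize (D2 (d / 2) ltac:(lra)).
  destruct (G1 (d / 2) ltac:(lra) (e / 2) ltac:(lra)) as [M [M1 M2]].
  destruct (M2 (M + 1) ltac:(lra)) as [I [I1 I2]].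
  specialize (H (d / 2) (M + 1) I ltac:(lra) ltac:(lra) I1).
  apply Rabs_def2 in D2. apply Rabs_def2 in I2. apply Rabs_le_between in H. apply Rabs_le. lra.
Qed.

(** The hypothesis compares truncated integrals rather than integrands: in [frac_transfer] the two
    functions agree only after summation over the reflections. *)
Lemma Imp_transfer f g V : locint g ->
  (forall rho r I J, 0 < rho -> 0 < r -> RI (cut rho r f) I -> RI (cut rho r g) J -> I = J) ->
  Imp f V -> Imp g V.
Proof.
  intros L H [F [F1 F2]]. exists F. split; auto.
  intros rho Hrho e He. destruct (F1 rho Hrho e He) as [M [M1 M2]]. exists M. split; auto.
  intros r Hr. destruct (M2 r Hr) as [I [I1 I2]].
  destruct (intble_RI _ (L rho r Hrho ltac:(lra))) as [J HJ].
  exists J. split; auto. rewrite <- (H rho r I J); auto. lra.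
Qed.

Lemma Imp_ae l f g V : Imp f V -> locint g -> (forall p, off l p -> f p = g p) -> Imp g V.
Proof.
  intros F G H. apply (Imp_transfer f); auto. intros rho r I J _ _ HI HJ.
  apply (RI_eq_off l _ _ _ _ HI HJ). intros p Hp. unfold cut. rewrite H; auto.
Qed.

Lemma rpow_small_0 b e : 0 < b -> 0 < e -> exists d, 0 < d /\ forall x, 0 < x < d -> rpow x b < e.
Proof.
  intros Hb He. exists (rpow e (/ b)). split; [apply rpow_gt_0; auto|]. intros x Hx.
  rewrite rpow_pos in Hx by lra. rewrite rpow_pos by lra.
  replace e with (Rpower (Rpower e (/ b)) b).
  - apply Rlt_Rpower_l; lra.
  - rewrite Rpower_mult, Rinv_l, Rpower_1; lra.
Qed.

Lemma rpow_small_inf b e : 0 < b -> 0 < e -> exists M, 0 < M /\ forall x, M < x -> rpow x (- b) < e.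
Proof.
  intros Hb He. destruct (rpow_small_0 b e Hb He) as [d [Hd H]]. exists (/ d).
  split; [apply Rinv_0_lt_compat; auto|]. intros x Hx.
  assert (0 < / d) by (apply Rinv_0_lt_compat; auto).
  replace (rpow x (- b)) with (rpow (/ x) b).
  - apply H. split; [apply Rinv_0_lt_compat; lra|]. rewrite <- (Rinv_inv d). apply Rinv_lt_contravar; nra.
  - rewrite !rpow_pos by (try apply Rinv_0_lt_compat; lra). unfold Rpower. f_equal. rewrite ln_Rinv by lra. ring.
Qed.

(** The first bound makes the truncated integrals Cauchy as rho tends to 0 ([D2]), the second as r
    tends to infinity ([D1]). *)
Lemma Imp_exist g a b K1 K2 : locint g -> 0 < b < 3 -> 0 < a -> 0 <= K1 -> 0 <= K2 ->
  (forall p, 0 < pnorm p -> Rabs (g p) <= K1 * rpow (pnorm p) (b - 3)) ->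
  (forall p, 0 < pnorm p -> Rabs (g p) <= K2 * rpow (pnorm p) (- (3 + a))) ->
  exists V, Imp g V.
Proof.
  intros L Hb Ha HK1 HK2 B1 B2.
  destruct (near_bound b Hb) as [C1 [HC1 N]]. destruct (far_bound a Ha) as [C2 [HC2 F]].
  set (I := fun rho r => epsilon (inhabits 0) (RI (cut rho r g))).
  assert (HI : forall rho r, 0 < rho -> 0 < r -> RI (cut rho r g) (I rho r)).
  { intros rho r H1 H2. unfold I. apply epsilon_spec. apply intble_RI, L; auto. }
  assert (D1 : forall rho r s, 0 < rho -> 0 < r <= s -> Rabs (I rho s - I rho r) <= C2 * K2 * rpow r (- a)).
  { intros rho r s Hrho Hrs. replace (I rho s - I rho r) with (I rho s + -1 * I rho r) by ring.
    apply (F nil r K2 (fun p => cut rho s g p + -1 * cut rho r g p)); auto; try lra.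
    - apply RI_plus; [apply HI|apply RI_scal, HI]; lra.
    - intros p _. unfold cut. destruct (Rlt_dec rho (pnorm p)).
      2:{ left. rewrite (ind_false (rho < pnorm p)); auto. ring. }
      rewrite (ind_true (rho < pnorm p)) by auto. destruct (Rle_dec (supn p) r).
      + left. rewrite !ind_true by lra. ring.
      + rewrite (ind_false (supn p <= r)) by auto. destruct (Rle_dec (supn p) s).
        * right. rewrite ind_true by auto. split; [pose proof (supn_le_pnorm p); lra|].
          replace (1 * 1 * g p + -1 * (0 * 1 * g p)) with (g p) by ring. apply B2. lra.
        * left. rewrite ind_false by auto. ring. }
  assert (D2 : forall rho rho' r, 0 < rho <= rho' -> 0 < r -> Rabs (I rho r - I rho' r) <= C1 * K1 * rpow rho' b).
  { intros rho rho' r Hrho Hr. replace (I rho r - I rho' r) with (I rho r + -1 * I rho' r) by ring.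
    apply (N nil rho' K1 rho (fun p => cut rho r g p + -1 * cut rho' r g p)); auto; try lra.
    - apply RI_plus; [apply HI|apply RI_scal, HI]; lra.
    - intros p _. unfold cut. destruct (Rlt_dec rho' (pnorm p)).
      { left. rewrite !(ind_true (_ < pnorm p)) by lra. ring. }
      rewrite (ind_false (rho' < pnorm p)) by auto. destruct (Rlt_dec rho (pnorm p)).
      2:{ left. rewrite (ind_false (rho < pnorm p)) by auto. ring. }
      destruct (Rle_dec (supn p) r).
      + right. rewrite !ind_true by auto. split; [auto|]. split; [pose proof (supn_le_pnorm p); lra|].
        replace (1 * 1 * g p + -1 * (1 * 0 * g p)) with (g p) by ring. apply B1. lra.
      + left. rewrite ind_false by auto. ring. }
  assert (HG : forall rho, 0 < rho -> exists G, forall e, 0 < e -> exists M, 0 < M /\ forall r, M < r -> Rabs (I rho r - G) < e).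
  { intros rho Hrho.
    destruct (proj1 (filterlim_locally_cauchy (F := Rbar_locally p_infty) (I rho))) as [G HG].
    - intros e. destruct (rpow_small_inf a (e / (C2 * K2 + 1)) Ha) as [M [HM K]].
      { apply Rdiv_lt_0_compat; [apply cond_pos|nra]. }
      exists (fun r => M < r). split; [exists M; auto|].
      assert (W : forall r s, M < r -> r <= s -> Rabs (I rho s - I rho r) < e).
      { intros r s Hr Hs. eapply Rle_lt_trans; [apply D1; lra|]. specialize (K r Hr).
        apply Rlt_div_r in K; [|nra]. pose proof (rpow_nonneg r (- a)). nra. }
      intros r s Hr Hs. change (Rabs (I rho s - I rho r) < e).
      destruct (Rle_dec r s); [apply W; auto|]. rewrite Rabs_minus_sym. apply W; auto; lra.
    - exists G. intros e He.
      destruct (proj1 (filterlim_locally (F := Rbar_locally p_infty) (I rho) G) HG (mkposreal e He)) as [M HM].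
      exists (Rmax M 1). pose proof (Rmax_l M 1). pose proof (Rmax_r M 1). split; [lra|]. intros r Hr.
      apply (HM r). lra. }
  set (G := fun rho => epsilon (inhabits 0) (fun G => forall e, 0 < e -> exists M, 0 < M /\ forall r, M < r -> Rabs (I rho r - G) < e)).
  assert (HG' : forall rho, 0 < rho -> forall e, 0 < e -> exists M, 0 < M /\ forall r, M < r -> Rabs (I rho r - G rho) < e).
  { intros rho Hrho. unfold G. apply epsilon_spec, HG; auto. }
  (* The bound [D2] is uniform in r, so it survives the limit r -> infinity. *)
  assert (D3 : forall rho rho', 0 < rho <= rho' -> Rabs (G rho - G rho') <= C1 * K1 * rpow rho' b).
  { intros rho rho' Hrho. apply le_epsilon. intros e He.
    destruct (HG' rho ltac:(lra) (e / 2) ltac:(lra)) as [M [M1 M2]].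
    destruct (HG' rho' ltac:(lra) (e / 2) ltac:(lra)) as [M' [M1' M2']].
    pose proof (Rmax_l M M'). pose proof (Rmax_r M M').
    specialize (M2 (Rmax M M' + 1) ltac:(lra)). specialize (M2' (Rmax M M' + 1) ltac:(lra)).
    pose proof (D2 rho rho' (Rmax M M' + 1) Hrho ltac:(lra)) as D.
    apply Rabs_def2 in M2. apply Rabs_def2 in M2'. apply Rabs_le_between in D. apply Rabs_le. lra. }
  destruct (proj1 (filterlim_locally_cauchy (F := at_right 0) G)) as [V HV].
  - intros e. destruct (rpow_small_0 b (e / (C1 * K1 + 1)) (proj1 Hb)) as [d [Hd K]].
    { apply Rdiv_lt_0_compat; [apply cond_pos|nra]. }
    exists (fun r => 0 < r < d). split.
    { exists (mkposreal d Hd). intros y Hy Hy'. split; auto.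
      unfold ball in Hy; simpl in Hy; unfold AbsRing_ball, abs, minus, plus, opp in Hy; simpl in Hy.
      apply Rabs_def2 in Hy. lra. }
    assert (W : forall r s, 0 < r <= s -> s < d -> Rabs (G r - G s) < e).
    { intros r s Hr Hs. eapply Rle_lt_trans; [apply D3; lra|]. specialize (K s ltac:(lra)).
      apply Rlt_div_r in K; [|nra]. pose proof (rpow_nonneg s b). nra. }
    intros r s Hr Hs. change (Rabs (G s - G r) < e).
    destruct (Rle_dec s r); [apply W; lra|]. rewrite Rabs_minus_sym. apply W; lra.
  - exists V, G. split.
    + intros rho Hrho e He. destruct (HG' rho Hrho e He) as [M [M1 M2]]. exists M. split; auto.
      intros r Hr. exists (I rho r). split; auto. apply HI; lra.
    + intros e He.
      destruct (proj1 (filterlim_locally (F := at_right 0) G V) HV (mkposreal e He)) as [d Hd].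
      exists d. split; [apply cond_pos|]. intros rho Hrho. apply (Hd rho); [|lra].
      unfold ball; simpl; unfold AbsRing_ball, abs, minus, plus, opp; simpl. apply Rabs_def1; lra.
Qed.

Lemma Imp_near b : 0 < b < 3 -> exists C, 0 < C /\ forall h K g V, 0 < h -> 0 <= K -> Imp g V ->
  (forall p, 0 < pnorm p -> Rabs (g p) <= K * rpow (pnorm p) (b - 3)) -> (forall p, h < supn p -> g p = 0) ->
  Rabs V <= C * K * rpow h b.
Proof.
  intros Hb. destruct (near_bound b Hb) as [C [HC N]]. exists C. split; auto.
  intros h K g V Hh HK HV B S. apply (Imp_bound g V); auto. intros rho r I Hrho Hr HI.
  apply (N nil h K rho (cut rho r g)); auto. intros p _. unfold cut. ind_cases; try (left; ring).
  destruct (Rlt_dec h (supn p)); [left; rewrite S; auto; ring|].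
  right. split; [auto|]. split; [lra|]. rewrite !Rmult_1_l. apply B. lra.
Qed.

(** [Imp] is tied to the origin and is not visibly invariant under reflection about another point,
    whereas [RI] is. This passes to [RI] on cells away from the origin. *)
Lemma Imp_RI g r0 s : 0 < r0 -> 0 < s -> locint g -> (forall p, pnorm p <= r0 -> g p = 0) -> supp s g ->
  exists I, RI g I /\ Imp g I.
Proof.
  intros Hr Hs L Z S.
  assert (E : forall rho r, 0 < rho < r0 -> s < r -> forall p, cut rho r g p = g p).
  { intros rho r H1 H2 p. unfold cut. destruct (Rlt_dec s (supn p)); [rewrite S; auto; ring|].
    rewrite (ind_true (supn p <= r)) by lra. destruct (Rlt_dec rho (pnorm p)); [rewrite ind_true by auto; ring|].
    rewrite Z; [ring|lra]. }
  set (G := fun rho => epsilon (inhabits 0) (RI (cut rho (s + 1) g))).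
  assert (HG : forall rho, 0 < rho -> RI (cut rho (s + 1) g) (G rho)).
  { intros rho Hrho. unfold G. apply epsilon_spec, intble_RI, L; lra. }
  assert (HI : RI g (G (r0 / 2))).
  { eapply RI_ext; [|apply HG; lra]. apply E; lra. }
  exists (G (r0 / 2)). split; auto. exists G. split.
  - intros rho Hrho e He. exists s. split; auto. intros r Hsr. exists (G rho).
    rewrite Rminus_diag, Rabs_R0. split; auto.
    eapply RI_ext; [|apply HG; auto]. intros p. unfold cut.
    destruct (Rlt_dec s (supn p)); [rewrite S; auto; ring|]. rewrite !(ind_true (supn p <= _)) by lra. ring.
  - intros e He. exists r0. split; auto. intros rho Hrho.
    rewrite (RI_unique g (G rho) (G (r0 / 2))); auto.
    + rewrite Rminus_diag, Rabs_R0; auto.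
    + eapply RI_ext; [|apply HG; lra]. apply E; lra.
Qed.

(** * Locally integrable functions *)

(** The integrand needs to agree with a bounded uniformly continuous function only outside each ball
    around the origin; for powers this function is obtained by replacing the norm by its maximum
    with rho. *)
Lemma locint_mult g A : Jset A -> (forall p, ~ A p -> g p = 0) ->
  (forall rho, 0 < rho -> exists f, BUC f /\ forall p, rho < pnorm p -> A p -> g p = f p) -> locint g.
Proof.
  intros HA H0 H rho r Hrho Hr. destruct (H rho Hrho) as [f [Hf E]].
  eapply intble_ext; [|apply (intble_mult f _ Hf (Jset_and _ _ (Jset_outside rho Hrho) HA r Hr))].
  intros p. unfold cut. ind_cases; try tauto; try ring.
  - rewrite E by tauto. ring.
  - rewrite H0 by tauto. ring.
Qed.

Lemma pow_BUC rho e : 0 < rho -> e <= 0 -> BUC (fun p => rpow (Rmax (pnorm p) rho) e).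
Proof.
  intros Hr He. apply (BUC_of_lip _ (2 * (- e * rpow rho (e - 1)) + 1)).
  - exists (rpow rho e). intros p. rewrite Rabs_right by apply Rle_ge, rpow_nonneg.
    apply rpow_le_neg; auto. split; auto. apply Rmax_r.
  - pose proof (rpow_nonneg rho (e - 1)). nra.
  - intros p q. eapply Rle_trans; [apply (rpow_lip e rho); auto; apply Rmax_r|].
    assert (Rabs (Rmax (pnorm p) rho - Rmax (pnorm q) rho) <= Rabs (pnorm p - pnorm q)).
    { unfold Rmax. destruct (Rle_dec (pnorm p) rho), (Rle_dec (pnorm q) rho);
      unfold Rabs; repeat match goal with |- context [Rcase_abs ?x] => destruct (Rcase_abs x) end; lra. }
    pose proof (pnorm_lip p q). pose proof (pnorm_le_supn (psub p q)). pose proof (supn_nonneg (psub p q)).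
    assert (0 <= - e * rpow rho (e - 1)) by (pose proof (rpow_nonneg rho (e - 1)); nra). nra.
Qed.

Lemma locint_pow A f e : Jset A -> BUC f -> e <= 0 ->
  locint (fun p => ind (A p) * (f p * rpow (pnorm p) e)).
Proof.
  intros HA Hf He. apply (locint_mult _ A); auto.
  - intros p Hp. rewrite ind_false; auto. ring.
  - intros rho Hrho. exists (fun p => f p * rpow (Rmax (pnorm p) rho) e). split.
    + apply BUC_mult; auto. apply pow_BUC; auto.
    + intros p Hp HAp. rewrite ind_true by auto. rewrite Rmax_left by lra. ring.
Qed.

(** * Regularity of [u] *)

Lemma ucont_of_modulus f A t : 0 < t ->
  (forall p q, pnorm (psub p q) < 1 -> Rabs (f p - f q) <= A * rpow (pnorm (psub p q)) t) -> ucont f.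
Proof.
  intros Ht H e He. pose proof (Rabs_pos A) as HA.
  destruct (rpow_small_0 t (e / (Rabs A + 1)) Ht) as [d [Hd K]]; [apply Rdiv_lt_0_compat; lra|].
  exists (Rmin d 1 / 2). pose proof (Rmin_l d 1). pose proof (Rmin_r d 1). assert (0 < Rmin d 1) by (apply Rmin_pos; lra).
  split; [lra|]. intros p q Hpq. pose proof (pnorm_le_supn (psub p q)).
  eapply Rle_lt_trans; [apply H; lra|].
  destruct (Rle_lt_or_eq_dec _ _ (pnorm_nonneg (psub p q))) as [Hp|Hp].
  - specialize (K (pnorm (psub p q)) ltac:(lra)). apply Rlt_div_r in K; [|lra].
    pose proof (rpow_nonneg (pnorm (psub p q)) t). pose proof (Rle_abs A). nra.
  - rewrite <- Hp. unfold rpow. destruct (Rlt_dec 0 0); lra.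
Qed.

(** The form in which the smoothness of [u] is used, with s = alpha + eps. The last clause compares
    the even parts of [u] about x at two offsets: if [u] has a Hölder gradient, the even part has
    gradient of order |b|^(s-1) at offset b; for s <= 1 the first term on the right suffices. *)
Definition regular (u : pt -> R) (s K : R) : Prop :=
  0 <= K /\ BUC u /\
  (forall p d, Rabs (u (padd p d) + u (psub p d) - 2 * u p) <= K * rpow (pnorm d) s) /\
  (forall x a b, 0 < pnorm b ->
     Rabs (u (padd x a) + u (psub x a) - u (padd x b) - u (psub x b)) <=
     K * (rpow (pnorm (psub a b)) s + pnorm (psub a b) * rpow (pnorm b) (s - 1))).

Ltac pt_ring := apply pt_eq; unfold padd, psub, pscal, unit_vec, mkpt, px, py, pz; simpl; ring.

Section Regularity.
Context (ax bx ay by_ az bz : R).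
Context (Hx : ax < bx) (Hy : ay < by_) (Hz : az < bz).
(** A reference point outside the open box, where [u] vanishes, and within distance [D] of every
    point of the box. It anchors the bounds on [u] and on its partial derivatives. *)
Let corner := mkpt ax ay az.
Let D := 2 * ((bx - ax) + (by_ - ay) + (bz - az)).

Lemma corner_out : ~ in_box_open ax bx ay by_ az bz corner.
Proof. unfold in_box_open, corner, mkpt, px; simpl. lra. Qed.

Lemma box_diam p : in_box_open ax bx ay by_ az bz p -> pnorm (psub p corner) <= D.
Proof.
  intros [H1 [H2 H3]]. eapply Rle_trans; [apply pnorm_le_supn|]. unfold D. apply Rmult_le_compat_l; [lra|].
  apply supn_le. unfold corner, psub, mkpt, px, py, pz in *; simpl in *.
  split; [|split]; apply Rabs_le; lra.
Qed.

Lemma regular_holder u s : (forall p, ~ in_box_open ax bx ay by_ az bz p -> u p = 0) ->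
  (* The Hölder constant is not assumed nonnegative, hence the absolute value below. *)
  0 < s -> unif_holder u s -> exists K, regular u s K.
Proof.
  intros U0 Hs [M0 H0]. set (M := Rabs M0).
  assert (HM : 0 <= M) by apply Rabs_pos.
  assert (H : forall x y, Rabs (u x - u y) <= M * rpow (pnorm (psub x y)) s).
  { intros x y. eapply Rle_trans; [apply H0|]. apply Rmult_le_compat_r; [apply rpow_nonneg|apply Rle_abs]. }
  clear H0. exists (2 * M). split; [lra|]. split; [split|split].
  - apply (ucont_of_modulus u M s); auto.
  - exists (M * rpow D s). intros p.
    assert (0 <= M * rpow D s) by (apply Rmult_le_pos; auto using rpow_nonneg).
    destruct (classic (in_box_open ax bx ay by_ az bz p)) as [Hp|Hp].
    + specialize (H p corner). rewrite (U0 corner corner_out), Rminus_0_r in H.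
      eapply Rle_trans; [exact H|]. apply Rmult_le_compat_l; auto.
      apply rpow_le_pos; [|lra]. split; [apply pnorm_nonneg|apply box_diam; auto].
    + rewrite (U0 p Hp), Rabs_R0. auto.
  - intros p d. pose proof (H (padd p d) p) as A. pose proof (H (psub p d) p) as B.
    replace (psub (padd p d) p) with d in A by pt_ring.
    replace (psub (psub p d) p) with (pscal (-1) d) in B by pt_ring. rewrite pnorm_opp in B.
    replace (u (padd p d) + u (psub p d) - 2 * u p) with ((u (padd p d) - u p) + (u (psub p d) - u p)) by ring.
    eapply Rle_trans; [apply Rabs_triang|]. lra.
  - intros x a b Hb. pose proof (H (padd x a) (padd x b)) as A. pose proof (H (psub x a) (psub x b)) as B.
    replace (psub (padd x a) (padd x b)) with (psub a b) in A by pt_ring.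
    replace (psub (psub x a) (psub x b)) with (pscal (-1) (psub a b)) in B by pt_ring. rewrite pnorm_opp in B.
    replace (u (padd x a) + u (psub x a) - u (padd x b) - u (psub x b))
      with ((u (padd x a) - u (padd x b)) + (u (psub x a) - u (psub x b))) by ring.
    eapply Rle_trans; [apply Rabs_triang|].
    assert (0 <= pnorm (psub a b) * rpow (pnorm b) (s - 1))
      by (apply Rmult_le_pos; [apply pnorm_nonneg|apply rpow_nonneg]).
    nra.
Qed.

(** [has_partial] is a derivative at parameter 0; moving the base point along the line gives the
    derivative at every parameter, which the mean value theorem requires. *)
Lemma partial_MVT u g d p t : (forall x, has_partial u d x (g x)) ->
  exists c, Rabs c <= Rabs t /\
    u (padd p (pscal t (unit_vec d))) - u p = g (padd p (pscal c (unit_vec d))) * t.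
Proof.
  intros H. set (f := fun t => u (padd p (pscal t (unit_vec d)))).
  assert (Df : forall r, derivable_pt_lim f r (g (padd p (pscal r (unit_vec d))))).
  { intros r e He. destruct (H (padd p (pscal r (unit_vec d))) e He) as [dl Hd].
    exists dl. intros k Hk Hk'. specialize (Hd k Hk Hk').
    assert (E : forall a, padd (padd p (pscal r (unit_vec d))) (pscal a (unit_vec d)) = padd p (pscal (r + a) (unit_vec d)))
      by (intros; pt_ring).
    rewrite !E in Hd. rewrite Rplus_0_l, Rplus_0_r in Hd. exact Hd. }
  assert (F0 : f 0 = u p).
  { unfold f. f_equal. pt_ring. }
  destruct (Rtotal_order 0 t) as [Ht|[<-|Ht]].
  - destruct (MVT_cor2 f (fun r => g (padd p (pscal r (unit_vec d)))) 0 t Ht) as [c [E Hc]]; [auto|].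
    exists c. split; [rewrite !Rabs_right; lra|]. rewrite F0, Rminus_0_r in E. exact E.
  - exists 0. split; [lra|]. change (f 0 - u p = g (padd p (pscal 0 (unit_vec d))) * 0). rewrite F0. ring.
  - destruct (MVT_cor2 f (fun r => g (padd p (pscal r (unit_vec d)))) t 0 Ht) as [c [E Hc]]; [auto|].
    exists c. split; [rewrite !Rabs_left; lra|]. rewrite F0 in E. change (f t - u p = g (padd p (pscal c (unit_vec d))) * t). lra.
Qed.

Lemma pnorm_mono a b : Rabs (px a) <= Rabs (px b) -> Rabs (py a) <= Rabs (py b) -> Rabs (pz a) <= Rabs (pz b) ->
  pnorm a <= pnorm b.
Proof.
  intros H1 H2 H3. unfold pnorm. apply sqrt_le_1_alt.
  apply Rsqr_le_abs_1 in H1, H2, H3. rewrite !Rsqr_pow2 in *. lra.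
Qed.

Lemma rpow_S b s : 0 <= b -> rpow b (s + 1) = b * rpow b s.
Proof.
  intros Hb. rewrite rpow_plus. unfold rpow. destruct (Rlt_dec 0 b); [rewrite Rpower_1; auto; ring|].
  ring.
Qed.

(** The increment is telescoped along three coordinate segments, and on each the mean value theorem
    evaluates one partial derivative at a point within |d| of p. Total differentiability is thus
    never invoked; the factor 3 counts the segments. *)
Lemma taylor1 u g0 g1 g2 s M p d : 0 <= M -> 0 < s ->
  (forall x, has_partial u 0 x (g0 x)) -> (forall x, has_partial u 1 x (g1 x)) -> (forall x, has_partial u 2 x (g2 x)) ->
  (forall x y, Rabs (g0 x - g0 y) <= M * rpow (pnorm (psub x y)) s) ->
  (forall x y, Rabs (g1 x - g1 y) <= M * rpow (pnorm (psub x y)) s) ->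
  (forall x y, Rabs (g2 x - g2 y) <= M * rpow (pnorm (psub x y)) s) ->
  Rabs (u (padd p d) - u p - (g0 p * px d + g1 p * py d + g2 p * pz d)) <= 3 * M * rpow (pnorm d) (s + 1).
Proof.
  intros HM Hs D0 D1 D2 L0 L1 L2. rewrite rpow_S by apply pnorm_nonneg.
  set (p1 := padd p (pscal (px d) (unit_vec 0))). set (p2 := padd p1 (pscal (py d) (unit_vec 1))).
  destruct (partial_MVT u g0 0 p (px d) D0) as [c0 [C0 E0]].
  destruct (partial_MVT u g1 1 p1 (py d) D1) as [c1 [C1 E1]].
  destruct (partial_MVT u g2 2 p2 (pz d) D2) as [c2 [C2 E2]].
  assert (E : padd p2 (pscal (pz d) (unit_vec 2)) = padd p d) by (unfold p2, p1; pt_ring).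
  rewrite E in E2. fold p2 in E1. fold p1 in E0.
  set (N := rpow (pnorm d) s).
  assert (Hstep : forall g q a i, (forall x y, Rabs (g x - g y) <= M * rpow (pnorm (psub x y)) s) ->
    pnorm (psub q p) <= pnorm d -> Rabs a <= pnorm d -> i = (g q - g p) * a -> Rabs i <= M * N * pnorm d).
  { intros g q a i L Hq Ha ->. rewrite Rabs_mult. apply Rmult_le_compat; auto using Rabs_pos.
    eapply Rle_trans; [apply L|]. apply Rmult_le_compat_l; auto. apply rpow_le_pos; [|lra].
    split; [apply pnorm_nonneg|auto]. }
  replace (u (padd p d) - u p - (g0 p * px d + g1 p * py d + g2 p * pz d)) with
    ((u p1 - u p - g0 p * px d) + (u p2 - u p1 - g1 p * py d) + (u (padd p d) - u p2 - g2 p * pz d)) by ring.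
  assert (Z : Rabs 0 <= Rabs (py d) /\ Rabs 0 <= Rabs (pz d)) by (rewrite Rabs_R0; split; apply Rabs_pos).
  assert (T0 : Rabs (u p1 - u p - g0 p * px d) <= M * N * pnorm d).
  { eapply (Hstep g0 _ (px d)); [auto| |apply (crd_le_pnorm 0)|rewrite E0; ring].
    apply pnorm_mono; unfold padd, psub, pscal, unit_vec, mkpt, px, py, pz in *; simpl;
      match goal with |- Rabs ?x <= _ => ring_simplify x end; tauto || (eapply Rle_trans; [|apply C0]; right; f_equal; ring). }
  assert (T1 : Rabs (u p2 - u p1 - g1 p * py d) <= M * N * pnorm d).
  { eapply (Hstep g1 _ (py d)); [auto| |apply (crd_le_pnorm 1)|rewrite E1; ring].
    apply pnorm_mono; unfold p1, padd, psub, pscal, unit_vec, mkpt, px, py, pz in *; simpl;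
      match goal with |- Rabs ?x <= _ => ring_simplify x end; tauto || lra || (eapply Rle_trans; [|apply C1]; right; f_equal; ring). }
  assert (T2 : Rabs (u (padd p d) - u p2 - g2 p * pz d) <= M * N * pnorm d).
  { eapply (Hstep g2 _ (pz d)); [auto| |apply (crd_le_pnorm 2)|rewrite E2; ring].
    apply pnorm_mono; unfold p2, p1, padd, psub, pscal, unit_vec, mkpt, px, py, pz in *; simpl;
      match goal with |- Rabs ?x <= _ => ring_simplify x end; tauto || lra || (eapply Rle_trans; [|apply C2]; right; f_equal; ring). }
  eapply Rle_trans; [apply Rabs_triang|]. pose proof (Rabs_triang (u p1 - u p - g0 p * px d) (u p2 - u p1 - g1 p * py d)).
  lra.
Qed.

Lemma dot_bound a b c d G : Rabs a <= G -> Rabs b <= G -> Rabs c <= G ->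
  Rabs (a * px d + b * py d + c * pz d) <= 3 * G * pnorm d.
Proof.
  intros A B C. eapply Rle_trans; [apply Rabs_triang|].
  pose proof (Rabs_triang (a * px d) (b * py d)). rewrite !Rabs_mult in *.
  assert (Rabs a * Rabs (px d) <= G * pnorm d) by (apply Rmult_le_compat; auto using Rabs_pos; apply (crd_le_pnorm 0)).
  assert (Rabs b * Rabs (py d) <= G * pnorm d) by (apply Rmult_le_compat; auto using Rabs_pos; apply (crd_le_pnorm 1)).
  assert (Rabs c * Rabs (pz d) <= G * pnorm d) by (apply Rmult_le_compat; auto using Rabs_pos; apply (crd_le_pnorm 2)).
  lra.
Qed.

Lemma regular_C1 u s : (forall p, ~ in_box_open ax bx ay by_ az bz p -> u p = 0) ->
  0 < s <= 1 -> Ck_s 1 s u -> exists K, regular u (s + 1) K.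
Proof.
  intros U0 Hs [_ HC].
  destruct (HC 0%nat ltac:(lia)) as [g0 [D0 [_ [M0 L0]]]].
  destruct (HC 1%nat ltac:(lia)) as [g1 [D1 [_ [M1 L1]]]].
  destruct (HC 2%nat ltac:(lia)) as [g2 [D2 [_ [M2 L2]]]]. clear HC.
  set (M := Rabs M0 + Rabs M1 + Rabs M2).
  pose proof (Rabs_pos M0). pose proof (Rabs_pos M1). pose proof (Rabs_pos M2).
  pose proof (Rle_abs M0). pose proof (Rle_abs M1). pose proof (Rle_abs M2).
  assert (HM : 0 <= M) by (unfold M; lra).
  assert (L : forall g M', (forall x y, Rabs (g x - g y) <= M' * rpow (pnorm (psub x y)) s) -> M' <= M ->
     forall x y, Rabs (g x - g y) <= M * rpow (pnorm (psub x y)) s).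
  { intros g M' Hg HM' x y. eapply Rle_trans; [apply Hg|]. apply Rmult_le_compat_r; auto using rpow_nonneg. }
  assert (L0' := L g0 M0 L0 ltac:(unfold M; lra)). assert (L1' := L g1 M1 L1 ltac:(unfold M; lra)).
  assert (L2' := L g2 M2 L2 ltac:(unfold M; lra)). clear L L0 L1 L2.
  assert (T : forall p d, Rabs (u (padd p d) - u p - (g0 p * px d + g1 p * py d + g2 p * pz d)) <= 3 * M * rpow (pnorm d) (s + 1)).
  { intros. apply taylor1; auto; lra. }
  assert (HD : 0 <= D) by (unfold D; lra).
  (* A bound for the partial derivatives inside the box: values at the corner plus the Hölder
     oscillation over distance [D]. *)
  set (G := Rabs (g0 corner) + Rabs (g1 corner) + Rabs (g2 corner) + M * rpow D s).
  assert (HG0 : 0 <= M * rpow D s) by (apply Rmult_le_pos; auto using rpow_nonneg).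
  pose proof (Rabs_pos (g0 corner)). pose proof (Rabs_pos (g1 corner)). pose proof (Rabs_pos (g2 corner)).
  assert (HG : forall g p, (forall x y, Rabs (g x - g y) <= M * rpow (pnorm (psub x y)) s) -> Rabs (g corner) <= G - M * rpow D s ->
     in_box_open ax bx ay by_ az bz p -> Rabs (g p) <= G).
  { intros g p Lg Hc Hp. replace (g p) with ((g p - g corner) + g corner) by ring.
    eapply Rle_trans; [apply Rabs_triang|]. specialize (Lg p corner).
    assert (M * rpow (pnorm (psub p corner)) s <= M * rpow D s); [|lra].
    apply Rmult_le_compat_l; auto. apply rpow_le_pos; [|lra]. split; [apply pnorm_nonneg|apply box_diam; auto]. }
  (* 6 = 3 + 3 from two Taylor remainders; the gradient difference in the last clause also gives 3 *
     2, because 2^s <= 2 for s <= 1. *)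
  exists (6 * M). split; [lra|]. split; [split|split].
  (* The gradient bound [G] is available at points of the box only, so the expansion is made at
     whichever point lies inside; if neither does, both values are 0. *)
  - assert (In : forall p q, in_box_open ax bx ay by_ az bz p -> pnorm (psub q p) < 1 ->
      Rabs (u q - u p) <= (3 * G + 3 * M) * rpow (pnorm (psub q p)) 1).
    { intros p q Hp Hq. specialize (T p (psub q p)). replace (padd p (psub q p)) with q in T by pt_ring.
      assert (Dt := dot_bound (g0 p) (g1 p) (g2 p) (psub q p) G (HG g0 p L0' ltac:(unfold G; lra) Hp)
        (HG g1 p L1' ltac:(unfold G; lra) Hp) (HG g2 p L2' ltac:(unfold G; lra) Hp)).
      set (n := pnorm (psub q p)) in *. assert (Hn : 0 <= n) by apply pnorm_nonneg.
      rewrite rpow_S in T by auto.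
      replace (rpow n 1) with n.
      2:{ unfold rpow. destruct (Rlt_dec 0 n); [rewrite Rpower_1; auto|lra]. }
      assert (Hns : rpow n s <= 1).
      { replace 1 with (rpow 1 s); [apply rpow_le_pos; lra|]. rewrite rpow_pos by lra. unfold Rpower. rewrite ln_1, Rmult_0_r. apply exp_0. }
      pose proof (rpow_nonneg n s).
      replace (u q - u p) with ((u q - u p - (g0 p * px (psub q p) + g1 p * py (psub q p) + g2 p * pz (psub q p))) + (g0 p * px (psub q p) + g1 p * py (psub q p) + g2 p * pz (psub q p))) by ring.
      eapply Rle_trans; [apply Rabs_triang|].
      assert (3 * M * (n * rpow n s) <= 3 * M * n); [|lra].
      apply Rmult_le_compat_l; [lra|]. nra. }
    apply (ucont_of_modulus u (3 * G + 3 * M) 1); [lra|]. intros p q Hpq.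
    destruct (classic (in_box_open ax bx ay by_ az bz q)) as [Hq|Hq]; [apply In; auto|].
    destruct (classic (in_box_open ax bx ay by_ az bz p)) as [Hp|Hp].
    + rewrite Rabs_minus_sym, pnorm_sub_sym. apply In; auto. rewrite pnorm_sub_sym; auto.
    + rewrite !U0, Rminus_0_r, Rabs_R0 by auto. apply Rmult_le_pos; auto using rpow_nonneg. unfold G. lra.
  - exists (3 * G * D + 3 * M * rpow D (s + 1)). intros p.
    assert (0 <= 3 * G * D) by (repeat apply Rmult_le_pos; try lra; unfold G; lra).
    assert (0 <= 3 * M * rpow D (s + 1)) by (repeat apply Rmult_le_pos; try lra; apply rpow_nonneg).
    destruct (classic (in_box_open ax bx ay by_ az bz p)) as [Hp|Hp].
    2:{ rewrite U0, Rabs_R0; auto; lra. }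
    specialize (T corner (psub p corner)). replace (padd corner (psub p corner)) with p in T by pt_ring.
    rewrite (U0 corner corner_out), Rminus_0_r in T.
    assert (Dt := dot_bound (g0 corner) (g1 corner) (g2 corner) (psub p corner) G ltac:(unfold G; lra) ltac:(unfold G; lra) ltac:(unfold G; lra)).
    set (v := g0 corner * px (psub p corner) + g1 corner * py (psub p corner) + g2 corner * pz (psub p corner)) in *.
    replace (u p) with ((u p - v) + v) by ring. eapply Rle_trans; [apply Rabs_triang|].
    pose proof (box_diam p Hp).
    assert (3 * G * pnorm (psub p corner) <= 3 * G * D) by (apply Rmult_le_compat_l; auto; unfold G; lra).
    assert (3 * M * rpow (pnorm (psub p corner)) (s + 1) <= 3 * M * rpow D (s + 1)); [|lra].
    apply Rmult_le_compat_l; [lra|]. apply rpow_le_pos; [|lra]. split; [apply pnorm_nonneg|auto].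
  - intros p d. pose proof (T p d) as A. pose proof (T p (pscal (-1) d)) as B.
    rewrite pnorm_opp in B. replace (padd p (pscal (-1) d)) with (psub p d) in B by pt_ring.
    replace (u (padd p d) + u (psub p d) - 2 * u p) with
      ((u (padd p d) - u p - (g0 p * px d + g1 p * py d + g2 p * pz d)) +
       (u (psub p d) - u p - (g0 p * px (pscal (-1) d) + g1 p * py (pscal (-1) d) + g2 p * pz (pscal (-1) d))))
      by (unfold pscal, mkpt, px, py, pz; simpl; ring).
    eapply Rle_trans; [apply Rabs_triang|]. lra.
  (* Expanding at x + b and at x - b with opposite increments leaves the gradient difference over
     distance 2 |b|, of order |b|^s, times |a - b|. *)
  - intros x a b Hb. replace (s + 1 - 1) with s by ring.
    pose proof (T (padd x b) (psub a b)) as A. pose proof (T (psub x b) (pscal (-1) (psub a b))) as B.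
    rewrite pnorm_opp in B. replace (padd (padd x b) (psub a b)) with (padd x a) in A by pt_ring.
    replace (padd (psub x b) (pscal (-1) (psub a b))) with (psub x a) in B by pt_ring.
    assert (Lb : forall g, (forall x y, Rabs (g x - g y) <= M * rpow (pnorm (psub x y)) s) ->
      Rabs (g (padd x b) - g (psub x b)) <= 2 * M * rpow (pnorm b) s).
    { intros g Lg. eapply Rle_trans; [apply Lg|].
      replace (psub (padd x b) (psub x b)) with (pscal 2 b) by pt_ring.
      rewrite pnorm_scal, rpow_mult_distr by lra.
      assert (rpow 2 s <= 2).
      { rewrite <- (rpow_1 2) at 2 by lra. rewrite !rpow_pos by lra. apply Rle_Rpower; lra. }
      pose proof (rpow_nonneg (pnorm b) s). assert (0 <= M * rpow (pnorm b) s) by nra. nra. }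
    assert (Dt := dot_bound _ _ _ (psub a b) _ (Lb g0 L0') (Lb g1 L1') (Lb g2 L2')).
    replace (u (padd x a) + u (psub x a) - u (padd x b) - u (psub x b)) with
      ((u (padd x a) - u (padd x b) - (g0 (padd x b) * px (psub a b) + g1 (padd x b) * py (psub a b) + g2 (padd x b) * pz (psub a b))) +
       (u (psub x a) - u (psub x b) - (g0 (psub x b) * px (pscal (-1) (psub a b)) + g1 (psub x b) * py (pscal (-1) (psub a b)) + g2 (psub x b) * pz (pscal (-1) (psub a b)))) +
       ((g0 (padd x b) - g0 (psub x b)) * px (psub a b) + (g1 (padd x b) - g1 (psub x b)) * py (psub a b) + (g2 (padd x b) - g2 (psub x b)) * pz (psub a b)))
      by (unfold pscal, mkpt, px, py, pz; simpl; ring).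
    eapply Rle_trans; [apply Rabs_triang|]. eapply Rle_trans; [apply Rplus_le_compat_r, Rabs_triang|].
    lra.
Qed.

End Regularity.

(** * The symmetrized difference of [u] *)

Definition flip (m n s : bool) (p : pt) : pt := mkpt (sgn m * px p) (sgn n * py p) (sgn s * pz p).

Definition symdiff (u : pt -> R) (x xi : pt) : R :=
  sum8 (fun m n s => u (padd x (flip m n s xi))) - 8 * u x.

Lemma pnorm_flip m n s p : pnorm (flip m n s p) = pnorm p.
Proof.
  unfold pnorm, flip, mkpt, px, py, pz; simpl fst; simpl snd. f_equal. destruct m, n, s; simpl; ring.
Qed.

Ltac flip_ring := apply pt_eq; unfold flip, padd, psub, pscal, mkpt, px, py, pz; simpl; ring.

Lemma flip_sub m n s a b : psub (flip m n s a) (flip m n s b) = flip m n s (psub a b).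
Proof. flip_ring. Qed.

(** Opposite sign patterns are paired, so that each pair is symmetric about x and [regular] applies
    to it. *)
Lemma sum8_pairs F : sum8 F =
  (F false false false + F true true true) + (F false false true + F true true false) +
  (F false true false + F true false true) + (F false true true + F true false false).
Proof. unfold sum8. ring. Qed.

Lemma flip_neg m n s x p : padd x (flip (negb m) (negb n) (negb s) p) = psub x (flip m n s p).
Proof. destruct m, n, s; flip_ring. Qed.

Lemma Rabs_add4 a b c d e : Rabs a <= e -> Rabs b <= e -> Rabs c <= e -> Rabs d <= e -> Rabs (a + b + c + d) <= 4 * e.
Proof.
  intros A B C D. apply Rabs_le_between in A, B, C, D. apply Rabs_le. lra.
Qed.

Lemma symdiff_bound u s K x xi : regular u s K -> Rabs (symdiff u x xi) <= 4 * K * rpow (pnorm xi) s.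
Proof.
  intros [_ [_ [H _]]]. unfold symdiff. rewrite sum8_pairs.
  pose proof (fun m n k => H x (flip m n k xi)) as P.
  rewrite (flip_neg false false false x xi : padd x (flip true true true xi) = _),
    (flip_neg false false true x xi : padd x (flip true true false xi) = _),
    (flip_neg false true false x xi : padd x (flip true false true xi) = _),
    (flip_neg false true true x xi : padd x (flip true false false xi) = _).
  match goal with |- Rabs ?z <= _ => replace z with
    ((u (padd x (flip false false false xi)) + u (psub x (flip false false false xi)) - 2 * u x) +
     (u (padd x (flip false false true xi)) + u (psub x (flip false false true xi)) - 2 * u x) +
     (u (padd x (flip false true false xi)) + u (psub x (flip false true false xi)) - 2 * u x) +
     (u (padd x (flip false true true xi)) + u (psub x (flip false true true xi)) - 2 * u x)) by ring end.
  rewrite Rmult_assoc. apply Rabs_add4; eapply Rle_trans; try apply P; rewrite pnorm_flip; lra.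
Qed.

Lemma symdiff_diff1 u s K x a b : regular u s K -> 0 < pnorm b ->
  Rabs (symdiff u x a - symdiff u x b) <= 4 * K * (rpow (pnorm (psub a b)) s + pnorm (psub a b) * rpow (pnorm b) (s - 1)).
Proof.
  intros [_ [_ [_ H]]] Hb. unfold symdiff. rewrite !sum8_pairs.
  assert (P : forall m n k, Rabs (u (padd x (flip m n k a)) + u (psub x (flip m n k a)) - u (padd x (flip m n k b)) - u (psub x (flip m n k b)))
    <= K * (rpow (pnorm (psub a b)) s + pnorm (psub a b) * rpow (pnorm b) (s - 1))).
  { intros m n k. pose proof (H x (flip m n k a) (flip m n k b)) as P. rewrite flip_sub, !pnorm_flip in P. auto. }
  rewrite !(flip_neg false false false x _ : padd x (flip true true true _) = _),
    !(flip_neg false false true x _ : padd x (flip true true false _) = _),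
    !(flip_neg false true false x _ : padd x (flip true false true _) = _),
    !(flip_neg false true true x _ : padd x (flip true false false _) = _).
  match goal with |- Rabs ?z <= _ => replace z with
    ((u (padd x (flip false false false a)) + u (psub x (flip false false false a)) - u (padd x (flip false false false b)) - u (psub x (flip false false false b))) +
     (u (padd x (flip false false true a)) + u (psub x (flip false false true a)) - u (padd x (flip false false true b)) - u (psub x (flip false false true b))) +
     (u (padd x (flip false true false a)) + u (psub x (flip false true false a)) - u (padd x (flip false true false b)) - u (psub x (flip false true false b))) +
     (u (padd x (flip false true true a)) + u (psub x (flip false true true a)) - u (padd x (flip false true true b)) - u (psub x (flip false true true b)))) by ring end.
  rewrite Rmult_assoc. apply Rabs_add4; apply P.
Qed.

Lemma sum8_abs F e : (forall m n s, Rabs (F m n s) <= e) -> Rabs (sum8 F) <= 8 * e.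
Proof.
  intros H. rewrite sum8_pairs.
  assert (P : forall a b, Rabs a <= e -> Rabs b <= e -> Rabs (a + b) <= 2 * e).
  { intros a b A B. eapply Rle_trans; [apply Rabs_triang|lra]. }
  replace (8 * e) with (4 * (2 * e)) by ring. apply Rabs_add4; apply P; auto.
Qed.

(** No pairing here: each of the eight terms is itself a second difference, centred at x plus a
    reflection of c. *)
Lemma symdiff_diff2 u s K x c d : regular u s K ->
  Rabs (symdiff u x (padd c d) + symdiff u x (psub c d) - 2 * symdiff u x c) <= 8 * (K * rpow (pnorm d) s).
Proof.
  intros [_ [_ [H _]]].
  assert (E : symdiff u x (padd c d) + symdiff u x (psub c d) - 2 * symdiff u x c =
    sum8 (fun m n k => u (padd (padd x (flip m n k c)) (flip m n k d)) + u (psub (padd x (flip m n k c)) (flip m n k d))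
       - 2 * u (padd x (flip m n k c)))).
  { unfold symdiff.
    assert (E1 : forall m n k, padd x (flip m n k (padd c d)) = padd (padd x (flip m n k c)) (flip m n k d)) by (intros; flip_ring).
    assert (E2 : forall m n k, padd x (flip m n k (psub c d)) = psub (padd x (flip m n k c)) (flip m n k d)) by (intros; flip_ring).
    unfold sum8. rewrite !E1, !E2. ring. }
  rewrite E. apply sum8_abs. intros m n k. rewrite <- (pnorm_flip m n k d). apply H.
Qed.

Lemma flip_diag_affine m n s x p : padd x (flip m n s p) = diag_affine (mkpt (sgn m) (sgn n) (sgn s)) x p.
Proof. apply pt_eq; unfold padd, flip, diag_affine, mkpt, px, py, pz; simpl; ring. Qed.

Lemma symdiff_BUC u x : BUC u -> BUC (symdiff u x).
Proof.
  intros U. unfold symdiff.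
  assert (P : forall m n s, BUC (fun p => u (padd x (flip m n s p)))).
  { intros m n s. pose proof (diag_affine_BUC (mkpt (sgn m) (sgn n) (sgn s)) x u U) as Q.
    rewrite (functional_extensionality (fun p => u (padd x (flip m n s p))) (fun p => u (diag_affine (mkpt (sgn m) (sgn n) (sgn s)) x p)));
      auto. intros p. rewrite flip_diag_affine. reflexivity. }
  unfold sum8, Rminus. repeat apply BUC_plus; auto. apply BUC_const.
Qed.

Lemma symdiff_flip u x m n s p : symdiff u x (flip m n s p) = symdiff u x p.
Proof.
  unfold symdiff, sum8.
  assert (E : forall m' n' s', flip m' n' s' (flip m n s p) = flip (xorb m' m) (xorb n' n) (xorb s' s) p).
  { intros. destruct m, n, s, m', n', s'; flip_ring. }
  rewrite !E. destruct m, n, s; cbn [xorb]; ring.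
Qed.

(** * The quadrature error on one cell *)

Lemma rpow_le_exp t e e' : 0 < t <= 1 -> e <= e' -> rpow t e' <= rpow t e.
Proof.
  intros Ht He. replace e' with (e + (e' - e)) by ring. rewrite rpow_plus.
  assert (rpow t (e' - e) <= 1).
  { replace 1 with (rpow 1 (e' - e)); [apply rpow_le_pos; lra|].
    rewrite rpow_pos by lra. unfold Rpower. rewrite ln_1, Rmult_0_r. apply exp_0. }
  pose proof (rpow_nonneg t e). nra.
Qed.

Lemma rpow_sq x e : 0 < x -> rpow (x ^ 2) e = rpow x (2 * e).
Proof. intros Hx. rewrite rpow_pow by auto. replace (2 * e) with (e + e) by ring. rewrite rpow_plus. ring. Qed.

Lemma rpow_minus_nat r e n : 0 < r -> rpow r (e - INR n) = rpow r e / r ^ n.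
Proof.
  intros Hr. unfold Rminus. rewrite rpow_plus, rpow_inv, rpow_INR by auto. reflexivity.
Qed.

(** On a cell away from the origin all norms agree with r up to a factor 3, and derivatives of
    negative powers are estimated at r / 3. *)
Lemma rpow_third r e n : 0 < r -> rpow (r * / 3) (e - INR n) = rpow (/ 3) (e - INR n) * (rpow r e / r ^ n).
Proof. intros Hr. rewrite rpow_mult_distr, rpow_minus_nat by lra. ring. Qed.

Lemma rpow_diff1 e r a b h : e <= 0 -> 0 < r -> r * / 3 <= a -> r * / 3 <= b -> Rabs (a - b) <= 2 * h ->
  Rabs (rpow a e - rpow b e) <= (2 * (- e) * rpow (/ 3) (e - 1)) * (rpow r e * (h / r)).
Proof.
  intros He Hr Ha Hb Hab. eapply Rle_trans; [apply (rpow_lip e (r * / 3)); auto; lra|].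
  pose proof (rpow_third r e 1 Hr) as E. simpl INR in E. rewrite E.
  replace (2 * - e * rpow (/ 3) (e - 1) * (rpow r e * (h / r)))
    with (- e * (rpow (/ 3) (e - 1) * (rpow r e / r ^ 1)) * (2 * h)) by (field; lra).
  apply Rmult_le_compat_l; auto. repeat apply Rmult_le_pos; auto using rpow_nonneg; try lra.
  left. apply Rinv_0_lt_compat. simpl; lra.
Qed.

Lemma pnorm_parallelogram c d : pnorm (padd c d) ^ 2 + pnorm (psub c d) ^ 2 - 2 * pnorm c ^ 2 = 2 * pnorm d ^ 2.
Proof. rewrite !pnorm_sq. unfold padd, psub, mkpt, px, py, pz; simpl. ring. Qed.

(** The power is written as (|q|^2)^(e/2): by the parallelogram law the second difference of the
    squared norm is exactly 2 |d|^2, so a one-variable Taylor estimate suffices. *)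
Lemma rpow_diff2 e : e <= 0 -> exists C, 0 <= C /\ forall r h c d, 0 < r -> 0 < h ->
  r * / 3 <= pnorm c <= 3 * r -> r * / 3 <= pnorm (padd c d) <= 3 * r -> r * / 3 <= pnorm (psub c d) <= 3 * r ->
  pnorm d <= 2 * h ->
  Rabs (rpow (pnorm (padd c d)) e + rpow (pnorm (psub c d)) e - 2 * rpow (pnorm c) e) <= C * (rpow r e * (h / r) ^ 2).
Proof.
  intros He. set (f := e / 2).
  (* 144 = (2 * 6)^2, since two norms differ by at most 2 h and their sum is at most 6 r; the 8 in
     [C2] comes from 2 |d|^2 <= 8 h^2. *)
  set (C1 := - f * (1 - f) * rpow (/ 3) (e - 4) * 144). set (C2 := - f * rpow (/ 3) (e - 2) * 8).
  assert (Hf : f <= 0) by (unfold f; lra).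
  assert (H1 : 0 <= C1) by (unfold C1; repeat apply Rmult_le_pos; auto using rpow_nonneg; lra).
  assert (H2 : 0 <= C2) by (unfold C2; repeat apply Rmult_le_pos; auto using rpow_nonneg; lra).
  exists (2 * C1 + C2). split; [lra|]. intros r h c d Hr Hh Hc Hp Hm Hd.
  set (m := (r * / 3) ^ 2). assert (Hm0 : 0 < m) by (apply pow_lt; lra).
  assert (Q : forall q, r * / 3 <= pnorm q -> m <= pnorm q ^ 2) by (intros; apply pow_incr; lra).
  assert (F : forall q, r * / 3 <= pnorm q -> rpow (pnorm q) e = rpow (pnorm q ^ 2) f).
  { intros q Hq. rewrite rpow_sq by lra. f_equal. unfold f. lra. }
  rewrite !F by tauto.
  pose proof (rpow_taylor2 f m (pnorm c ^ 2) (pnorm (padd c d) ^ 2) Hf Hm0 (Q _ (proj1 Hc)) (Q _ (proj1 Hp))) as T1.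
  pose proof (rpow_taylor2 f m (pnorm c ^ 2) (pnorm (psub c d) ^ 2) Hf Hm0 (Q _ (proj1 Hc)) (Q _ (proj1 Hm))) as T2.
  assert (D : forall q, r * / 3 <= pnorm q <= 3 * r -> pnorm (psub q c) <= 2 * h -> (pnorm q ^ 2 - pnorm c ^ 2) ^ 2 <= 144 * (h ^ 2 * r ^ 2)).
  { intros q Hq Hqc. pose proof (pnorm_lip q c) as L.
    assert (A : Rabs (pnorm q ^ 2 - pnorm c ^ 2) <= 12 * (h * r)).
    { replace (pnorm q ^ 2 - pnorm c ^ 2) with ((pnorm q - pnorm c) * (pnorm q + pnorm c)) by ring.
      rewrite Rabs_mult, (Rabs_right (pnorm q + pnorm c)) by lra. pose proof (Rabs_pos (pnorm q - pnorm c)).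
      replace (12 * (h * r)) with ((2 * h) * (6 * r)) by ring. apply Rmult_le_compat; lra. }
    apply sq_of_abs_le in A. replace (144 * (h ^ 2 * r ^ 2)) with ((12 * (h * r)) ^ 2) by ring. exact A. }
  assert (Dp := D (padd c d) Hp). assert (Dm := D (psub c d) Hm). clear D.
  replace (psub (padd c d) c) with d in Dp by pt_ring.
  replace (psub (psub c d) c) with (pscal (-1) d) in Dm by pt_ring. rewrite pnorm_opp in Dm.
  specialize (Dp Hd). specialize (Dm Hd).
  assert (E4 : rpow m (f - 2) = rpow (/ 3) (e - 4) * (rpow r e / r ^ 4)).
  { unfold m. rewrite rpow_sq by lra. pose proof (rpow_third r e 4 Hr) as E.
    replace (e - INR 4) with (e - 4) in E by (simpl; ring). rewrite <- E. f_equal. unfold f. lra. }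
  assert (E2 : rpow m (f - 1) = rpow (/ 3) (e - 2) * (rpow r e / r ^ 2)).
  { unfold m. rewrite rpow_sq by lra. pose proof (rpow_third r e 2 Hr) as E.
    replace (e - INR 2) with (e - 2) in E by (simpl; ring). rewrite <- E. f_equal. unfold f. lra. }
  assert (B : forall z, z <= 144 * (h ^ 2 * r ^ 2) -> - f * (1 - f) * rpow m (f - 2) * z <= C1 * (rpow r e * (h / r) ^ 2)).
  { intros z Hz. rewrite E4. unfold C1.
    replace (- f * (1 - f) * rpow (/ 3) (e - 4) * 144 * (rpow r e * (h / r) ^ 2))
      with (- f * (1 - f) * (rpow (/ 3) (e - 4) * (rpow r e / r ^ 4)) * (144 * (h ^ 2 * r ^ 2))) by (field; lra).
    apply Rmult_le_compat_l; auto. repeat apply Rmult_le_pos; auto using rpow_nonneg; try lra.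
    left. apply Rinv_0_lt_compat, pow_lt; auto. }
  assert (L : Rabs (f * rpow (pnorm c ^ 2) (f - 1) * (2 * pnorm d ^ 2)) <= C2 * (rpow r e * (h / r) ^ 2)).
  { rewrite !Rabs_mult, (Rabs_left1 f) by auto. rewrite (Rabs_right (rpow _ _)) by apply Rle_ge, rpow_nonneg.
    rewrite (Rabs_right 2), (Rabs_right (pnorm d ^ 2)) by (try apply Rle_ge, pow2_ge_0; lra).
    pose proof (pnorm_nonneg d).
    assert (pnorm d ^ 2 <= 4 * h ^ 2) by nra.
    assert (rpow (pnorm c ^ 2) (f - 1) <= rpow m (f - 1)) by (apply rpow_le_neg; [split; auto; apply Q; tauto|lra]).
    rewrite E2 in H3. unfold C2.
    replace (- f * rpow (/ 3) (e - 2) * 8 * (rpow r e * (h / r) ^ 2))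
      with (- f * (rpow (/ 3) (e - 2) * (rpow r e / r ^ 2)) * (2 * (4 * h ^ 2))) by (field; lra).
    apply Rmult_le_compat; try (apply Rmult_le_pos; auto using rpow_nonneg; lra).
    - apply Rmult_le_pos; [lra|apply pow2_ge_0].
    - apply Rmult_le_compat_l; auto. lra.
    - lra. }
  specialize (B _ Dp) as Bp. specialize (B _ Dm) as Bm.
  set (Qp := pnorm (padd c d) ^ 2) in *. set (Qm := pnorm (psub c d) ^ 2) in *. set (Q0 := pnorm c ^ 2) in *.
  assert (PL : Qp - Q0 + (Qm - Q0) = 2 * pnorm d ^ 2).
  { unfold Qp, Qm, Q0. rewrite <- (pnorm_parallelogram c d). ring. }
  rewrite <- PL in L.
  apply Rabs_le_between in T1, T2, L. apply Rabs_le. lra.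
Qed.

(** A discrete Leibniz rule of second order; the cross term is a product of two first
    differences. *)
Lemma prod_diff2 a0 a1 a2 s0 s1 s2 A A1 A2 S S1 S2 :
  Rabs a0 <= A -> Rabs s0 <= S -> Rabs (a1 + a2 - 2 * a0) <= A2 -> Rabs (s1 + s2 - 2 * s0) <= S2 ->
  Rabs (a1 - a0) <= A1 -> Rabs (a2 - a0) <= A1 -> Rabs (s1 - s0) <= S1 -> Rabs (s2 - s0) <= S1 ->
  Rabs (a1 * s1 + a2 * s2 - 2 * (a0 * s0)) <= A * S2 + S * A2 + 2 * (A1 * S1).
Proof.
  intros H1 H2 H3 H4 H5 H6 H7 H8.
  replace (a1 * s1 + a2 * s2 - 2 * (a0 * s0)) with
    (a0 * (s1 + s2 - 2 * s0) + s0 * (a1 + a2 - 2 * a0) + ((a1 - a0) * (s1 - s0) + (a2 - a0) * (s2 - s0))) by ring.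
  assert (P : forall x y X Y, Rabs x <= X -> Rabs y <= Y -> Rabs (x * y) <= X * Y).
  { intros x y X Y Hx Hy. rewrite Rabs_mult. apply Rmult_le_compat; auto using Rabs_pos. }
  eapply Rle_trans; [apply Rabs_triang|]. apply Rplus_le_compat.
  - eapply Rle_trans; [apply Rabs_triang|]. apply Rplus_le_compat; apply P; auto.
  - eapply Rle_trans; [apply Rabs_triang|]. pose proof (P _ _ _ _ H5 H7). pose proof (P _ _ _ _ H6 H8). lra.
Qed.

Definition refl (c q : pt) : pt := psub (pscal 2 c) q.

Definition wpsi (g : R) (S : pt -> R) (p : pt) : R := rpow (pnorm p) (- g) * S p.

(* Second differences about the cell centre cancel the first order error, which alone would
   give a logarithm when [al = eps = 1]; writing [t = h / |xi|] every term is [O(t ^ s)]. *)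
Lemma cell_pointwise al g s : 0 < al -> 0 <= g <= 2 -> 0 < s <= 2 -> g - (3 + al) <= 0 ->
  exists C, 0 < C /\ forall (S : pt -> R) K h c xi (Q : pt -> Prop) v1 v2 v3 v4, 0 <= K -> 0 < h ->
  (forall p, Rabs (S p) <= K * rpow (pnorm p) s) ->
  (forall a b, 0 < pnorm b -> Rabs (S a - S b) <= K * (rpow (pnorm (psub a b)) s + pnorm (psub a b) * rpow (pnorm b) (s - 1))) ->
  (forall c d, Rabs (S (padd c d) + S (psub c d) - 2 * S c) <= K * rpow (pnorm d) s) ->
  (forall q, Q q -> h <= pnorm q) -> (forall q q', Q q -> Q q' -> pnorm (psub q q') <= 2 * h) ->
  Q c -> (forall q, Q q -> Q (refl c q)) -> Q xi -> Q v1 -> Q v2 -> Q v3 -> Q v4 ->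
  let ps := wpsi g S in
  let om p := rpow (pnorm p) (g - (3 + al)) in
  let avg := / 8 * ((ps v1 + ps (refl c v1)) + (ps v2 + ps (refl c v2)) + (ps v3 + ps (refl c v3)) + (ps v4 + ps (refl c v4))) in
  Rabs ((ps xi - avg) * om xi + (ps (refl c xi) - avg) * om (refl c xi)) <= C * K * rpow h s * rpow (pnorm xi) (- (3 + al)).
Proof.
  intros Hal Hg Hs Hga.
  destruct (rpow_diff2 (- g) ltac:(lra)) as [CA [HCA TA]].
  set (a0 := rpow (/ 3) (- g)). assert (Ha0 : 0 <= a0) by apply rpow_nonneg.
  set (a1 := 2 * - - g * rpow (/ 3) (- g - 1)).
  assert (Ha1 : 0 <= a1) by (unfold a1; repeat apply Rmult_le_pos; auto using rpow_nonneg; lra).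
  set (e := g - (3 + al)) in *.
  set (C3 := 2 * - e * rpow (/ 3) (e - 1)).
  assert (HC3 : 0 <= C3) by (unfold C3; repeat apply Rmult_le_pos; auto using rpow_nonneg; lra).
  (* 4 and 9 bound 2^s and 3^s for s <= 2. In 58 = 4 + 54 the part 54 = 2 * 27 comes from the term
     |a - b| |b|^(s-1) of the first difference. *)
  set (C1 := 4 * a0 + 9 * CA + 2 * (a1 * 58)). set (C2 := 58 * a0 + 9 * a1).
  assert (HC1 : 0 <= C1) by (unfold C1; nra). assert (HC2 : 0 <= C2) by (unfold C2; nra).
  exists (2 * C1 + 2 * (C2 * C3) + 1). split; [nra|].
  intros S K h c xi Q v1 v2 v3 v4 HK Hh S1 S2 S3 Qh Qd Qc Qr Qxi Q1 Q2 Q3 Q4 ps om avg.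
  set (r := pnorm xi). assert (Hr : h <= r) by (apply Qh; auto).
  set (t := h / r).
  assert (Ht : 0 < t <= 1).
  { unfold t. split; [apply Rdiv_lt_0_compat; lra|]. apply Rle_div_l; lra. }
  set (T := rpow t s). assert (HT0 : 0 <= T) by apply rpow_nonneg.
  assert (HT1 : T <= 1) by (rewrite <- (rpow_0 t) by lra; apply rpow_le_exp; lra).
  (* Here s <= 2 is used: the second order terms in t are absorbed into T = t^s. *)
  assert (HtT : t ^ 2 <= T).
  { rewrite <- (rpow_INR t 2) by lra. apply rpow_le_exp; simpl; lra. }
  set (P := rpow r (- g)). set (R0 := rpow r s). set (W := rpow r e).
  assert (HP : 0 <= P) by apply rpow_nonneg. assert (HR0 : 0 <= R0) by apply rpow_nonneg.
  assert (HW : 0 <= W) by apply rpow_nonneg.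
  assert (Hhs : rpow h s = R0 * T).
  { unfold R0, T. rewrite <- rpow_mult_distr by lra. f_equal. unfold t. field. lra. }
  assert (HPW : rpow r (- (3 + al)) = P * W).
  { unfold P, W. rewrite <- rpow_plus. f_equal. unfold e. ring. }
  (* The lower bound r / 3 is the smallest value of max(h, r - 2 h), reached at h = r / 3. *)
  assert (Near : forall q, Q q -> r * / 3 <= pnorm q <= 3 * r).
  { intros q Hq. pose proof (Qd q xi Hq Qxi). pose proof (pnorm_lip q xi) as L. pose proof (Qh q Hq).
    apply Rabs_le_between in L. fold r in L. lra. }
  assert (N3 : rpow 3 s <= 9).
  { replace 9 with (rpow 3 2); [rewrite !rpow_pos by lra; apply Rle_Rpower; lra|].
    replace 2 with (INR 2) by reflexivity. rewrite rpow_INR; lra. }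
  assert (N2 : rpow 2 s <= 4).
  { replace 4 with (rpow 2 2); [rewrite !rpow_pos by lra; apply Rle_Rpower; lra|].
    replace 2 with (INR 2) at 2 by reflexivity. rewrite rpow_INR; lra. }
  assert (QS : forall q, Q q -> rpow (pnorm q) s <= 9 * R0).
  { intros q Hq. pose proof (Near q Hq). apply (Rle_trans _ (rpow (3 * r) s)).
    - apply rpow_le_pos; lra.
    - rewrite rpow_mult_distr by lra. apply Rmult_le_compat_r; auto. }
  assert (BS : forall q, Q q -> Rabs (S q) <= 9 * (K * R0)).
  { intros q Hq. eapply Rle_trans; [apply S1|]. specialize (QS q Hq). nra. }
  assert (H2h : forall x, 0 <= x <= 2 * h -> rpow x s <= 4 * (R0 * T)).
  { intros x Hx. apply (Rle_trans _ (rpow (2 * h) s)).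
    - apply rpow_le_pos; lra.
    - rewrite rpow_mult_distr, Hhs by lra. assert (0 <= R0 * T) by nra. nra. }
  assert (BS1 : forall q q', Q q -> Q q' -> Rabs (S q - S q') <= K * R0 * (4 * T + 54 * t)).
  { intros q q' Hq Hq'. pose proof (Near q' Hq'). pose proof (Qd q q' Hq Hq').
    eapply Rle_trans; [apply S2; lra|]. rewrite Rmult_assoc. apply Rmult_le_compat_l; auto.
    assert (X1 := H2h _ (conj (pnorm_nonneg (psub q q')) H0)).
    assert (X2 : rpow (pnorm q') (s - 1) <= 27 * (R0 / r)).
    { pose proof (rpow_minus_nat (pnorm q') s 1 ltac:(lra)) as E. simpl INR in E. rewrite E, pow_1.
      apply Rle_div_l; [lra|]. replace (27 * (R0 / r) * pnorm q') with (9 * R0 * (3 * pnorm q' / r)) by (field; lra).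
      assert (1 <= 3 * pnorm q' / r) by (apply Rle_div_r; lra). specialize (QS q' Hq'). nra. }
    assert (0 <= R0 / r) by (apply Rdiv_le_0_compat; lra).
    assert (X3 : pnorm (psub q q') * rpow (pnorm q') (s - 1) <= 2 * h * (27 * (R0 / r))).
    { apply Rmult_le_compat; auto using pnorm_nonneg, rpow_nonneg. }
    replace (2 * h * (27 * (R0 / r))) with (54 * (R0 * t)) in X3 by (unfold t; field; lra). lra. }
  assert (BA : forall q, Q q -> Rabs (rpow (pnorm q) (- g)) <= a0 * P).
  { intros q Hq. rewrite Rabs_right by apply Rle_ge, rpow_nonneg. pose proof (Near q Hq).
    unfold a0, P. rewrite Rmult_comm, <- rpow_mult_distr by lra. apply rpow_le_neg; lra. }
  assert (BA1 : forall q q', Q q -> Q q' -> Rabs (rpow (pnorm q) (- g) - rpow (pnorm q') (- g)) <= a1 * (P * t)).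
  { intros q q' Hq Hq'. pose proof (Near q Hq). pose proof (Near q' Hq').
    apply rpow_diff1; try lra. eapply Rle_trans; [apply pnorm_lip|]. auto. }
  assert (BO : forall q q', Q q -> Q q' -> Rabs (om q - om q') <= C3 * (W * t)).
  { intros q q' Hq Hq'. pose proof (Near q Hq). pose proof (Near q' Hq').
    apply rpow_diff1; try lra. eapply Rle_trans; [apply pnorm_lip|]. auto. }
  set (M := K * (P * R0)). assert (HM : 0 <= M) by (unfold M; repeat apply Rmult_le_pos; auto).
  assert (B1 : forall q, Q q -> Rabs (ps q + ps (refl c q) - 2 * ps c) <= C1 * (M * T)).
  { intros q Hq. unfold ps, wpsi.
    assert (E1 : q = padd c (psub q c)) by pt_ring. assert (E2 : refl c q = psub c (psub q c)) by (unfold refl; pt_ring).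
    assert (Hd : pnorm (psub q c) <= 2 * h) by auto.
    assert (X2 : Rabs (S q + S (refl c q) - 2 * S c) <= K * (4 * (R0 * T))).
    { rewrite E2. rewrite E1 at 1. eapply Rle_trans; [apply S3|]. apply Rmult_le_compat_l; auto.
      apply H2h. split; [apply pnorm_nonneg|auto]. }
    assert (Y2 : Rabs (rpow (pnorm q) (- g) + rpow (pnorm (refl c q)) (- g) - 2 * rpow (pnorm c) (- g)) <= CA * (P * t ^ 2)).
    { rewrite E2. rewrite E1 at 1. apply TA; try lra; auto. rewrite <- E1. auto. rewrite <- E2; auto. }
    eapply Rle_trans; [apply (prod_diff2 _ _ _ _ _ _ (a0 * P) (a1 * (P * t)) (CA * (P * t ^ 2)) (9 * (K * R0)) (K * R0 * (4 * T + 54 * t)) (K * (4 * (R0 * T)))); auto|].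
    replace (a0 * P * (K * (4 * (R0 * T))) + 9 * (K * R0) * (CA * (P * t ^ 2)) + 2 * (a1 * (P * t) * (K * R0 * (4 * T + 54 * t))))
      with (M * (4 * a0 * T + 9 * CA * t ^ 2 + 2 * a1 * (4 * (t * T) + 54 * t ^ 2))) by (unfold M; ring).
    replace (C1 * (M * T)) with (M * (4 * a0 * T + 9 * CA * T + 2 * a1 * (4 * T + 54 * T))) by (unfold C1; ring).
    apply Rmult_le_compat_l; auto. assert (t * T <= T) by nra.
    apply Rplus_le_compat; [apply Rplus_le_compat; [lra|apply Rmult_le_compat_l; lra]|apply Rmult_le_compat_l; lra]. }
  assert (B2 : forall q q', Q q -> Q q' -> Rabs (ps q - ps q') <= C2 * (M * (T + t))).
  { intros q q' Hq Hq'. unfold ps, wpsi.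
    replace (rpow (pnorm q) (- g) * S q - rpow (pnorm q') (- g) * S q') with
      (rpow (pnorm q) (- g) * (S q - S q') + (rpow (pnorm q) (- g) - rpow (pnorm q') (- g)) * S q') by ring.
    eapply Rle_trans; [apply Rabs_triang|]. rewrite !Rabs_mult.
    assert (X : Rabs (rpow (pnorm q) (- g)) * Rabs (S q - S q') <= (a0 * P) * (K * R0 * (4 * T + 54 * t)))
      by (apply Rmult_le_compat; auto using Rabs_pos).
    assert (Y : Rabs (rpow (pnorm q) (- g) - rpow (pnorm q') (- g)) * Rabs (S q') <= (a1 * (P * t)) * (9 * (K * R0)))
      by (apply Rmult_le_compat; auto using Rabs_pos).
    eapply Rle_trans; [apply Rplus_le_compat; [exact X|exact Y]|].
    replace (a0 * P * (K * R0 * (4 * T + 54 * t)) + a1 * (P * t) * (9 * (K * R0)))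
      with (M * (a0 * (4 * T + 54 * t) + 9 * a1 * t)) by (unfold M; ring).
    replace (C2 * (M * (T + t))) with (M * (a0 * (58 * (T + t)) + 9 * a1 * (T + t))) by (unfold C2; ring).
    apply Rmult_le_compat_l; auto. apply Rplus_le_compat; apply Rmult_le_compat_l; lra. }
  (* Both sides are compared with 2 [ps c]: 2 [avg] is the mean of four reflected pairs, each equal
     to 2 [ps c] up to C1 M T. *)
  assert (X1 : Rabs (ps xi + ps (refl c xi) - 2 * avg) <= 2 * C1 * (M * T)).
  { pose proof (B1 _ Qxi) as Z. pose proof (B1 _ Q1) as Z1. pose proof (B1 _ Q2) as Z2.
    pose proof (B1 _ Q3) as Z3. pose proof (B1 _ Q4) as Z4.
    apply Rabs_le_between in Z, Z1, Z2, Z3, Z4. unfold avg. apply Rabs_le. lra. }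
  assert (X2 : Rabs (ps (refl c xi) - avg) <= C2 * (M * (T + t))).
  { pose proof (fun q Hq => B2 (refl c xi) q (Qr _ Qxi) Hq) as Z.
    pose proof (Z _ Q1) as Z1. pose proof (Z _ Q2) as Z2. pose proof (Z _ Q3) as Z3. pose proof (Z _ Q4) as Z4.
    pose proof (Z _ (Qr _ Q1)) as Y1. pose proof (Z _ (Qr _ Q2)) as Y2. pose proof (Z _ (Qr _ Q3)) as Y3. pose proof (Z _ (Qr _ Q4)) as Y4.
    apply Rabs_le_between in Z1, Z2, Z3, Z4, Y1, Y2, Y3, Y4. unfold avg. apply Rabs_le. lra. }
  (* The first term is a second difference. In the second, the first order error of [ps] meets the
     variation of the weight [om], so it is a product of two small factors. *)
  replace ((ps xi - avg) * om xi + (ps (refl c xi) - avg) * om (refl c xi)) with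
    ((ps xi + ps (refl c xi) - 2 * avg) * om xi + (ps (refl c xi) - avg) * (om (refl c xi) - om xi)) by ring.
  eapply Rle_trans; [apply Rabs_triang|]. rewrite !Rabs_mult.
  assert (Rabs (om xi) = W) by (unfold om; fold r; apply Rabs_right, Rle_ge; auto).
  rewrite H, Hhs, HPW.
  assert (Y1 : Rabs (ps xi + ps (refl c xi) - 2 * avg) * W <= 2 * C1 * (M * T) * W) by (apply Rmult_le_compat_r; auto).
  assert (Y2 : Rabs (ps (refl c xi) - avg) * Rabs (om (refl c xi) - om xi) <= C2 * (M * (T + t)) * (C3 * (W * t)))
    by (apply Rmult_le_compat; auto using Rabs_pos).
  eapply Rle_trans; [apply Rplus_le_compat; [exact Y1|exact Y2]|].
  set (Z := M * W). assert (HZ : 0 <= Z) by (apply Rmult_le_pos; auto).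
  replace (2 * C1 * (M * T) * W + C2 * (M * (T + t)) * (C3 * (W * t)))
    with (Z * (2 * C1 * T + C2 * C3 * (t * T + t ^ 2))) by (unfold Z; ring).
  replace ((2 * C1 + 2 * (C2 * C3) + 1) * K * (R0 * T) * (P * W)) with (Z * (2 * C1 * T + C2 * C3 * (2 * T) + T)) by (unfold Z, M; ring).
  apply Rmult_le_compat_l; auto.
  assert (t * T <= T) by nra. assert (0 <= C2 * C3) by nra.
  assert (C2 * C3 * (t * T + t ^ 2) <= C2 * C3 * (2 * T)) by (apply Rmult_le_compat_l; lra). lra.
Qed.

(** * Reduction of the fractional Laplacian to the positive octant *)

Lemma RI_sum8 (f : bool -> bool -> bool -> pt -> R) (I : bool -> bool -> bool -> R) :
  (forall m n s, RI (f m n s) (I m n s)) -> RI (fun p => sum8 (fun m n s => f m n s p)) (sum8 I).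
Proof. intros H. unfold sum8. repeat apply RI_plus; apply H. Qed.

Lemma RI_flip m n s f I : RI f I -> RI (fun p => f (flip m n s p)) I.
Proof.
  intros H.
  assert (E : forall b, sgn b <> 0 /\ Rabs (sgn b) = 1).
  { intros []; simpl; [rewrite Rabs_left|rewrite Rabs_right]; lra. }
  pose proof (RI_diag_affine (mkpt (sgn m) (sgn n) (sgn s)) origin f I (proj1 (E m)) (proj1 (E n)) (proj1 (E s)) H) as Q.
  unfold mkpt, px, py, pz in Q; cbn [fst snd] in Q.
  rewrite (proj2 (E m)), (proj2 (E n)), (proj2 (E s)), Rinv_1, !Rmult_1_l in Q.
  eapply RI_ext; [|exact Q]. intros p. cbv beta. f_equal.
  apply pt_eq; unfold flip, diag_affine, origin, mkpt, px, py, pz; simpl; ring.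
Qed.

Lemma supn_flip m n s p : supn (flip m n s p) = supn p.
Proof.
  unfold supn, flip, mkpt, px, py, pz; simpl fst; simpl snd.
  rewrite !Rabs_mult.
  assert (E : forall b, Rabs (sgn b) = 1).
  { intros []; simpl; [rewrite Rabs_left|rewrite Rabs_right]; lra. }
  rewrite !E, !Rmult_1_l. reflexivity.
Qed.

Lemma cut_flip rho r g m n s p : cut rho r g (flip m n s p) = ind (supn p <= r) * ind (rho < pnorm p) * g (flip m n s p).
Proof. unfold cut. rewrite supn_flip, pnorm_flip. reflexivity. Qed.

Lemma ind_half_lines x : x <> 0 -> ind (0 <= x) + ind (0 <= - x) = 1.
Proof. intros H. ind_cases; lra. Qed.

(** Off the coordinate planes exactly one of the eight reflections moves p into the octant. *)
Lemma sum8_oct p : off (0 :: nil) p -> sum8 (fun m n s => ind (oct (flip m n s p))) = 1.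
Proof.
  intros [H1 [H2 H3]].
  assert (N : forall x, ~ In x (0 :: nil) -> x <> 0) by (intros x H E; apply H; left; auto).
  apply N in H1, H2, H3. apply ind_half_lines in H1, H2, H3.
  assert (E : forall m n s, ind (oct (flip m n s p)) = ind (0 <= sgn m * px p) * (ind (0 <= sgn n * py p) * ind (0 <= sgn s * pz p))).
  { intros. unfold oct, flip, mkpt, px, py, pz; cbn [fst snd]. rewrite !ind_and. reflexivity. }
  assert (E1 : forall x, ind (0 <= sgn true * x) = ind (0 <= - x)) by (intros; apply ind_iff; simpl; lra).
  assert (E0 : forall x, ind (0 <= sgn false * x) = ind (0 <= x)) by (intros; apply ind_iff; simpl; lra).
  unfold sum8. rewrite !E, !E1, !E0.
  transitivity ((ind (0 <= px p) + ind (0 <= - px p)) * ((ind (0 <= py p) + ind (0 <= - py p)) * (ind (0 <= pz p) + ind (0 <= - pz p)))).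
  - ring.
  - rewrite H1, H2, H3. ring.
Qed.

Definition kern (al : R) (p : pt) : R := rpow (pnorm p) (- (3 + al)).

Lemma kern_nonneg al p : 0 <= kern al p.
Proof. apply rpow_nonneg. Qed.

Lemma BUC_shift u x : BUC u -> BUC (fun p => u (padd x p)).
Proof.
  intros U. pose proof (diag_affine_BUC (mkpt 1 1 1) x u U) as Q.
  rewrite (functional_extensionality (fun p => u (padd x p)) (fun p => u (diag_affine (mkpt 1 1 1) x p))); auto.
  intros p. f_equal. apply pt_eq; unfold padd, diag_affine, mkpt, px, py, pz; simpl; ring.
Qed.

(** The truncation is invariant under the reflections, so each truncated integral equals the mean of
    its eight reflected copies. Summed over the reflections, both integrands become minus [symdiff]
    times the kernel off the coordinate planes, whence 8 I = 8 J. *)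
Lemma frac_transfer al u x V : 0 < al -> BUC u ->
  Imp (fun p => ind (oct p) * (-1 * symdiff u x p * kern al p)) V ->
  improper_int x (fun x' => (u x - u x') * rpow (pnorm (psub x x')) (- (3 + al))) = V.
Proof.
  intros Hal U HV.
  (* [ind True] puts the integrand in the shape expected by [locint_pow]. *)
  apply (Imp_improper x _ (fun p => ind True * ((u x + -1 * u (padd x p)) * kern al p))).
  { intros p. rewrite ind_true by auto. unfold kern.
    replace (psub x (padd x p)) with (pscal (-1) p) by pt_ring. rewrite pnorm_opp. ring. }
  refine (Imp_transfer _ _ V _ _ HV).
  - apply (locint_pow (fun _ => True) (fun p => u x + -1 * u (padd x p)) (- (3 + al))).
    + apply Jset_True.
    + apply BUC_plus; [apply BUC_const|apply BUC_scal, BUC_shift; auto].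
    + lra.
  - intros rho r I J Hrho Hr HI HJ.
    assert (E : sum8 (fun _ _ _ => I) = sum8 (fun _ _ _ => J)).
    { eapply (RI_eq_off (0 :: nil)).
      - apply (RI_sum8 (fun m n s p => cut rho r (fun p => ind (oct p) * (-1 * symdiff u x p * kern al p)) (flip m n s p))).
        intros m n s. apply RI_flip. exact HI.
      - apply (RI_sum8 (fun m n s p => cut rho r (fun p => ind True * ((u x + -1 * u (padd x p)) * kern al p)) (flip m n s p))).
        intros m n s. apply RI_flip. exact HJ.
      - intros p Hp.
        set (w := ind (supn p <= r) * ind (rho < pnorm p)).
        transitivity (w * (-1 * symdiff u x p * kern al p) * sum8 (fun m n s => ind (oct (flip m n s p)))).
        + unfold sum8. rewrite !cut_flip. fold w. rewrite !symdiff_flip. unfold kern. rewrite !pnorm_flip. ring.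
        + rewrite (sum8_oct p Hp). unfold symdiff, sum8. rewrite !cut_flip. fold w. unfold kern. rewrite !pnorm_flip.
          rewrite (ind_true True) by auto. ring. }
    unfold sum8 in E. lra.
Qed.

(** * Cells and the outer region *)

Definition cell (h : R) (i j k : nat) (p : pt) : Prop := in_cbox (gridpt h i j k) (gridpt h (S i) (S j) (S k)) p.

Lemma cell_coords h i j k p : cell h i j k p <->
  (INR i * h <= px p <= INR i * h + h) /\ (INR j * h <= py p <= INR j * h + h) /\ (INR k * h <= pz p <= INR k * h + h).
Proof.
  unfold cell, in_cbox, gridpt, mkpt, px, py, pz; cbn [fst snd]. rewrite !S_INR.
  assert (E : forall a, (a + 1) * h = a * h + h) by (intros; ring). rewrite !E. tauto.
Qed.

Lemma cell_ind_intble h i j k : 0 < h -> intble (fun p => ind (cell h i j k p)).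
Proof.
  intros Hh. apply (box_intble (gridpt h i j k) h); auto.
  - intros p Hp. apply cell_coords. unfold gridpt, mkpt, px, py, pz in *; cbn [fst snd] in *. lra.
  - intros p Hp. apply cell_coords in Hp. unfold in_cbox, gridpt, padd, mkpt, px, py, pz in *; cbn [fst snd] in *. lra.
Qed.

Lemma cell_supn h i j k p : 0 < h -> cell h i j k p -> supn p <= (INR i + INR j + INR k + 1) * h.
Proof.
  intros Hh Hp. apply cell_coords in Hp. destruct Hp as [P1 [P2 P3]].
  pose proof (pos_INR i). pose proof (pos_INR j). pose proof (pos_INR k).
  assert (0 <= INR i * h) by nra. assert (0 <= INR j * h) by nra. assert (0 <= INR k * h) by nra.
  apply supn_le. split; [|split]; apply Rabs_le; lra.
Qed.

(** On a bounded support the decay bound follows from the bound at the origin: |p|^(b-3) = |p|^(b+1)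
    |p|^-4 and |p| <= 2 D. *)
Lemma Imp_exist_bdd g b K D : locint g -> 0 < b < 3 -> 0 <= K -> 0 < D ->
  (forall p, 0 < pnorm p -> Rabs (g p) <= K * rpow (pnorm p) (b - 3)) -> supp D g -> exists V, Imp g V.
Proof.
  intros L Hb HK HD B Hsupp.
  apply (Imp_exist g 1 b K (K * rpow (2 * D) (b + 1))); auto; try lra.
  - apply Rmult_le_pos; auto using rpow_nonneg.
  - intros p Hp. destruct (Rlt_dec D (supn p)) as [Hd|Hd].
    + rewrite Hsupp, Rabs_R0 by auto. repeat apply Rmult_le_pos; auto using rpow_nonneg.
    + eapply Rle_trans; [apply B; auto|]. rewrite Rmult_assoc. apply Rmult_le_compat_l; auto.
      replace (b - 3) with ((b + 1) + - (3 + 1)) by ring. rewrite rpow_plus.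
      apply Rmult_le_compat_r; [apply rpow_nonneg|]. apply rpow_le_pos; [|lra].
      pose proof (pnorm_le_supn p). lra.
Qed.

Lemma cell_pow_Imp h i j k f e b K : 0 < h -> BUC f -> e <= 0 -> 0 < b < 3 -> 0 <= K ->
  (forall p, 0 < pnorm p -> Rabs (f p * rpow (pnorm p) e) <= K * rpow (pnorm p) (b - 3)) ->
  exists V, Imp (fun p => ind (cell h i j k p) * (f p * rpow (pnorm p) e)) V.
Proof.
  intros Hh Hf He Hb HK B.
  pose proof (pos_INR i). pose proof (pos_INR j). pose proof (pos_INR k).
  apply (Imp_exist_bdd _ b K ((INR i + INR j + INR k + 1) * h)); auto.
  - apply locint_pow; auto. apply Jset_intble, cell_ind_intble; auto.
  - nra.
  - intros p Hp. rewrite Rabs_mult. pose proof (ind_bound (cell h i j k p)).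
    rewrite (Rabs_right (ind _)) by lra. pose proof (B p Hp).
    pose proof (Rabs_pos (f p * rpow (pnorm p) e)). nra.
  - intros p Hp. rewrite ind_false; [ring|]. intros Hc. apply cell_supn in Hc; auto. lra.
Qed.

Lemma int_cell_Imp al g h i j k : 0 < h -> al < g -> 0 < al -> g <= 2 ->
  Imp (fun p => ind (cell h i j k p) * omega al g p) (int_cell al g h i j k).
Proof.
  intros Hh H1 H2 H3.
  destruct (cell_pow_Imp h i j k (fun _ => 1) (g - (3 + al)) (g - al) 1) as [V HV]; auto using BUC_const; try lra.
  - intros p Hp. replace (g - al - 3) with (g - (3 + al)) by ring.
    rewrite !Rmult_1_l, Rabs_right by apply Rle_ge, rpow_nonneg. lra.
  - assert (HV' : Imp (fun p => ind (cell h i j k p) * omega al g p) V).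
    { replace (fun p => ind (cell h i j k p) * omega al g p) with (fun p => ind (cell h i j k p) * (1 * rpow (pnorm p) (g - (3 + al))));
        auto. apply functional_extensionality. intros p. unfold omega. ring. }
    replace (int_cell al g h i j k) with V; auto. symmetry. unfold int_cell.
    apply (Imp_improper origin _ (fun p => ind (cell h i j k p) * omega al g p)); auto.
    intros p. replace (padd origin p) with p; [reflexivity|].
    apply pt_eq; unfold origin, padd, mkpt, px, py, pz; simpl; ring.
Qed.

Definition outer (L : R) (p : pt) : Prop :=
  (0 <= px p /\ 0 <= py p /\ 0 <= pz p) /\ ~ (0 < px p < L /\ 0 < py p < L /\ 0 < pz p < L).

Lemma Imp_eq_off l f g V W : Imp f V -> Imp g W -> (forall p, off l p -> f p = g p) -> V = W.
Proof.
  intros F G H. apply Rle_antisym; eapply (Imp_le l); eauto; intros p Hp; rewrite H; auto; lra.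
Qed.

(* On the coordinate planes [outer L] reaches the origin; removing this null set makes the
   integrand bounded there. *)
Lemma int_D2_Imp al L : 0 < al -> 0 < L -> Imp (fun p => ind (outer L p) * kern al p) (int_D2 al L).
Proof.
  intros Hal HL.
  assert (J1 : Jset (outer L)).
  { apply (Jset_and oct (fun p => ~ (0 < px p < L /\ 0 < py p < L /\ 0 < pz p < L))); [apply Jset_oct|].
    apply Jset_not, Jset_intble, (box_intble origin L); auto.
    - intros p Hp. unfold origin, mkpt, px, py, pz in *; cbn [fst snd] in *. lra.
    - intros p Hp. unfold in_cbox, padd, origin, mkpt, px, py, pz in *; cbn [fst snd] in *. lra. }
  assert (J2 : Jset (fun p => oct p /\ ~ supn p < L)).
  { apply Jset_and; [apply Jset_oct|]. apply Jset_not, Jset_intble.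
    apply (box_intble (mkpt (-L) (-L) (-L)) (2 * L)); [lra| |].
    - intros p [P1 [P2 P3]]. apply supn_lt. unfold mkpt, px, py, pz in *; cbn [fst snd] in *.
      split; [|split]; apply Rabs_def1; lra.
    - intros p Hp. apply supn_lt in Hp. destruct Hp as [P1 [P2 P3]]. apply Rabs_def2 in P1, P2, P3.
      unfold in_cbox, padd, mkpt, px, py, pz in *; cbn [fst snd] in *. lra. }
  assert (Lc : forall A, Jset A -> locint (fun p => ind (A p) * (1 * kern al p))).
  { intros A HA. apply (locint_pow A (fun _ => 1) (- (3 + al))); auto using BUC_const. lra. }
  destruct (Imp_exist (fun p => ind (oct p /\ ~ supn p < L) * (1 * kern al p)) al 1 (rpow L (- (al + 1))) 1) as [V HV];
    auto; try lra.
  - apply rpow_nonneg.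
  - intros p Hp. unfold kern. ind_cases.
    + rewrite !Rmult_1_l, Rabs_right by apply Rle_ge, rpow_nonneg.
      replace (- (3 + al)) with (- (al + 1) + (1 - 3)) by ring. rewrite rpow_plus.
      apply Rmult_le_compat_r; [apply rpow_nonneg|]. pose proof (supn_le_pnorm p). apply rpow_le_neg; lra.
    + rewrite Rmult_0_l, Rabs_R0. apply Rmult_le_pos; apply rpow_nonneg.
  - intros p Hp. unfold kern. pose proof (rpow_nonneg (pnorm p) (- (3 + al))).
    ind_cases; rewrite Rabs_right; lra.
  - assert (HV1 : Imp (fun p => ind (outer L p) * (1 * kern al p)) V).
    { apply (Imp_ae (0 :: nil) _ _ V HV); auto. intros p Hp. f_equal. apply ind_iff.
      assert (N : forall x, ~ In x (0 :: nil) -> x <> 0) by (intros x H E; apply H; left; auto).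
      destruct Hp as [H1 [H2 H3]]. apply N in H1, H2, H3. unfold outer, oct. rewrite supn_lt.
      split; intros [[P1 [P2 P3]] P4]; (split; [tauto|]); intros P5; apply P4; clear P4.
      - destruct P5 as [Q1 [Q2 Q3]]. rewrite !Rabs_right by lra. lra.
      - destruct P5 as [Q1 [Q2 Q3]]. rewrite !Rabs_right in * by lra. lra. }
    replace (fun p => ind (outer L p) * kern al p) with (fun p => ind (outer L p) * (1 * kern al p))
      by (apply functional_extensionality; intros; ring).
    replace (int_D2 al L) with V; auto. symmetry. unfold int_D2.
    apply (Imp_improper origin _ (fun p => ind (outer L p) * (1 * kern al p))); auto.
    intros p. replace (padd origin p) with p; [unfold outer, kern; ring|].
    apply pt_eq; unfold origin, padd, mkpt, px, py, pz; simpl; ring.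
Qed.

(** * Decomposition of the octant *)

(** Closed cells overlap on these coordinates; away from them the cells are disjoint and indicators
    can be summed. *)
Definition gridlines (h : R) (n : nat) : list R := map (fun i => INR i * h) (seq 0 (S n)).

Lemma gridlines_In h n i : (i <= n)%nat -> In (INR i * h) (gridlines h n).
Proof. intros H. apply (in_map (fun i => INR i * h)). apply in_seq. lia. Qed.

Lemma sum_intervals h n t : 0 < h -> ~ In t (gridlines h n) ->
  sumR n (fun i => ind (INR i * h <= t <= INR i * h + h)) = ind (0 <= t <= INR n * h).
Proof.
  intros Hh Ht.
  assert (G : forall i, (i <= n)%nat -> t <> INR i * h) by (intros i Hi ->; apply Ht, gridlines_In; auto).
  clear Ht. induction n as [|n IH].
  - simpl. rewrite ind_false; auto. specialize (G 0%nat (le_n _)). simpl in G. lra.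
  - simpl sumR. rewrite IH by auto. rewrite S_INR. pose proof (pos_INR n). assert (0 <= INR n * h) by nra.
    pose proof (G n ltac:(lia)). replace ((INR n + 1) * h) with (INR n * h + h) by ring. ind_cases; lra.
Qed.

Lemma sum3_prod n f g k : sum3 n (fun a b c => f a * (g b * k c)) = sumR n f * (sumR n g * sumR n k).
Proof.
  unfold sum3. rewrite (Rmult_comm (sumR n f)), <- sumR_scal. apply sumR_ext. intros a _.
  rewrite Rmult_comm. rewrite (sumR_ext n _ (fun b => f a * (g b * sumR n k))).
  - rewrite sumR_scal. f_equal. rewrite Rmult_comm, <- sumR_scal. apply sumR_ext. intros; ring.
  - intros b _. rewrite <- Rmult_assoc, <- sumR_scal. apply sumR_ext. intros; ring.
Qed.

Lemma sum_cells h n p : 0 < h -> off (gridlines h n) p ->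
  sum3 n (fun i j k => ind (cell h i j k p)) =
  ind (0 <= px p <= INR n * h) * (ind (0 <= py p <= INR n * h) * ind (0 <= pz p <= INR n * h)).
Proof.
  intros Hh [H1 [H2 H3]]. rewrite <- !(sum_intervals h n) by auto. rewrite <- sum3_prod.
  apply sum3_ext. intros i j k _ _ _. rewrite <- !ind_and. apply ind_iff, cell_coords.
Qed.

(** Off the grid, an octant point is either in exactly one cell or has a coordinate above L, where f
    takes the prescribed value d. *)
Lemma octant_split h n L f d p : 0 < h -> (0 < n)%nat -> L = INR n * h -> off (gridlines h n) p ->
  (outer L p -> L < px p \/ L < py p \/ L < pz p -> f = d) ->
  ind (oct p) * f = sum3 n (fun i j k => ind (cell h i j k p)) * f + ind (outer L p) * d.
Proof.
  intros Hh Hn HL Hp Hd. rewrite sum_cells by auto. rewrite <- HL.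
  assert (G0 : forall t, ~ In t (gridlines h n) -> t <> 0 /\ t <> L).
  { intros t Ht. split; intros E; apply Ht.
    - replace t with (INR 0 * h) by (simpl; lra). apply gridlines_In; lia.
    - rewrite E, HL. apply gridlines_In; auto. }
  destruct Hp as [H1 [H2 H3]]. apply G0 in H1, H2, H3.
  destruct (classic (oct p)) as [Ho|Ho].
  - rewrite (ind_true _ Ho). unfold oct in Ho.
    destruct (classic (px p <= L /\ py p <= L /\ pz p <= L)) as [Hi|Hi].
    + rewrite !ind_true by lra. rewrite (ind_false (outer L p)); [ring|]. intros [_ C]. apply C. lra.
    + assert (Hout : outer L p) by (split; [exact Ho|lra]).
      rewrite (ind_true (outer L p)) by auto. rewrite (Hd Hout) by lra.
      assert (Z : ind (0 <= px p <= L) * (ind (0 <= py p <= L) * ind (0 <= pz p <= L)) = 0).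
      { rewrite <- !ind_and. apply ind_false. intros C. apply Hi. lra. }
      rewrite Z. ring.
  - rewrite (ind_false _ Ho), (ind_false (outer L p)); [|intros [C _]; apply Ho; exact C].
    assert (Z : ind (0 <= px p <= L) * (ind (0 <= py p <= L) * ind (0 <= pz p <= L)) = 0).
    { rewrite <- !ind_and. apply ind_false. intros C. apply Ho. unfold oct. lra. }
    rewrite Z. ring.
Qed.

(** * Error of a single cell away from the origin *)

Definition iszero (i j k : nat) : bool := (Nat.eqb i 0 && Nat.eqb j 0 && Nat.eqb k 0)%bool.

Lemma cell_far h i j k p : 0 < h -> iszero i j k = false -> cell h i j k p -> h <= pnorm p.
Proof.
  intros Hh Hz Hp. apply cell_coords in Hp. destruct Hp as [P1 [P2 P3]].
  assert (G : forall m, (m <> 0)%nat -> h <= INR m * h).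
  { intros m Hm. assert (1 <= INR m) by (apply (le_INR 1); lia). nra. }
  assert (C : (i <> 0 \/ j <> 0 \/ k <> 0)%nat).
  { unfold iszero in Hz. destruct i, j, k; simpl in Hz; try discriminate; lia. }
  destruct C as [C|[C|C]]; specialize (G _ C).
  - pose proof (crd_le_pnorm 0 p). simpl in H. pose proof (Rle_abs (px p)). lra.
  - pose proof (crd_le_pnorm 1 p). simpl in H. pose proof (Rle_abs (py p)). lra.
  - pose proof (crd_le_pnorm 2 p). simpl in H. pose proof (Rle_abs (pz p)). lra.
Qed.

Definition centre (h : R) (i j k : nat) : pt := padd (gridpt h i j k) (mkpt (h / 2) (h / 2) (h / 2)).

Lemma cell_refl h i j k q : cell h i j k q -> cell h i j k (refl (centre h i j k) q).
Proof.
  intros H. apply cell_coords in H. apply cell_coords.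
  unfold refl, centre, gridpt, psub, padd, pscal, mkpt, px, py, pz in *; cbn [fst snd] in *. lra.
Qed.

Lemma refl_refl c q : refl c (refl c q) = q.
Proof. apply pt_eq; unfold refl, psub, pscal, mkpt, px, py, pz; simpl; ring. Qed.

Lemma RI_refl c f I : RI f I -> RI (fun p => f (refl c p)) I.
Proof.
  intros H. pose proof (RI_diag_affine (mkpt (-1) (-1) (-1)) (pscal 2 c) f I) as Q.
  unfold mkpt, px, py, pz in Q; cbn [fst snd] in Q. rewrite (Rabs_left (-1)) in Q by lra.
  specialize (Q ltac:(lra) ltac:(lra) ltac:(lra) H). replace (/ - -1) with 1 in Q by field. rewrite !Rmult_1_l in Q.
  eapply RI_ext; [|exact Q]. intros p. cbv beta. f_equal.
  apply pt_eq; unfold refl, psub, pscal, diag_affine, mkpt, px, py, pz; simpl; ring.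
Qed.

Definition vertex (h : R) (i j k : nat) (m n s : bool) : pt := gridpt h (i + b2n m) (j + b2n n) (k + b2n s).

Lemma vertex_cell h i j k m n s : 0 < h -> cell h i j k (vertex h i j k m n s).
Proof.
  intros Hh. apply cell_coords. unfold vertex, gridpt, mkpt, px, py, pz; cbn [fst snd]. rewrite !plus_INR.
  destruct m, n, s; simpl; lra.
Qed.

(** Reflection about the centre exchanges opposite vertices, so the vertex average already consists
    of the four reflected pairs of [cell_pointwise]. *)
Lemma vertex_refl h i j k m n s :
  refl (centre h i j k) (vertex h i j k m n s) = vertex h i j k (negb m) (negb n) (negb s).
Proof.
  apply pt_eq; unfold refl, centre, vertex, gridpt, psub, padd, pscal, mkpt, px, py, pz; cbn [fst snd]; rewrite !plus_INR;
    destruct m, n, s; simpl; field.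
Qed.

(** What the quadrature estimates need to know of [symdiff u x]. The constant obtained in
    [symdiff_symreg] does not depend on x, which gives the supremum over the box. *)
Definition symreg (Sf : pt -> R) (s K : R) : Prop :=
  0 <= K /\ BUC Sf /\ (forall p, Rabs (Sf p) <= K * rpow (pnorm p) s) /\
  (forall a b, 0 < pnorm b -> Rabs (Sf a - Sf b) <= K * (rpow (pnorm (psub a b)) s + pnorm (psub a b) * rpow (pnorm b) (s - 1))) /\
  (forall c d, Rabs (Sf (padd c d) + Sf (psub c d) - 2 * Sf c) <= K * rpow (pnorm d) s).

Lemma symdiff_symreg u s K x : regular u s K -> symreg (symdiff u x) s (8 * K).
Proof.
  intros H. assert (HK : 0 <= K) by apply H. split; [lra|]. split; [apply symdiff_BUC; apply H|]. split; [|split].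
  - intros p. eapply Rle_trans; [apply symdiff_bound; eauto|]. pose proof (rpow_nonneg (pnorm p) s). nra.
  - intros a b Hb. eapply Rle_trans; [apply symdiff_diff1; eauto|].
    pose proof (rpow_nonneg (pnorm (psub a b)) s). pose proof (pnorm_nonneg (psub a b)). pose proof (rpow_nonneg (pnorm b) (s - 1)).
    apply Rmult_le_compat_r; [nra|lra].
  - intros c d. rewrite Rmult_assoc. apply symdiff_diff2; auto.
Qed.

(** The integral of [G] over the cell is unchanged by reflection about the centre, so twice the
    error is the integral of [G p + G (refl c p)], and this sum is bounded pointwise by
    [cell_pointwise]. *)
Lemma cell_error al g s : 0 < al -> al < g <= 2 -> 0 < s <= 2 -> exists C, 0 < C /\
  forall Sf K h i j k X W U, symreg Sf s K -> 0 < h -> iszero i j k = false ->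
  Imp (fun p => ind (cell h i j k p) * (Sf p * kern al p)) X ->
  Imp (fun p => ind (cell h i j k p) * omega al g p) W ->
  RI (fun p => ind (cell h i j k p) * kern al p) U ->
  Rabs (/ 8 * sum8 (fun m n s => wpsi g Sf (vertex h i j k m n s)) * W - X) <= C * K * rpow h s * U.
Proof.
  intros Hal Hg Hs.
  destruct (cell_pointwise al g s Hal ltac:(lra) Hs ltac:(lra)) as [C [HC CP]].
  exists C. split; auto. intros Sf K h i j k X W U [HK [HB [S1 [S2 S3]]]] Hh Hz HX HW HU.
  set (v := vertex h i j k). set (c := centre h i j k). set (avg := / 8 * sum8 (fun m n s => wpsi g Sf (v m n s))).
  set (G := fun p => ind (cell h i j k p) * ((wpsi g Sf p - avg) * omega al g p)).
  assert (HG : Imp G (X + - avg * W)).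
  { assert (HG' := Imp_plus _ _ _ _ HX (Imp_scal (- avg) _ _ HW)).
    replace G with (fun p => ind (cell h i j k p) * (Sf p * kern al p) + - avg * (ind (cell h i j k p) * omega al g p)); auto.
    apply functional_extensionality. intros p. unfold G, wpsi, omega, kern.
    replace (- (3 + al)) with (- g + (g - (3 + al))) by ring. rewrite rpow_plus. ring. }
  assert (LG : locint G).
  { apply (locint_mult G (cell h i j k)).
    - apply Jset_intble, cell_ind_intble; auto.
    - intros p Hp. unfold G. rewrite ind_false; auto. ring.
    - intros rho Hrho.
      exists (fun p => (rpow (Rmax (pnorm p) rho) (- g) * Sf p + - avg) * rpow (Rmax (pnorm p) rho) (g - (3 + al))). split.
      + apply BUC_mult; [apply BUC_plus; [apply BUC_mult|apply BUC_const]|]; auto; apply pow_BUC; auto; lra.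
      + intros p Hp Hc. unfold G, wpsi, omega. rewrite ind_true, !Rmax_left by (auto; lra). ring. }
  pose proof (pos_INR i). pose proof (pos_INR j). pose proof (pos_INR k).
  (* The cell satisfies |p| >= h, so [G] vanishes on the ball of radius h / 2. *)
  destruct (Imp_RI G (h / 2) ((INR i + INR j + INR k + 1) * h)) as [I [I1 I2]]; auto; try lra.
  { nra. }
  { intros p Hp. unfold G. rewrite ind_false; [ring|]. intros Hc. apply cell_far in Hc; auto. lra. }
  { intros p Hp. unfold G. rewrite ind_false; [ring|]. intros Hc. apply cell_supn in Hc; auto. lra. }
  clear HX HW.
  assert (HU0 : 0 <= U).
  { apply (RI_nonneg nil _ _ HU). intros p _. apply Rmult_le_pos; [apply ind_bound|apply kern_nonneg]. }
  assert (B : forall p, Rabs (G p + G (refl c p)) <= (C * K * rpow h s) * (ind (cell h i j k p) * kern al p)).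
  { intros p. unfold G. destruct (classic (cell h i j k p)) as [Hp|Hp].
    - rewrite !ind_true by (auto; apply cell_refl; auto). rewrite !Rmult_1_l.
      assert (P := CP Sf K h c p (cell h i j k) (v false false false) (v false false true) (v false true false) (v false true true)
        HK Hh S1 S2 S3 (fun q Hq => cell_far h i j k q Hh Hz Hq)).
      assert (Hv : forall m n s, refl c (v m n s) = v (negb m) (negb n) (negb s)) by (intros; apply vertex_refl).
      cbv zeta in P. rewrite !Hv in P. cbn [negb] in P.
      assert (Ea : avg = / 8 * (wpsi g Sf (v false false false) + wpsi g Sf (v true true true) +
         (wpsi g Sf (v false false true) + wpsi g Sf (v true true false)) + (wpsi g Sf (v false true false) + wpsi g Sf (v true false true)) +
         (wpsi g Sf (v false true true) + wpsi g Sf (v true false false)))) by (unfold avg; rewrite sum8_pairs; reflexivity).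
      rewrite <- Ea in P. apply P; auto; try (apply vertex_cell; auto).
      + intros q q' Hq Hq'. eapply Rle_trans; [apply pnorm_le_supn|]. apply Rmult_le_compat_l; [lra|].
        apply cell_coords in Hq, Hq'. apply supn_le. unfold psub, mkpt, px, py, pz in *; cbn [fst snd] in *.
        split; [|split]; apply Rabs_le; lra.
      + apply cell_coords. unfold c, centre, gridpt, padd, mkpt, px, py, pz; cbn [fst snd]. lra.
      + intros q. apply cell_refl.
    - rewrite (ind_false _ Hp), ind_false.
      + rewrite !Rmult_0_l, Rplus_0_l, Rabs_R0. lra.
      + intros Hr. apply Hp. rewrite <- (refl_refl c p). apply cell_refl; auto. }
  assert (R1 : RI (fun p => G p + G (refl c p)) (I + I)) by (apply RI_plus; [auto|apply RI_refl; auto]).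
  assert (R2 := RI_scal (C * K * rpow h s) _ _ HU).
  assert (RB := RI_abs_le nil _ _ _ _ R1 R2 (fun p _ => B p)). apply Rabs_le_between in RB.
  assert (0 <= C * K * rpow h s * U).
  { repeat apply Rmult_le_pos; auto using rpow_nonneg; lra. }
  assert (E := Imp_unique _ _ _ HG I2). apply Rabs_le. lra.
Qed.

(** * Summing the errors *)

Lemma cell_kern_RI al h i j k : 0 < al -> 0 < h -> iszero i j k = false ->
  exists U, RI (fun p => ind (cell h i j k p) * kern al p) U.
Proof.
  intros Hal Hh Hz. apply intble_RI.
  eapply intble_ext; [|apply (intble_mult (fun p => rpow (Rmax (pnorm p) h) (- (3 + al))) _ (pow_BUC h (- (3 + al)) Hh ltac:(lra)) (cell_ind_intble h i j k Hh))].
  intros p. cbv beta. destruct (classic (cell h i j k p)) as [Hp|Hp].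
  - rewrite ind_true by auto. rewrite Rmax_left by (apply (cell_far h i j k); auto). unfold kern. ring.
  - rewrite ind_false by auto. ring.
Qed.

Lemma RI_sum3 n (f : nat -> nat -> nat -> pt -> R) (I : nat -> nat -> nat -> R) :
  (forall i j k, RI (f i j k) (I i j k)) -> RI (fun p => sum3 n (fun i j k => f i j k p)) (sum3 n I).
Proof.
  intros H. unfold sum3.
  apply (RI_sumR n (fun i p => sumR n (fun j => sumR n (fun k => f i j k p)))). intros i _.
  apply (RI_sumR n (fun j p => sumR n (fun k => f i j k p))). intros j _.
  apply (RI_sumR n (fun k p => f i j k p)). auto.
Qed.

(** Off the grid the cells are disjoint, so the summed integrand is at most the kernel restricted to
    |p| >= h, and [far_bound] applies with r = h. *)
Lemma kern_sum al : 0 < al -> exists C, 0 < C /\ forall h n (U : nat -> nat -> nat -> R), 0 < h ->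
  (forall i j k, RI (fun p => if iszero i j k then 0 else ind (cell h i j k p) * kern al p) (U i j k)) ->
  Rabs (sum3 n U) <= C * rpow h (- al).
Proof.
  intros Hal. destruct (far_bound al Hal) as [C [HC F]]. exists C. split; auto. intros h n U Hh HU.
  rewrite <- (Rmult_1_r C).
  apply (F (gridlines h n) h 1 (fun p => sum3 n (fun i j k => if iszero i j k then 0 else ind (cell h i j k p) * kern al p))); auto; try lra.
  - apply (RI_sum3 n (fun i j k p => if iszero i j k then 0 else ind (cell h i j k p) * kern al p)); auto.
  - intros p Hp. destruct (Rle_dec h (pnorm p)) as [Hn|Hn].
    + right. split; auto. rewrite Rmult_1_l. fold (kern al p). pose proof (kern_nonneg al p).
      assert (Hpos : forall i j k, 0 <= (if iszero i j k then 0 else ind (cell h i j k p) * kern al p)).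
      { intros. destruct (iszero i j k); [lra|]. apply Rmult_le_pos; auto. apply ind_bound. }
      rewrite Rabs_right.
      2:{ apply Rle_ge. unfold sum3. repeat (apply sumR_nonneg; intros). auto. }
      apply (Rle_trans _ (sum3 n (fun i j k => kern al p * ind (cell h i j k p)))).
      * apply sum3_le. intros i j k _ _ _. destruct (iszero i j k); [|lra].
        apply Rmult_le_pos; auto. apply ind_bound.
      * rewrite sum3_scal, sum_cells by auto. rewrite <- !ind_and.
        match goal with |- _ * ind ?A <= _ => pose proof (ind_bound A) end. nra.
    + left. transitivity (sum3 n (fun _ _ _ => 0 * 0)).
      * apply sum3_ext. intros i j k _ _ _. destruct (iszero i j k) eqn:E; [ring|].
        rewrite ind_false; [ring|]. intros Hc. apply Hn. apply (cell_far h i j k); auto.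
      * rewrite sum3_scal. ring.
Qed.

Lemma sumR_single n f : (0 < n)%nat -> (forall i, (0 < i)%nat -> f i = 0) -> sumR n f = f 0%nat.
Proof.
  intros Hn H. induction n as [|n IH]; [lia|]. simpl. destruct n as [|n]; [simpl; ring|].
  rewrite IH by lia. rewrite (H (S n)) by lia. ring.
Qed.

Lemma sumR_0 n : sumR n (fun _ => 0) = 0.
Proof. induction n as [|n IH]; simpl; lra. Qed.

Lemma sum3_single n F : (0 < n)%nat -> sum3 n (fun i j k => if iszero i j k then F i j k else 0) = F 0%nat 0%nat 0%nat.
Proof.
  intros Hn. unfold sum3, iszero.
  rewrite sumR_single; auto.
  - rewrite sumR_single; auto.
    + rewrite sumR_single; auto. intros [|i] Hi; [lia|reflexivity].
    + intros [|i] Hi; [lia|]. simpl. apply sumR_0.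
  - intros [|i] Hi; [lia|]. simpl. rewrite (sumR_ext n _ (fun _ => 0)); [apply sumR_0|]. intros; apply sumR_0.
Qed.

(** From a point of the box, a shift by more than L along one axis, in either direction, leaves the
    box. *)
Lemma symdiff_outside ax bx ay by_ az bz u x L p :
  (forall p, ~ in_box_open ax bx ay by_ az bz p -> u p = 0) -> in_box_open ax bx ay by_ az bz x ->
  bx - ax <= L -> by_ - ay <= L -> bz - az <= L -> (L < px p \/ L < py p \/ L < pz p) ->
  symdiff u x p = -8 * u x.
Proof.
  intros U0 [X1 [X2 X3]] L1 L2 L3 Hp. unfold symdiff.
  assert (Z : forall m n s, u (padd x (flip m n s p)) = 0).
  { intros m n s. apply U0. unfold in_box_open, padd, flip, mkpt, px, py, pz in *; cbn [fst snd] in *.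
    intros [C1 [C2 C3]]. destruct Hp as [H|[H|H]]; destruct m, n, s; simpl in *; lra. }
  unfold sum8. rewrite !Z. ring.
Qed.

(** * The cell at the origin and the global bound *)

Lemma cg_bound g m n s : Rabs (cg g m n s) <= 8 / 3.
Proof.
  unfold cg. destruct (Req_EM_T g 2).
  - destruct (Nat.eqb _ 1); [rewrite Rabs_right; lra|rewrite Rabs_R0; lra].
  - rewrite Rabs_R1. lra.
Qed.

(** No cancellation is used here: the seven vertices other than the origin have norm between h and 2
    h. The 4 bounds 2^s, and 8/3 bounds the coefficients for every gamma. *)
Lemma origin_vertices_bound g s Sf K h : 0 < g -> 0 < s <= 2 -> symreg Sf s K -> 0 < h ->
  Rabs (sum8 (fun m n s => if (m || n || s)%bool then cg g m n s * wpsi g Sf (vertex h 0 0 0 m n s) else 0)) <=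
  8 * (8 / 3 * (4 * K * (rpow h s * rpow h (- g)))).
Proof.
  intros Hg Hs [HK [_ [S1 _]]] Hh. apply sum8_abs. intros m n k.
  assert (P0 : 0 <= rpow h s * rpow h (- g)) by (apply Rmult_le_pos; apply rpow_nonneg).
  destruct (m || n || k)%bool eqn:E.
  2:{ rewrite Rabs_R0. nra. }
  rewrite Rabs_mult. apply Rmult_le_compat; auto using Rabs_pos, cg_bound.
  set (v := vertex h 0 0 0 m n k).
  assert (Hv : supn v <= h).
  { apply supn_le. unfold v, vertex, gridpt, mkpt, px, py, pz; cbn [fst snd Nat.add].
    split; [|split]; rewrite Rabs_right; destruct m, n, k; simpl; lra. }
  assert (Hv' : h <= pnorm v).
  { eapply Rle_trans; [|apply supn_le_pnorm].
    destruct m; [eapply Rle_trans; [|apply (crd_le_supn 0)]|destruct n; [eapply Rle_trans; [|apply (crd_le_supn 1)]|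
      destruct k; [eapply Rle_trans; [|apply (crd_le_supn 2)]|discriminate]]];
    unfold v, vertex, gridpt, mkpt, crd, px, py, pz; cbn [fst snd]; rewrite Rabs_right; simpl; lra. }
  pose proof (pnorm_le_supn v) as Hv2.
  unfold wpsi. rewrite Rabs_mult, (Rabs_right (rpow _ _)) by apply Rle_ge, rpow_nonneg.
  assert (A : rpow (pnorm v) (- g) <= rpow h (- g)) by (apply rpow_le_neg; lra).
  assert (B : Rabs (Sf v) <= K * (4 * rpow h s)).
  { eapply Rle_trans; [apply S1|]. apply Rmult_le_compat_l; auto.
    apply (Rle_trans _ (rpow (2 * h) s)); [apply rpow_le_pos; lra|].
    rewrite rpow_mult_distr by lra. apply Rmult_le_compat_r; [apply rpow_nonneg|].
    replace 4 with (rpow 2 2); [rewrite !rpow_pos by lra; apply Rle_Rpower; lra|].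
    replace 2 with (INR 2) at 2 by reflexivity. rewrite rpow_INR; lra. }
  replace (4 * K * (rpow h s * rpow h (- g))) with (rpow h (- g) * (K * (4 * rpow h s))) by ring.
  apply Rmult_le_compat; auto using rpow_nonneg, Rabs_pos.
Qed.

Lemma consistency al g eps ax bx ay by_ az bz u K :
  0 < al < 2 -> 0 < eps <= 1 -> al + eps <= 2 -> al < g <= 2 ->
  ax < bx -> ay < by_ -> az < bz ->
  (forall p, ~ in_box_open ax bx ay by_ az bz p -> u p = 0) -> regular u (al + eps) K ->
  let L := Rmax (bx - ax) (Rmax (by_ - ay) (bz - az)) in
  exists C, 0 < C /\ forall N, (1 <= N)%nat -> forall x, in_box_open ax bx ay by_ az bz x ->
    Rabs (frac_lap al u x - disc_op al g L N u x) <= C * rpow (L / INR N) eps.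
Proof.
  intros Hal He Hs Hg Hx Hy Hz U0 HR L.
  assert (L1 : bx - ax <= L) by apply Rmax_l.
  assert (L2 : by_ - ay <= L) by (eapply Rle_trans; [apply Rmax_l|apply Rmax_r]).
  assert (L3 : bz - az <= L) by (eapply Rle_trans; [apply Rmax_r|apply Rmax_r]).
  assert (HL : 0 < L) by lra. clearbody L.
  assert (HK : 0 <= K) by apply HR. assert (HB : BUC u) by apply HR.
  set (s := al + eps) in *. assert (Hss : s = al + eps) by reflexivity.
  destruct (Imp_near eps ltac:(lra)) as [Cn [HCn Near]].
  destruct (Imp_near (g - al) ltac:(lra)) as [Cw [HCw NearW]].
  destruct (cell_error al g s ltac:(lra) Hg ltac:(lra)) as [Ce [HCe CE]].
  destruct (kern_sum al ltac:(lra)) as [Ck [HCk KS]].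
  set (K8 := 8 * K). assert (HK8 : 0 <= K8) by (unfold K8; lra).
  (* The three contributions: the exact integral over the origin cell, its quadrature term (32/3 =
     1/8 * 8 * 8/3 * 4), and all other cells together. *)
  set (C0 := Cn * K8 + 32 / 3 * K8 * Cw + Ce * K8 * Ck).
  assert (HC0 : 0 <= C0) by (unfold C0; repeat (apply Rplus_le_le_0_compat || apply Rmult_le_pos); lra).
  (* Nothing is proved about the value of [c3 al]; it enters through its absolute value, and + 1
     keeps the constant positive. *)
  exists (Rabs (c3 al) * C0 + 1).
  split; [pose proof (Rmult_le_pos _ _ (Rabs_pos (c3 al)) HC0); lra|].
  intros N HN x Hxb. set (h := L / INR N).
  assert (HNp : 0 < INR N) by (apply lt_0_INR; lia).
  assert (Hh : 0 < h) by (apply Rdiv_lt_0_compat; auto).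
  assert (HNh : L = INR N * h) by (unfold h; field; lra).
  set (Sf := symdiff u x). assert (SR : symreg Sf s K8) by (apply symdiff_symreg; auto).
  assert (SB : BUC Sf) by apply SR. assert (S1 : forall p, Rabs (Sf p) <= K8 * rpow (pnorm p) s) by apply SR.
  assert (Snear : forall p, Rabs (Sf p * kern al p) <= K8 * rpow (pnorm p) (eps - 3)).
  { intros p. rewrite Rabs_mult, (Rabs_right (kern al p)) by apply Rle_ge, kern_nonneg.
    replace (eps - 3) with (s + - (3 + al)) by (unfold s; ring). rewrite rpow_plus, <- Rmult_assoc.
    apply Rmult_le_compat_r; [apply kern_nonneg|apply S1]. }
  destruct (bounded_fun_pos Sf (proj2 SB)) as [M [HM0 HM]].
  set (X := fun i j k => epsilon (inhabits 0) (Imp (fun p => ind (cell h i j k p) * (Sf p * kern al p)))).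
  assert (HX : forall i j k, Imp (fun p => ind (cell h i j k p) * (Sf p * kern al p)) (X i j k)).
  { intros i j k. unfold X. apply epsilon_spec.
    apply (cell_pow_Imp h i j k Sf (- (3 + al)) eps K8); auto; lra. }
  set (W := int_cell al g h).
  assert (HW : forall i j k, Imp (fun p => ind (cell h i j k p) * omega al g p) (W i j k)).
  { intros. apply int_cell_Imp; lra. }
  set (U := fun i j k => epsilon (inhabits 0) (RI (fun p => if iszero i j k then 0 else ind (cell h i j k p) * kern al p))).
  assert (HU : forall i j k, RI (fun p => if iszero i j k then 0 else ind (cell h i j k p) * kern al p) (U i j k)).
  { intros i j k. unfold U. apply epsilon_spec. destruct (iszero i j k) eqn:E.
    - exists 0. apply RI_zero.
    - apply cell_kern_RI; auto; lra. }
  (* Near the origin the integrand is of order |p|^(eps - 3); far away the boundedness of [Sf]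
     leaves the decay of the kernel. *)
  destruct (Imp_exist (fun p => ind (oct p) * (-1 * Sf p * kern al p)) al eps K8 M) as [V HV]; auto; try lra.
  { apply (locint_pow oct (fun p => -1 * Sf p)); [apply Jset_oct|apply BUC_scal; auto|lra]. }
  { intros p _. rewrite Rabs_mult. pose proof (ind_bound (oct p)). rewrite (Rabs_right (ind _)) by lra.
    specialize (Snear p). replace (-1 * Sf p * kern al p) with (- (Sf p * kern al p)) by ring. rewrite Rabs_Ropp.
    pose proof (Rabs_pos (Sf p * kern al p)). nra. }
  { intros p _. rewrite !Rabs_mult, (Rabs_right (kern al p)) by apply Rle_ge, kern_nonneg.
    pose proof (ind_bound (oct p)). rewrite (Rabs_right (ind _)) by lra. rewrite (Rabs_left (-1)) by lra.
    specialize (HM p). pose proof (kern_nonneg al p). pose proof (Rabs_pos (Sf p)). fold (kern al p).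
    assert (- -1 * Rabs (Sf p) * kern al p <= M * kern al p) by (apply Rmult_le_compat_r; lra).
    assert (0 <= - -1 * Rabs (Sf p) * kern al p) by (repeat apply Rmult_le_pos; lra). nra. }
  assert (EV : V = -1 * sum3 N X + 8 * u x * int_D2 al L).
  { apply (Imp_eq_off (gridlines h N) _ _ _ _ HV
      (Imp_plus _ _ _ _ (Imp_scal (-1) _ _ (Imp_sum3 N (fun i j k p => ind (cell h i j k p) * (Sf p * kern al p)) X ltac:(intros; apply HX)))
        (Imp_scal (8 * u x) _ _ (int_D2_Imp al L ltac:(lra) HL)))).
    intros p Hp.
    rewrite (octant_split h N L (-1 * Sf p * kern al p) (8 * u x * kern al p) p); auto; try lia.
    - rewrite (sum3_ext N (fun i j k => ind (cell h i j k p) * (Sf p * kern al p)) (fun i j k => (Sf p * kern al p) * ind (cell h i j k p)))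
        by (intros; ring).
      rewrite sum3_scal. ring.
    - intros _ Hout. unfold Sf. rewrite (symdiff_outside ax bx ay by_ az bz u x L p); auto. ring. }
  assert (EF : frac_lap al u x = c3 al * V).
  { unfold frac_lap. f_equal. apply frac_transfer; auto. lra. }
  set (A := fun i j k => sum8 (fun m n s => wpsi g Sf (vertex h i j k m n s))).
  set (Q := sum8 (fun m n s => if (m || n || s)%bool then cg g m n s * wpsi g Sf (vertex h 0 0 0 m n s) else 0)).
  (* [wpsi g Sf] is [psi u g x] up to unfolding, so this is mere conversion. *)
  assert (ED : disc_op al g L N u x =
    - c3 al * (/ 8 * Q * W 0%nat 0%nat 0%nat + / 8 * sum3 N (fun i j k => if iszero i j k then 0 else A i j k * W i j k)
       - 8 * u x * int_D2 al L)) by reflexivity.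
  set (Y := fun i j k => if iszero i j k then 0 else / 8 * A i j k * W i j k - X i j k).
  (* The origin cell is skipped by the sum in [disc_op] but present in [sum3 N X]; it is taken out
     and estimated by itself. *)
  assert (ES : / 8 * sum3 N (fun i j k => if iszero i j k then 0 else A i j k * W i j k) + -1 * sum3 N X =
     sum3 N Y + -1 * X 0%nat 0%nat 0%nat).
  { rewrite <- (sum3_single N X) by lia. rewrite <- !sum3_scal, <- !sum3_plus.
    apply sum3_ext. intros i j k _ _ _. unfold Y. destruct (iszero i j k); ring. }
  assert (B1 : Rabs (X 0%nat 0%nat 0%nat) <= Cn * K8 * rpow h eps).
  { apply (Near h K8 _ _ Hh HK8 (HX 0%nat 0%nat 0%nat)).
    - intros p _. rewrite Rabs_mult. pose proof (ind_bound (cell h 0 0 0 p)). rewrite (Rabs_right (ind _)) by lra.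
      specialize (Snear p). pose proof (Rabs_pos (Sf p * kern al p)). nra.
    - intros p Hp. rewrite ind_false; [ring|]. intros Hc. apply cell_supn in Hc; auto. simpl in Hc. lra. }
  assert (B2 : Rabs (W 0%nat 0%nat 0%nat) <= Cw * 1 * rpow h (g - al)).
  { apply (NearW h 1 _ _ Hh ltac:(lra) (HW 0%nat 0%nat 0%nat)).
    - intros p _. unfold omega. replace (g - al - 3) with (g - (3 + al)) by ring.
      pose proof (rpow_nonneg (pnorm p) (g - (3 + al))). pose proof (ind_bound (cell h 0 0 0 p)).
      rewrite Rabs_right; nra.
    - intros p Hp. rewrite ind_false; [ring|]. intros Hc. apply cell_supn in Hc; auto. simpl in Hc. lra. }
  assert (B3 : Rabs Q <= 8 * (8 / 3 * (4 * K8 * (rpow h s * rpow h (- g))))).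
  { apply origin_vertices_bound; auto; lra. }
  (* In the origin cell the powers of h carrying gamma cancel, so the rate does not depend on the
     splitting parameter. *)
  assert (Eh : rpow h s * rpow h (- g) * rpow h (g - al) = rpow h eps).
  { rewrite <- !rpow_plus. f_equal. unfold s. ring. }
  assert (Eh' : rpow h s * rpow h (- al) = rpow h eps).
  { rewrite <- !rpow_plus. f_equal. unfold s. ring. }
  assert (B4 : Rabs (/ 8 * Q * W 0%nat 0%nat 0%nat) <= 32 / 3 * K8 * Cw * rpow h eps).
  { rewrite !Rabs_mult, (Rabs_right (/ 8)) by lra.
    replace (32 / 3 * K8 * Cw * rpow h eps) with
      (/ 8 * (8 * (8 / 3 * (4 * K8 * (rpow h s * rpow h (- g))))) * (Cw * 1 * rpow h (g - al))) by (rewrite <- Eh; field).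
    apply Rmult_le_compat; auto using Rabs_pos.
    - apply Rmult_le_pos; [lra|apply Rabs_pos].
    - apply Rmult_le_compat_l; lra. }
  assert (HU0 : forall i j k, 0 <= U i j k).
  { intros i j k. apply (RI_nonneg nil _ _ (HU i j k)). intros p _.
    destruct (iszero i j k); [lra|]. apply Rmult_le_pos; [apply ind_bound|apply kern_nonneg]. }
  assert (B5 : Rabs (sum3 N Y) <= Ce * K8 * Ck * rpow h eps).
  { eapply Rle_trans; [apply sum3_abs|].
    assert (P0 : 0 <= Ce * K8 * rpow h s) by (repeat apply Rmult_le_pos; auto using rpow_nonneg; lra).
    apply (Rle_trans _ (sum3 N (fun i j k => Ce * K8 * rpow h s * U i j k))).
    - apply sum3_le. intros i j k _ _ _. unfold Y. pose proof (HU i j k) as HUi. pose proof (HU0 i j k).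
      destruct (iszero i j k) eqn:E; [rewrite Rabs_R0; apply Rmult_le_pos; auto|].
      apply (CE Sf K8 h i j k (X i j k) (W i j k) (U i j k)); auto.
    - rewrite sum3_scal.
      apply (Rle_trans _ (Ce * K8 * rpow h s * (Ck * rpow h (- al)))).
      + apply Rmult_le_compat_l; auto. eapply Rle_trans; [apply Rle_abs|]. apply KS; auto.
      + right. rewrite <- Eh'. ring. }
  replace (frac_lap al u x - disc_op al g L N u x) with
    (c3 al * (/ 8 * Q * W 0%nat 0%nat 0%nat + sum3 N Y + - X 0%nat 0%nat 0%nat)).
  2:{ rewrite EF, ED, EV.
      transitivity (c3 al * (/ 8 * Q * W 0%nat 0%nat 0%nat + (sum3 N Y + -1 * X 0%nat 0%nat 0%nat))); [ring|].
      rewrite <- ES. ring. }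
  rewrite Rabs_mult.
  assert (B : Rabs (/ 8 * Q * W 0%nat 0%nat 0%nat + sum3 N Y + - X 0%nat 0%nat 0%nat) <= C0 * rpow h eps).
  { eapply Rle_trans; [apply Rabs_triang|]. rewrite Rabs_Ropp.
    eapply Rle_trans; [apply Rplus_le_compat_r, Rabs_triang|]. unfold C0. lra. }
  pose proof (Rmult_le_compat_l _ _ _ (Rabs_pos (c3 al)) B). pose proof (rpow_nonneg h eps). lra.
Qed.

Lemma Int_part_cases a : 0 < a < 2 -> (Int_part a = 0%Z /\ a < 1) \/ (Int_part a = 1%Z /\ 1 <= a).
Proof.
  intros Ha. destruct (base_Int_part a) as [H1 H2].
  assert (-1 < Int_part a)%Z by (apply lt_IZR; lra). assert (Int_part a < 2)%Z by (apply lt_IZR; lra).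
  assert (E : (Int_part a = 0 \/ Int_part a = 1)%Z) by lia. destruct E as [E|E]; rewrite E in *; [left|right]; split; auto; lra.
Qed.

Theorem theorem3 (alpha ax bx ay by_ az bz eps : R) (u : pt -> R) :
  0 < alpha < 2 ->
  ax < bx -> ay < by_ -> az < bz ->
  (forall p, ~ in_box_open ax bx ay by_ az bz p -> u p = 0) ->
  0 < eps <= 1 + Rfloor alpha - alpha ->
  Ck_s (Z.to_nat (Int_part alpha)) (alpha - Rfloor alpha + eps) u ->
  forall gamma, alpha < gamma <= 2 ->
  let L := Rmax (bx - ax) (Rmax (by_ - ay) (bz - az)) in
  exists C, C > 0 /\
    exists N0 : nat, forall N : nat, (N0 <= N)%nat ->
      forall x, in_box_open ax bx ay by_ az bz x ->
        Rabs (frac_lap alpha u x - disc_op alpha gamma L N u x) <= C * rpow (L / INR N) eps.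
Proof.
  intros Ha Hx Hy Hz U0 He HC gamma Hg L.
  assert (HR : 0 < eps <= 1 /\ alpha + eps <= 2 /\ exists K, regular u (alpha + eps) K).
  (* For alpha < 1 the function is Hölder with exponent alpha + eps <= 1. For alpha >= 1 its partial
     derivatives are Hölder with exponent alpha - 1 + eps <= 1, and [regular_C1] raises the order by
     one. Both give order alpha + eps. *)
  { unfold Rfloor in *. destruct (Int_part_cases alpha Ha) as [[E Ha']|[E Ha']]; rewrite E in *.
    - split; [lra|]. split; [lra|]. destruct HC as [_ HC].
      apply (regular_holder ax bx ay by_ az bz Hx Hy Hz); auto; [lra|].
      replace (alpha + eps) with (alpha - 0 + eps) by ring. exact HC.
    - split; [lra|]. split; [lra|].
      replace (alpha + eps) with (alpha - 1 + eps + 1) by ring.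
      apply (regular_C1 ax bx ay by_ az bz Hx Hy Hz); auto. lra. }
  destruct HR as [He1 [Hs [K HK]]].
  destruct (consistency alpha gamma eps ax bx ay by_ az bz u K Ha He1 Hs Hg Hx Hy Hz U0 HK) as [C [HCp H]].
  exists C. split; [auto|]. exists 1%nat. exact H.
Qed.
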